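(* Consider the control system $\dot x=f(t,x,u)$, $u(t)\in U$, $x(t_1)=x_1$ (the original system), where $f:\mathbb{R}\times\mathbb{R}^n\times\mathbb{R}^r\to\mathbb{R}^n$ is continuous together with its partial derivatives $f_x$ and $f_{xx}$, and $U\subset\mathbb{R}^r$ is nonempty and compact. Let $(\widehat x(\cdot),\widehat\mu_t)$ be an admissible pair on $[t_1,\widehat t_2]$ for the convexified system $\dot x=\langle\mu_t,f(t,x,u)\rangle$, $\mu_t\in\mathfrak{M}_U$, $x(t_1)=x_1$ (for $s=1$ below, $\widehat x$ is moreover given as a continuous function on $[t_1,\widehat t_2+\widehat\delta]$ for some $\widehat\delta>0$). Suppose that: (1) the set $\Lambda_s(\widehat x(\cdot),\widehat\mu_t)$ is empty for some $s\in\{-1,1\}$; (2) there exists a constant $L>0$ such that for all $t\in[t_1,\widehat t_2]$, $x\in\mathbb{R}^n$ and $u\in U$: $\|f_x(t,x,u)\|\le L(1+\|x\|)$; (3) the mapping $(t,x)\mapsto f(t,x,u)$ is uniformly continuous on compact sets, uniformly in $u\in U$. Then there exists $\delta>0$ such that for any $\varepsilon>0$ there exist a piecewise constant control $u_\varepsilon(\cdot)$ and a time $\tau_\varepsilon$ with $|\tau_\varepsilon-\widehat t_2|<\varepsilon$ such that the corresponding trajectory $x_\varepsilon(\cdot)$ of the original system satisfies: (1) $\|x_\varepsilon(\cdot)-\widehat x(\cdot)\|_{C([t_1,\max\{\widehat t_2,\tau_\varepsilon\}],\mathbb{R}^n)}<\varepsilon$; (2) $x_\varepsilon(\tau_\varepsilon)=\widehat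 x(\widehat t_2)$; (3) if $s=-1$, then $\tau_\varepsilon<\widehat t_2$; if $s=1$, then $\tau_\varepsilon>\widehat t_2$. Moreover, the control $u_\varepsilon(\cdot)$ can be chosen to be a convex combination of at most $n+1$ piecewise constant controls from the original system.
   Context: A control of the original system on $[t_1,t_2]$ is $u\in L_\infty([t_1,t_2],\mathbb{R}^r)$ with $u(t)\in U$ a.e.; the corresponding trajectory is the absolutely continuous $x$ with $\dot x(t)=f(t,x(t),u(t))$ a.e., $x(t_1)=x_1$. The constant $\delta$ in the conclusion does not appear elsewhere in it. A generalized control is a family $\{\mu_t\}_{t\in\mathbb{R}}$ of (Borel, regular) probability measures on $\mathbb{R}^r$ that is finite (there is a compact $K$ with $\operatorname{supp}\mu_t\subset K$ for a.e. $t$) and weakly measurable ($t\mapsto\langle\mu_t,g(t,u)\rangle=\int g(t,u)\,d\mu_t(u)$ is Lebesgue measurable for every continuous $g:\mathbb{R}\times\mathbb{R}^r\to\mathbb{R}^n$). $\mathfrak{M}_U$ is the set of generalized controls with $\operatorname{supp}\mu_t\subset U$ for a.e. $t$. An admissible pair of the convexified system on $[t_1,t_2]$ is $(x,\mu_t)$ with $\mu_t\in\mathfrak{M}_U$, $x$ absolutely continuous on $[t_1,t_2]$, $\dot x(t)=\langle\mu_t,f(t,x(t),u)\rangle$ a.e., $x(t_1)=x_1$. $H(t,x,\psi,u)=\langle\psi,f(t,x,u)\rangle$, $M(t,x,\psi)=\sup_{u\in U}H(t,x,\psi,u)$. For $s\in\{-1,1\}$, $\Lambda_s(\widehat x(\cdot),\widehat\mu_t)$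 is the set of all nonzero absolutely continuous $\psi:[t_1,\widehat t_2]\to(\mathbb{R}^n)^*$ with: $\dot\psi=-\psi\langle\widehat\mu_t,f_x(t,\widehat x,u)\rangle$ a.e.; $\langle\psi(t),\dot{\widehat x}(t)\rangle=M(t,\widehat x(t),\psi(t))$ a.e.; $M(\cdot,\widehat x(\cdot),\psi(\cdot))$ is continuous on $[t_1,\widehat t_2]$; and $sM(\widehat t_2,\widehat x(\widehat t_2),\psi(\widehat t_2))\le0$. *)

(* Defs.v *)
From HB Require Import structures.
From mathcomp Require Import all_boot all_order all_algebra.
From mathcomp Require Import all_classical all_reals all_analysis.

Set Implicit Arguments.
Unset Strict Implicit.
Unset Printing Implicit Defensive.

Import Order.TTheory GRing.Theory Num.Theory.
Import numFieldNormedType.Exports.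

Local Open Scope classical_set_scope.
Local Open Scope ring_scope.

(* Conventions.  Points of R^n and R^r are row vectors with the library's norm
   (the sup norm); every statement below is invariant under a change of norm.
   Covectors, the elements of the dual (R^n)^*, are column vectors, so that the
   pairing <psi, y> is (y *m psi) 0 0.  The library's Jacobian 'J g x acts on
   row vectors from the right, 'd g x v = v *m 'J g x, hence the covector
   psi o g'(x) is 'J g x *m psi.
   A function on an interval is a total function on R, of which only the values
   on that interval matter. *)

Section real_functions.
Context {R : realType}.

(* R with the sigma-algebra of Lebesgue (not only Borel) measurable sets *)
Definition lebesgueR := caratheodory_type ((@wlength R idfun)^*)%mu.

Definition lebesgue_measurable_fun m n (D : set R) (g : R -> 'M[R]_(m, n)) :=
  forall i j, measurable_fun (D : set lebesgueR)
                             ((fun t => g t i j) : lebesgueR -> R).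

Definition abs_continuous (V : normedModType R) (a b : R) (x : R -> V) :=
  forall e : R, 0 < e -> exists2 d : R, 0 < d &
    forall s : seq (R * R),
      all (fun p => [&& a <= p.1, p.1 <= p.2 & p.2 <= b]) s ->
      pairwise (fun p q => (p.2 <= q.1) || (q.2 <= p.1)) s ->
      \sum_(p <- s) (p.2 - p.1) < d ->
      \sum_(p <- s) `|x p.2 - x p.1| < e.

(* The end points are left out because the two-sided derivative there depends
   on values outside [a, b]. *)
Definition ae_derivative (V : normedModType R) (a b : R) (x dx : R -> V) :=
  {ae (@lebesgue_measure R), forall t, t \in `]a, b[ -> is_derive t 1 x (dx t)}.

Definition C_norm (V : normedModType R) (a b : R) (g : R -> V) : R :=
  sup [set `|g t| | t in `[a, b]].

Definition op_norm m n (A : 'M[R]_(m, n)) : R :=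
  sup [set `|v *m A| | v in [set v : 'rV[R]_m | `|v| <= 1]].

Definition piecewise_constant (V : Type) (a b : R) (u : R -> V) :=
  exists2 s : seq R, itv_partition a b s &
    forall i, (i < size s)%N -> exists c : V,
      forall t, t \in `]nth b (a :: s) i, nth b (a :: s) i.+1[ -> u t = c.

End real_functions.

Section generalized_controls.
Context {R : realType} (r : nat).

Definition borel_rV := g_sigma_algebraType (@open 'rV[R]_r).

Implicit Types (mu : probability borel_rV R) (mut : R -> probability borel_rV R).

Definition regular_measure mu := forall A : set borel_rV, measurable A ->
  mu A = ereal_inf [set mu V | V in [set V : set 'rV[R]_r | open V /\ A `<=` V]]
  /\
  mu A = ereal_sup [set mu K | K in [set K : set 'rV[R]_r | compact K /\ K `<=` A]].

Definition supp mu : set 'rV[R]_r :=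
  [set u | forall V : set 'rV[R]_r, open V -> V u -> (0 < mu V)%E].

(* <mu, g>, entrywise *)
Definition mean m n mu (g : 'rV[R]_r -> 'M[R]_(m, n)) : 'M[R]_(m, n) :=
  \matrix_(i, j) (\int[mu]_(u in setT) g u i j).

Definition finite_family mut := exists2 K : set 'rV[R]_r, compact K &
  {ae (@lebesgue_measure R), forall t, supp (mut t) `<=` K}.

Definition weakly_measurable (n : nat) mut :=
  forall g : R * 'rV[R]_r -> 'rV[R]_n, continuous g ->
    lebesgue_measurable_fun setT (fun t => mean (mut t) (fun u => g (t, u))).

(* n is the dimension of the state space *)
Definition generalized_control (n : nat) mut :=
  [/\ forall t, regular_measure (mut t), finite_family mut
    & weakly_measurable n mut].

Definition generalized_controls_in (n : nat) (U : set 'rV[R]_r) :=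
  [set mut | generalized_control n mut /\
     {ae (@lebesgue_measure R), forall t, supp (mut t) `<=` U}].

End generalized_controls.

Section control_systems.
Context {R : realType} (n r : nat).
Variable f : R -> 'rV[R]_n -> 'rV[R]_r -> 'rV[R]_n.
Variable U : set 'rV[R]_r.
Implicit Types (t : R) (x : 'rV[R]_n) (u : 'rV[R]_r) (psi : 'cV[R]_n).

Definition fx t x u : 'M[R]_n := 'J (fun y => f t y u) x.

Definition fxx t x u : 'rV[R]_n -> 'M[R]_n := 'd (fun y => fx t y u) x.

(* Continuity of fxx in the finite-dimensional space of linear maps is
   continuity of its value at each vector. *)
Definition continuous_with_fx_fxx :=
  [/\ continuous (fun p : R * 'rV[R]_n * 'rV[R]_r => f p.1.1 p.1.2 p.2),
      (forall t x u, differentiable (fun y => f t y u) x) /\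
      continuous (fun p : R * 'rV[R]_n * 'rV[R]_r => fx p.1.1 p.1.2 p.2)
    & (forall t x u, differentiable (fun y => fx t y u) x) /\
      forall v : 'rV[R]_n,
      continuous (fun p : R * 'rV[R]_n * 'rV[R]_r => fxx p.1.1 p.1.2 p.2 v)].

Definition unif_continuous_on_compacts :=
  forall C : set (R * 'rV[R]_n), compact C ->
  forall e : R, 0 < e -> exists2 d : R, 0 < d &
    forall u, U u -> forall p q : R * 'rV[R]_n, C p -> C q ->
      `|p - q| < d -> `|f p.1 p.2 u - f q.1 q.2 u| < e.

Definition control (a b : R) (u : R -> 'rV[R]_r) :=
  [/\ lebesgue_measurable_fun `[a, b] u,
      exists c : R,
        {ae (@lebesgue_measure R), forall t, t \in `[a, b] -> `|u t| <= c}
    & {ae (@lebesgue_measure R), forall t, t \in `[a, b] -> U (u t)}].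

Definition trajectory (a b : R) (x1 : 'rV[R]_n)
    (u : R -> 'rV[R]_r) (x : R -> 'rV[R]_n) :=
  [/\ abs_continuous a b x,
      ae_derivative a b x (fun t => f t (x t) (u t))
    & x a = x1].

Definition admissible_pair (a b : R) (x1 : 'rV[R]_n) (x : R -> 'rV[R]_n)
    (mut : R -> probability (@borel_rV R r) R) :=
  [/\ generalized_controls_in n U mut,
      abs_continuous a b x,
      ae_derivative a b x (fun t => mean (mut t) (f t (x t)))
    & x a = x1].

Definition pairing psi (y : 'rV[R]_n) : R := (y *m psi) 0 0.

Definition Hfun t x psi u : R := pairing psi (f t x u).

Definition Mfun t x psi : R := sup [set Hfun t x psi u | u in U].

Definition Lambda (s a b : R) (xh : R -> 'rV[R]_n)
    (muh : R -> probability (@borel_rV R r) R) : set (R -> 'cV[R]_n) :=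
  [set psi |
    [/\ exists2 t, t \in `[a, b] & psi t != 0,
        abs_continuous a b psi,
        ae_derivative a b psi
          (fun t => - (mean (muh t) (fx t (xh t)) *m psi t))
      & [/\ {ae (@lebesgue_measure R), forall t, t \in `]a, b[ ->
              pairing (psi t) (derive1 xh t) = Mfun t (xh t) (psi t)},
            {within `[a, b], continuous (fun t => Mfun t (xh t) (psi t))}
          & s * Mfun b (xh b) (psi b) <= 0]]].

Definition pc_control (a b : R) (u : R -> 'rV[R]_r) :=
  control a b u /\ piecewise_constant a b u.

(* u is on [a, b] a convex combination, with constant coefficients, of at most
   N piecewise constant controls *)
Definition convex_comb_pc_controls (N : nat) (a b : R) (u : R -> 'rV[R]_r) :=
  exists (k : nat) (alpha : 'I_k -> R) (v : 'I_k -> R -> 'rV[R]_r),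
    [/\ (k <= N)%N,
        (forall i, 0 <= alpha i) /\ \sum_i alpha i = 1,
        forall i, pc_control a b (v i)
      & forall t, t \in `[a, b] -> u t = \sum_i alpha i *: v i t].

End control_systems.

(* Main.v *)
(* For u in U let dV_u = (f(t, xh, u) dt - dxh) Psi, where Psi is the transition
   matrix, up to t2, of the system linearized along the relaxed pair: using u
   with a small intensity between alpha and beta moves the end point, to first
   order, in the direction V_u(beta) - V_u(alpha).  Let y be a limit of the slopes
   (xh(t2) - xh(t2 - h)) / h.  If a covector separates - s y from the cone of these
   directions, then the corresponding solution of the adjoint equation belongs to
   Lambda_s.  Since Lambda_s is empty, a ball around - s y lies in the closure of
   the cone.  At the time t2 + s h the relaxed trajectory is displaced by about
   s h y, which variations with intensities of order h can compensate.

   The relaxed control is imitated on a fine grid by constant controls used in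
   the proportions of a convex combination of the pairs (f, f_x), and in every
   cell a fraction gamma_j of the time is given to the j-th variation.  The
   difference of the trajectories of two families of intensities is linear in
   gamma - gamma' up to an error which is small compared with |gamma - gamma'|,
   so the end point is hit exactly by a contraction argument. *)

(* The contraction shapes the proof: closeness of trajectories is not enough, their difference must
   be linear in the intensities with an error relative to |gamma - gamma'|. Hence f and f_x are
   imitated with the same weights, and f is used through strict differentiability near xh. An
   absolute imitation error remains only for one reference family of intensities; it is harmless
   because the tolerances and the displacement h of the end time are fixed first and the mesh
   afterwards, so fine that this error is a small fraction of h. The mean of f_x along the relaxed
   pair is only measurable in t. It enters through the increments of a primitive W; the linear
   equations for Psi and V are relations between increments, solved by the same theorem on Euler
   polygons ([sewing]) as the ordinary equations. Outside the unit ball around xh(t) the field takes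
   its value at the nearest point ([clipped]), which gives bounds for all states; the trajectories
   obtained stay in that ball. Limits are taken along an ultrafilter on the integers, which makes
   all bounded sequences converge at once. *)
Require Import Defs.
From mathcomp Require Import all_boot all_order all_algebra.
From mathcomp Require Import all_classical all_reals all_analysis.
From mathcomp Require Import measurable_realfun ring lra.

Set Implicit Arguments.
Unset Strict Implicit.
Unset Printing Implicit Defensive.

Import Order.TTheory GRing.Theory Num.Theory.
Import numFieldNormedType.Exports.

Local Open Scope classical_set_scope.
Local Open Scope ring_scope.

(** * Linear combinations *)

(* Linear combinations of vectors are compared coefficient by coefficient: the
   tactic [lmod] reduces an equation in a module to equations between scalars. *)
Inductive lmod_expr (R : Type) :=
  LVar of nat | L0 | LAdd of lmod_expr R & lmod_expr R
  | LOpp of lmod_expr R | LScale of R & lmod_expr R.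

Section lmod_expr.
Context {R : realType} {V : lmodType R}.

Fixpoint lmod_eval (env : seq V) (e : lmod_expr R) : V :=
  match e with
  | LVar i => nth 0 env i
  | L0 => 0
  | LAdd e1 e2 => lmod_eval env e1 + lmod_eval env e2
  | LOpp e1 => - lmod_eval env e1
  | LScale c e1 => c *: lmod_eval env e1
  end.

Fixpoint lmod_coef (e : lmod_expr R) (i : nat) : R :=
  match e with
  | LVar j => if eqn i j then 1 else 0
  | L0 => 0
  | LAdd e1 e2 => lmod_coef e1 i + lmod_coef e2 i
  | LOpp e1 => - lmod_coef e1 i
  | LScale c e1 => c * lmod_coef e1 i
  end.

Fixpoint lmod_coefs_eq (k : nat) (e1 e2 : lmod_expr R) : Prop :=
  match k with
  | 0%N => True
  | k'.+1 => lmod_coef e1 k' = lmod_coef e2 k' /\ lmod_coefs_eq k' e1 e2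
  end.

Lemma lmod_evalE env e :
  lmod_eval env e = \sum_(i < size env) lmod_coef e i *: nth 0 env i.
Proof.
elim: e => [j| |e1 IH1 e2 IH2|e IH|c e IH] /=; rewrite ?IH1 ?IH2 ?IH.
- have [ji|ij] := ltnP j (size env); last first.
    rewrite nth_default// big1// => i _.
    case: eqnP => [iE|_]; last by rewrite scale0r.
    by move: (ltn_ord i); rewrite iE ltnNge ij.
  rewrite (bigD1 (Ordinal ji))//= -[eqn j j]/(j == j) eqxx scale1r big1 ?addr0//.
  move=> i; rewrite -val_eqE /= => ij.
  by rewrite -[eqn i j]/(i == j :> nat) (negbTE ij) scale0r.
- by rewrite big1// => i _; rewrite scale0r.
- by rewrite -big_split; apply: eq_bigr => i _; rewrite scalerDl.
- by rewrite -sumrN; apply: eq_bigr => i _; rewrite scaleNr.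
- by rewrite scaler_sumr; apply: eq_bigr => i _; rewrite scalerA.
Qed.

Lemma lmod_coefsP env e1 e2 :
  lmod_coefs_eq (size env) e1 e2 -> lmod_eval env e1 = lmod_eval env e2.
Proof.
move=> H; rewrite !lmod_evalE; apply: eq_bigr => i _; congr (_ *: _).
move: (ltn_ord i); move: (nat_of_ord i) => {}i.
elim: (size env) H => //= k IH [ek ekk]; rewrite ltnS leq_eqVlt => /predU1P[->//|].
exact: IH.
Qed.

End lmod_expr.

Ltac lmod_index x env :=
  lazymatch env with
  | x :: _ => constr:(0%N)
  | _ :: ?l => let i := lmod_index x l in constr:(S i)
  end.
Ltac lmod_add x env :=
  match env with
  | context [x :: _] => env
  | _ => constr:(x :: env)
  end.
Ltac lmod_atoms e env :=
  lazymatch e with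
  | ?a + ?b => let env := lmod_atoms a env in lmod_atoms b env
  | - ?a => lmod_atoms a env
  | ?c *: ?a => lmod_atoms a env
  | 0 => env
  | _ => lmod_add e env
  end.
Ltac lmod_reify R e env :=
  lazymatch e with
  | ?a + ?b => let a := lmod_reify R a env in let b := lmod_reify R b env in
               constr:(@LAdd R a b)
  | - ?a => let a := lmod_reify R a env in constr:(@LOpp R a)
  | ?c *: ?a => let a := lmod_reify R a env in constr:(@LScale R c a)
  | 0 => constr:(@L0 R)
  | _ => let i := lmod_index e env in constr:(@LVar R i)
  end.
Ltac lmod R :=
  lazymatch goal with
  | |- @eq ?V ?a ?b =>
    let env := lmod_atoms a (@nil V) in
    let env := lmod_atoms b env in
    let ea := lmod_reify (R : Type) a env in
    let eb := lmod_reify (R : Type) b env in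
    refine (@lmod_coefsP R _ env ea eb _);
    cbv [lmod_coefs_eq lmod_coef size eqn];
    repeat split; try ring
  end.

(* [lra] is slow in large contexts: [hclear] leaves it only the comparisons that
   are generalized.  It would also clear section hypotheses of the form
   [is_true _], which is why these are stated below as [_ /\ True]. *)
Ltac hclear := repeat match goal with
  | H : is_true _ |- _ => clear H | H : _ = _ |- _ => clear H end.

(** * Absolutely continuous functions *)

Section calculus.
Context {R : realType}.

(** Multiplying the difference quotient by [q - t] removes the division, so that [q = t] needs no
    exclusion and derivatives combine directly with estimates of increments. *)
Lemma is_deriveP (V : normedModType R) (x : R -> V) (t : R) (v : V) :
  is_derive t 1 x v <->
  forall e : R, 0 < e -> exists2 d : R, 0 < d &
    forall q, `|q - t| < d -> `|x q - x t - (q - t) *: v| <= e * `|q - t|.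
Proof.
split.
  case=> dx dv e e0.
  have : h^-1 *: (x (h *: 1 + t) - x t) @[h --> 0^'] --> v.
    by rewrite -dv; exact: dx.
  move/cvgrPdist_le => /(_ e e0) [d /= d0 Hd].
  exists d => // q qtd.
  have [->|qt] := eqVneq q t; first by rewrite !subrr scale0r subr0 !normr0 mulr0.
  have qt0 : q - t != 0 by rewrite subr_eq0.
  have := Hd (q - t); rewrite /ball_ /= sub0r normrN => /(_ qtd qt0).
  rewrite [(q - t)%:A]mulr1 subrK => H.
  have -> : x q - x t - (q - t) *: v =
     - ((q - t) *: (v - (q - t)^-1 *: (x q - x t))).
    by rewrite scalerBr scalerA divff// scale1r opprB.
  by rewrite normrN normrZ mulrC ler_wpM2r.
move=> H.
have dx : h^-1 *: (x (h *: 1 + t) - x t) @[h --> 0^'] --> v.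
  apply/cvgrPdist_le => e e0.
  have [d d0 Hd] := H e e0.
  exists d => //= h; rewrite /ball_ /= sub0r normrN => hd h0.
  rewrite [h%:A]mulr1.
  have := Hd (h + t); rewrite addrK => /(_ hd) => H2.
  have -> : v - h^-1 *: (x (h + t) - x t) =
      - (h^-1 *: (x (h + t) - x t - h *: v)).
    by rewrite [in RHS]scalerBr scalerA mulVf// scale1r opprB.
  by rewrite normrN normrZ normfV ler_pdivrMl ?normr_gt0// mulrC.
split; first by apply/cvg_ex; exists v.
by apply/cvg_lim.
Qed.

(** Continuous induction, in place of a subdivision obtained by compactness of [[a, b]]: points
    satisfying [Q] approach their supremum from the left, and the local step at the supremum carries
    [Q] beyond it. *)
Lemma real_induction (a b : R) (Q : R -> Prop) : a <= b -> Q a ->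
  (forall t, a <= t <= b -> exists2 d : R, 0 < d & forall p q,
     a <= p -> p <= t -> t <= q -> q <= b -> t - d < p -> q < t + d ->
     Q p -> Q q) ->
  Q b.
Proof.
move=> ab Qa H.
pose S := [set t | a <= t <= b /\ Q t].
have Sa : S a by split; rewrite ?lexx.
have Sub : has_sup S.
  by split; [exists a | exists b => t [/andP[]]].
have ac : a <= sup S by apply: ub_le_sup => //; exact: Sub.2.
have cb : sup S <= b by apply: ge_sup; [exists a | move=> t [/andP[]]].
have [|d d0 Hd] := H (sup S); first by rewrite ac.
have [p Sp pd] := sup_adherent d0 Sub.
have pc : p <= sup S by apply: ub_le_sup => //; exact: Sub.2.
have [/andP[ap _] Qp] := Sp.
have Qq q : sup S <= q -> q <= b -> q < sup S + d -> Q q.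
  by move=> cq qb qd; apply: (Hd p q).
have [bc|bc] := ltP b (sup S + d); first exact: Qq.
have : sup S + d / 2 <= sup S.
  apply: ub_le_sup; first exact: Sub.2.
  split; last by apply: Qq; lra.
  by apply/andP; split; lra.
lra.
Qed.

(* The points without derivative are covered by an open set of small measure, on
   which absolute continuity takes over; the other steps are bounded by the
   derivative at a nearby point. *)
Lemma abs_continuous_mvi (V : normedModType R) (a b : R) (x : R -> V)
    (v : V) (k : R) :
  a <= b -> 0 <= k -> abs_continuous a b x ->
  {ae (@lebesgue_measure R), forall t, t \in `]a, b[ ->
     exists2 w, is_derive t 1 x w & `|w - v| <= k} ->
  `|x b - x a - (b - a) *: v| <= k * (b - a).
Proof.
move=> ab k0 acx [A [mA A0 HA]].
apply/ler_addgt0Pr => e0 e00.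
(* The final error is [e * (b - a)] from the slopes and twice [e] from the exceptional set: once for
   the increments of [x], once for [v] times the total length. *)
pose e := e0 / (b - a + 2).
have e_gt0 : 0 < e by rewrite divr_gt0// ltr_wpDl// subr_ge0.
have [d d0 Hd] := acx e e_gt0.
pose d' := Order.min d (e / (`|v| + 1)).
have v1 : 0 < `|v| + 1 by rewrite ltr_wpDl.
have d'0 : 0 < d' by rewrite /d' lt_min d0 divr_gt0.
pose B := A `|` [set a] `|` [set b].
have mB : measurable B by apply: measurableU => //; exact: measurableU.
have B0 : lebesgue_measure B = 0%E.
  apply/eqP; rewrite eq_le measure_ge0 andbT.
  apply: (le_trans (measureU2 _ _ _)) => //.
    exact: measurableU.
  rewrite [X in (_ + X)%E](_ : _ = 0%E) ?adde0; last exact: lebesgue_measure_set1.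
  apply: (le_trans (measureU2 _ _ _)) => //.
  rewrite [X in (_ + X)%E](_ : _ = 0%E) ?adde0; last exact: lebesgue_measure_set1.
  by rewrite [X in (X <= _)%E](_ : _ = 0%E).
have [|O [oO BO OB]] := lebesgue_regularity_outer mB _ d'0.
  by apply: (@le_lt_trans _ _ 0%E) => //; rewrite -B0.
have mO : measurable O by exact: open_measurable.
have Od : (lebesgue_measure O < d'%:E)%E.
  have OE : O = (O `\` B) `|` B by rewrite setUC setDUK.
  rewrite OE; apply: (le_lt_trans (measureU2 _ _ _)) => //.
    exact: measurableD.
  by rewrite [X in (_ + X)%E](_ : _ = 0%E) ?adde0.
(* [s] records the steps made inside [O]. The measure of [O] controls their total length; their
   increments are kept as a sum until the end, when absolute continuity bounds them all at once. *)
pose Q t := exists s : seq (R * R),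
  [/\ all (fun p => [&& a <= p.1, p.1 <= p.2 & p.2 <= t]) s,
      pairwise (fun p q => (p.2 <= q.1) || (q.2 <= p.1)) s,
      ((\sum_(p <- s) (p.2 - p.1))%:E <= lebesgue_measure (O `&` `[a, t]))%E
    & `|x t - x a - (t - a) *: v| <= (k + e) * (t - a) +
       \sum_(p <- s) `|x p.2 - x p.1| + `|v| * \sum_(p <- s) (p.2 - p.1)].
have : Q b.
  apply: (@real_induction a b) => //.
    by exists [::]; split => //; rewrite ?big_nil// !subrr scale0r subr0 normr0 !mulr0 !addr0.
  move=> t /andP[at_ tb].
  have [tO|tO] := pselect (O t).
    have /nbhs_ballP[r /= r0 Hr] : nbhs t O by apply: open_nbhs_nbhs; split.
    exists r => // p q ap pt tq qb tp qt [s [s1 s2 s3 s4]].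
    exists ((p, q) :: s); split => /=.
    - rewrite ap (le_trans pt tq) lexx /=.
      by apply: sub_all s1 => i /and3P[-> -> /= i2]; rewrite (le_trans i2)// (le_trans pt).
    - rewrite s2 andbT; apply: sub_all s1 => i /and3P[_ _ ->].
      by rewrite orbT.
    - rewrite big_cons EFinD.
      have pqE : ((q - p)%:E = lebesgue_measure (`]p, q] : set R))%E.
        by rewrite lebesgue_measure_itv/= lte_fin; case: ltgtP (le_trans pt tq) => // ->; rewrite subrr.
      rewrite pqE addeC.
      apply: (le_trans (leeD s3 (lexx _))).
      rewrite -measureU//=.
      + apply: le_measure; rewrite ?inE.
        * by apply: measurableU => //; exact: measurableI.
        * exact: measurableI.
        move=> z [[Oz]|]/=; rewrite !in_itv/= => /andP[z1 z2].
          by split => //; rewrite z1 (le_trans z2)// (le_trans pt).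
        split; last by rewrite z2 andbT (le_trans ap)// ltW.
        apply: Hr; rewrite /ball/= ltr_norml; move: tp qt z1 z2 pt tq; hclear => *.
        by apply/andP; split; lra.
      + exact: measurableI.
      + rewrite -subset0 => z [[_ /=]]; rewrite !in_itv /= => /andP[_ zp] /andP[pz _].
        by move: (le_lt_trans zp pz); rewrite ltxx.
    - rewrite !big_cons.
      have -> : x q - x a - (q - a) *: v = (x p - x a - (p - a) *: v) + (x q - x p) - (q - p) *: v.
        by lmod R.
      apply: (le_trans (ler_normB _ _)).
      apply: (le_trans (lerD (ler_normD _ _) (lexx _))).
      have qp : 0 <= q - p by rewrite subr_ge0 (le_trans pt).
      rewrite normrZ /= (ger0_norm qp).
      have : (k + e) * (p - a) <= (k + e) * (q - a).
        by rewrite ler_wpM2l ?addr_ge0 ?(ltW e_gt0)// lerD2r (le_trans pt).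
      by move: s4; hclear; lra.
  have tab : t \in `]a, b[.
    rewrite in_itv/= !lt_neqAle at_ tb !andbT; apply/andP; split; apply/eqP => tE; apply: tO; apply: BO.
      by left; right.
    by right.
  have [w /is_deriveP dw wv] : exists2 w, is_derive t 1 x w & `|w - v| <= k.
    apply: contrapT => H; apply: tO; apply: BO; left; left; apply: HA => /= H2.
    exact: H (H2 tab).
  have [r r0 Hr] := dw e e_gt0.
  exists r => // p q ap pt tq qb tp qt [s [s1 s2 s3 s4]].
  exists s; split => //.
  - by apply: sub_all s1 => i /and3P[-> -> /= i2]; rewrite (le_trans i2)// (le_trans pt).
  - apply: (le_trans s3); apply: le_measure; rewrite ?inE; [exact: measurableI | exact: measurableI |].
    move=> z /= [Oz]; rewrite !in_itv /= => /andP[z1 z2]; split => //.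
    by rewrite z1 (le_trans z2)// (le_trans pt).
  - have Hp := Hr p; have Hq := Hr q.
    rewrite ltr_norml in Hp; rewrite ltr_norml in Hq.
    have pt0 : p - t <= 0 by rewrite subr_le0.
    have qt0 : 0 <= q - t by rewrite subr_ge0.
    have {}Hp : `|x p - x t - (p - t) *: w| <= e * (t - p).
      rewrite -(opprB p) -(ler0_norm pt0); apply: Hp.
      by move: tp pt d'0; hclear => *; apply/andP; split; lra.
    have {}Hq : `|x q - x t - (q - t) *: w| <= e * (q - t).
      rewrite -{2}(ger0_norm qt0); apply: Hq.
      by move: qt tq r0; hclear => *; apply/andP; split; lra.
    have E : x q - x a - (q - a) *: v = (x p - x a - (p - a) *: v) +
      (x q - x t - (q - t) *: w) - (x p - x t - (p - t) *: w) + (q - p) *: (w - v).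
      by lmod R.
    rewrite E.
    apply: (le_trans (ler_normD _ _)).
    apply: (le_trans (lerD (ler_normB _ _) (lexx _))).
    apply: (le_trans (lerD (lerD (ler_normD _ _) (lexx _)) (lexx _))).
    have qp : 0 <= q - p by rewrite subr_ge0 (le_trans pt).
    rewrite normrZ (ger0_norm qp).
    have : (q - p) * `|w - v| <= (q - p) * k by rewrite ler_wpM2l.
    by move: s4 Hp Hq; hclear; lra.
move=> [s [s1 s2 s3 s4]].
have sd : \sum_(p <- s) (p.2 - p.1) < d'.
  rewrite -lte_fin; apply: le_lt_trans Od; apply: (le_trans s3).
  by apply: le_measure => [||z []//]; rewrite inE//; exact: measurableI.
have sd1 : \sum_(p <- s) (p.2 - p.1) < d by apply: (lt_le_trans sd); rewrite ge_min lexx.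
have sd2 : \sum_(p <- s) (p.2 - p.1) <= e / (`|v| + 1).
  by apply: (le_trans (ltW sd)); rewrite ge_min lexx orbT.
have se := Hd s s1 s2 sd1.
have vs : `|v| * \sum_(p <- s) (p.2 - p.1) <= e.
  apply: (@le_trans _ _ (`|v| * (e / (`|v| + 1)))); first exact: ler_wpM2l.
  by rewrite mulrCA ger_pMr// ler_pdivrMr// mul1r lerDl.
have ba2 : 0 < b - a + 2 by move: ab; hclear; lra.
have eE : e * (b - a + 2) = e0 by rewrite mulfVK// gt_eqF.
by apply: (le_trans s4); rewrite -eE; move: se vs; hclear; lra.
Qed.

End calculus.

(** * Differential equations *)

Section sewing.
Context {R : realType}.

Lemma ler_telescope (V : normedModType R) (g : nat -> V) (c : nat -> R) i j :
  (i <= j)%N ->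
  (forall k, (i <= k < j)%N -> `|g k.+1 - g k| <= c k.+1 - c k) ->
  `|g j - g i| <= c j - c i.
Proof.
move=> ij; rewrite -(subnKC ij); move: (j - i)%N => {ij}.
elim=> [|d IH] H; first by rewrite addn0 !subrr normr0.
rewrite addnS.
have -> : g (i + d).+1 - g i = (g (i + d).+1 - g (i + d)%N) + (g (i + d)%N - g i).
  by rewrite addrA subrK.
apply: (le_trans (ler_normD _ _)).
have -> : c (i + d).+1 - c i = (c (i + d).+1 - c (i + d)%N) + (c (i + d)%N - c i).
  by rewrite addrA subrK.
apply: lerD; first by apply: H; rewrite leq_addr addnS ltnSn.
by apply: IH => k /andP[ik kd]; apply: H; rewrite ik addnS ltnW.
Qed.

Lemma mx_norm_le m n (A : 'M[R]_(m, n)) (e : R) : 0 <= e ->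
  (forall i j, `|A i j| <= e) -> `|A| <= e.
Proof.
move=> e0 H; rewrite [leLHS]/Num.Def.normr/= mx_normrE.
by apply: bigmax_le => // -[i j] _; exact: H.
Qed.

Lemma mx_entry_le m n (A : 'M[R]_(m, n)) i j : `|A i j| <= `|A|.
Proof.
rewrite [leRHS]/Num.Def.normr/= mx_normrE.
exact: (le_bigmax _ (fun ij : 'I_m * 'I_n => `|A ij.1 ij.2|) (i, j)).
Qed.

(** Bolzano-Weierstrass without subsequences: the ultrafilter decides for every real [c] whether an
    entry is eventually at least [c], and the supremum of these [c] is the limit. The same
    ultrafilter serves for all sequences. *)
Lemma bounded_ultra_lim (T : Type) (F : set_system T) m n
    (u : T -> 'M[R]_(m, n)) (B : R) :
  UltraFilter F -> (forall x, `|u x| <= B) ->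
  exists l : 'M[R]_(m, n), forall e : R, 0 < e -> F [set x | `|u x - l| <= e].
Proof.
move=> UF uB.
have H i j : exists l : R, forall e : R, 0 < e -> F [set x | `|u x i j - l| <= e].
  have [l Hl] : exists l : R, forall e : R, 0 < e -> F [set x | l - e < u x i j < l + e].
    pose S := [set c : R | F [set x | c <= u x i j]].
    have SB : S (- B).
      apply: (filterS _ filterT) => x _ /=.
      by have := mx_entry_le (u x) i j; rewrite ler_norml => /andP[+ _]; apply: le_trans; rewrite lerN2.
    have Bub : ubound S B.
      move=> c Sc; rewrite leNgt; apply/negP => Bc.
      apply: (@filter_not_empty _ F); apply: filterS Sc => x /= cx.
      have := mx_entry_le (u x) i j; rewrite ler_norml => /andP[_ xu].
      have := lt_le_trans Bc (le_trans cx (le_trans xu (uB x))).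
      by rewrite ltxx.
    have hS : has_sup S by split; [exists (- B)|exists B].
    exists (sup S) => e e0.
    have [c Sc ce] := sup_adherent e0 hS.
    have nS : F (~` [set x | sup S + e <= u x i j]).
      case: (in_ultra_setVsetC [set x | sup S + e <= u x i j] UF) => // FS.
      have : sup S + e <= sup S by apply: ub_le_sup => //; exact: hS.2.
      by rewrite gerDl leNgt e0.
    apply: filterS (filterI Sc nS) => x /= [cx /negP]; rewrite -ltNge => ->.
    by rewrite (lt_le_trans ce cx).
  exists l => e e0; apply: filterS (Hl e e0) => x /= /andP[x1 x2].
  by rewrite ler_norml; apply/andP; split; move: x1 x2; clear; lra.
have {}H : forall i, exists f : 'I_n -> R, forall j e, 0 < e -> F [set x | `|u x i j - f j| <= e].
  by move=> i; have [f Hf] := choice (H i); exists f.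
have [f Hf] := choice H.
exists (\matrix_(i, j) f i j) => e e0.
have HF : F [set x | forall p : 'I_m * 'I_n, `|u x p.1 p.2 - f p.1 p.2| <= e].
  by apply: filter_forall => -[i j]; exact: Hf.
apply: filterS HF => x /= H2.
by apply: mx_norm_le; [exact: ltW|move=> i j; rewrite !mxE; exact: (H2 (i, j))].
Qed.

(* With [K s y q = q *: g s y] the last property is the differential equation
   [y' = g t y]; with [K s y q = W q *m y] it is [dy = dW y].  The solution is a
   limit of Euler polygons along an ultrafilter. *)
Theorem sewing m n (a b C : R) (K : R -> 'M[R]_(m, n) -> R -> 'M[R]_(m, n))
    (y0 : 'M[R]_(m, n)) :
  a < b -> 0 <= C ->
  (forall s y p q, a <= s <= b -> a <= p -> p <= q -> q <= b ->
     `|K s y q - K s y p| <= C * (q - p) * (1 + `|y|)) ->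
  (forall w, 0 < w -> exists2 d, 0 < d & forall s y p q z,
     a <= s <= b -> a <= p -> p <= q -> q <= b ->
     `|p - s| < d -> `|q - s| < d -> `|z - y| < d ->
     `|K p z q - K p z p - (K s y q - K s y p)| <= w * (q - p)) ->
  exists y : R -> 'M[R]_(m, n), [/\ y a = y0,
    (exists2 L, 0 <= L & forall p q, a <= p -> p <= q -> q <= b ->
        `|y q - y p| <= L * (q - p)) &
    forall w, 0 < w -> exists2 d, 0 < d & forall s p q,
     a <= s <= b -> a <= p -> p <= q -> q <= b ->
     `|p - s| < d -> `|q - s| < d ->
     `|y q - y p - (K s (y s) q - K s (y s) p)| <= w * (q - p)].
Proof.
move=> ab C0 Kgrow Kapp.
pose V := 'M[R]_(m, n).
pose h N : R := (b - a) / N.+1%:R.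
have ba0 : 0 < b - a by rewrite subr_gt0.
have h0 N : 0 < h N by rewrite divr_gt0.
have hN N : h N * N.+1%:R = b - a by rewrite mulfVK.
have hlim e : 0 < e -> exists M, forall N, (M <= N)%N -> h N < e.
  move=> e0; exists (Num.truncn ((b - a) / e)).+1 => //= N /= HN.
  rewrite /h ltr_pdivrMr// -ltr_pdivrMl// mulrC.
  apply: (lt_le_trans (truncnS_gt _)); rewrite ler_nat.
  by rewrite (leq_trans HN).
clearbody h.
pose t N k : R := a + k%:R * h N.
have tS N k : t N k.+1 = t N k + h N by rewrite /t -addn1 natrD mulrDl mul1r addrA.
have tmono N i j : (i <= j)%N -> t N i <= t N j.
  by move=> ij; rewrite /t lerD2l ler_pM2r// ler_nat.
have ta N k : a <= t N k by rewrite /t lerDl mulr_ge0// ltW.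
have tb N k : (k <= N.+1)%N -> t N k <= b.
  move=> kN; rewrite /t -lerBrDl -(hN N) mulrC ler_pM2l// ler_nat//.
pose E := fix E N k : V := if k is k'.+1 then
  E N k' + (K (t N k') (E N k') (t N k'.+1) - K (t N k') (E N k') (t N k')) else y0.
have ES N k : E N k.+1 - E N k = K (t N k) (E N k) (t N k.+1) - K (t N k) (E N k) (t N k).
  by rewrite /= addrC addKr.
(* Discrete Gronwall bound: an Euler step multiplies [1 + |E|] by at most [1 + C * h], and at most
   [N.+1] steps of total length [b - a] are made. *)
pose B := expR (C * (b - a)) * (1 + `|y0|).
have B0 : 0 < B by rewrite mulr_gt0// ?expR_gt0// ltr_pwDl.
have Estep N k : (k <= N)%N -> `|E N k.+1 - E N k| <= C * h N * (1 + `|E N k|).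
  move=> kN; rewrite ES.
  have tk : t N k <= t N k.+1 by rewrite tS lerDl ltW.
  apply: (le_trans (Kgrow _ _ _ _ _ _ tk _)); rewrite ?ta ?tb//.
  - exact: ltnW.
  - by rewrite tS [t N k + _]addrC addrK.
have EB N k : (k <= N.+1)%N -> 1 + `|E N k| <= B.
  move=> kN.
  have Ek : 1 + `|E N k| <= (1 + C * h N) ^+ k * (1 + `|y0|).
    elim: k kN => [|k IH] kN; first by rewrite expr0 mul1r.
    have {IH}Ik := IH (ltnW kN).
    rewrite exprS -mulrA.
    have s1 := Estep N k kN.
    have -> : E N k.+1 = E N k + (E N k.+1 - E N k) by rewrite addrC subrK.
    apply: (@le_trans _ _ ((1 + C * h N) * (1 + `|E N k|))); last first.
      by rewrite ler_wpM2l// addr_ge0// mulr_ge0// ltW.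
    have := ler_normD (E N k) (E N k.+1 - E N k).
    move: s1; clear; lra.
  apply: (le_trans Ek); rewrite /B ler_pM2r; last by rewrite ltr_pwDl.
  have Ch : 0 <= C * h N by rewrite mulr_ge0// ltW.
  apply: (@le_trans _ _ ((1 + C * h N) ^+ N.+1)).
    by rewrite ler_weXn2l// lerDl.
  have -> : C * (b - a) = N.+1%:R * (C * h N) by rewrite -(hN N); ring.
  rewrite expRM_natl.
  by rewrite lerXn2r ?nnegrE ?expR_ge0 ?addr_ge0// expR_ge1Dx.
pose L := C * B.
have L0 : 0 <= L by rewrite mulr_ge0// ltW.
have ELip N i j : (i <= j)%N -> (j <= N.+1)%N ->
    `|E N j - E N i| <= L * t N j - L * t N i.
  move=> ij jN; apply: (@ler_telescope _ _ (fun k => L * t N k)) => // k /andP[ik kj].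
  have kN : (k <= N)%N by rewrite -ltnS (leq_trans kj).
  apply: (le_trans (Estep _ _ kN)).
  rewrite -mulrBr tS [t N k + _]addrC addrK /L -[leRHS]mulrA [B * _]mulrC mulrA.
  rewrite ler_wpM2l//; first by rewrite mulr_ge0// ltW.
  by rewrite EB// ltnW.
pose k N x := Num.truncn ((x - a) / h N).
have kP N x : a <= x -> t N (k N x) <= x < t N (k N x) + h N.
  move=> ax; have : 0 <= (x - a) / h N by rewrite divr_ge0// ?subr_ge0// ltW.
  move=> /truncn_itv; rewrite -/(k N x) => /andP[].
  rewrite ler_pdivlMr// ltr_pdivrMr// /t => k1 k2.
  apply/andP; split; first by rewrite -lerBrDl.
  by rewrite -addrA -ltrBlDl (lt_le_trans k2)// -addn1 natrD mulrDl mul1r.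
have kN N x : a <= x -> x <= b -> (k N x <= N.+1)%N.
  move=> ax xb; have /andP[k1 _] := kP N x ax.
  have := le_trans k1 xb.
  by rewrite /t -lerBrDl -(hN N) mulrC ler_pM2l// ler_nat.
have kmono N x z : x <= z -> (k N x <= k N z)%N.
  by move=> xz; apply: le_truncn; rewrite ler_pM2r ?invr_gt0// lerD2r.
have [UF [UFu UFoo]] := ultraFilterLemma (@eventually_filter).
(* The ultrafilter yields the limit of the polygons at every [x] at once, without a diagonal
   extraction. *)
have /choice[y Hy] : forall x, exists l : V, a <= x -> x <= b -> forall e : R, 0 < e ->
    UF [set N | `|E N (k N x) - l| <= e].
  move=> x.
  have [ax|ax] := boolP (a <= x); last by exists 0.
  have [xb|xb] := boolP (x <= b); last by exists 0.
  have [|l Hl] := @bounded_ultra_lim _ UF m n (fun N => E N (k N x)) B UFu.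
    by move=> N; apply: le_trans (EB N _ (kN N x ax xb)); rewrite lerDr.
  by exists l.
have UFh e : 0 < e -> UF [set N | h N < e].
  move=> e0; apply: UFoo.
  by have [M HM] := hlim e e0; exists M.
have UFne A : UF A -> exists x, A x by move=> UA; exact: (@filter_ex _ UF _ _ UA).
exists y; split.
- apply/eqP; rewrite -subr_eq0 -normr_le0; apply/ler_addgt0Pr => e e0; rewrite add0r.
  have [N /=] := UFne _ (Hy a (lexx _) (ltW ab) e e0).
  have -> : k N a = 0%N by rewrite /k subrr mul0r truncn0.
  by rewrite /= distrC.
- exists L => // p q ap pq qb.
  have aq := le_trans ap pq; have pb := le_trans pq qb.
  apply/ler_addgt0Pr => e e0.
  have e3 : 0 < e / 3 by rewrite divr_gt0.
  have e3L : 0 < e / 3 / (L + 1) by rewrite divr_gt0// ltr_wpDl.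
  have [N /= [[N1 N2] N3]] := UFne _ (filterI (filterI (Hy p ap pb _ e3) (Hy q aq qb _ e3)) (UFh _ e3L)).
  have E1 := ELip N _ _ (kmono N _ _ pq) (kN N q aq qb).
  have /andP[p1 p2] := kP N p ap; have /andP[q1 q2] := kP N q aq.
  have -> : y q - y p = (E N (k N q) - E N (k N p)) - (E N (k N q) - y q) + (E N (k N p) - y p).
    by lmod R.
  apply: (le_trans (ler_normD _ _)); apply: (le_trans (lerD (ler_normB _ _) (lexx _))).
  have Lh : L * h N <= e / 3.
    apply: (@le_trans _ _ ((L + 1) * (e / 3 / (L + 1)))).
      by rewrite ler_pM// ?ltW// ltrDl.
    by rewrite mulrC mulfVK// gt_eqF// ltr_wpDl.
  have tpq : L * t N (k N q) - L * t N (k N p) <= L * (q - p) + L * h N.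
    by rewrite -mulrBr -mulrDr ler_wpM2l//; move: p1 p2 q1 q2; clear; lra.
  move: E1 N1 N2 Lh tpq; clear; lra.
move=> w w0.
have [d d0 Hd] := Kapp w w0.
(* The nodes that occur are within [2 * d1] of the node of [s], so the polygon moves by at most
   [L * (2 * d1) <= d / 2] from its value there; [e1 <= d / 4] leaves room for the passage to the
   limit. *)
pose d1 := d / (4 * (L + 1)).
have L1 : 0 < L + 1 by rewrite ltr_wpDl.
have d10 : 0 < d1 by rewrite divr_gt0// mulr_gt0.
have d1E : d = 4 * d1 * (L + 1).
  by rewrite /d1; field; rewrite gt_eqF.
exists d1 => // s p q /andP[as_ sb] ap pq qb psd qsd.
have aq := le_trans ap pq; have pb := le_trans pq qb.
apply/ler_addgt0Pr => e e0.
pose e1 := Order.min (e / 4) (d / 4).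
have e10 : 0 < e1 by rewrite lt_min !divr_gt0.
pose eh := Order.min d1 (e / 4 / (w + 2 * C * (1 + `|y s|))).
have den : 0 < w + 2 * C * (1 + `|y s|).
  by rewrite ltr_pwDl// !mulr_ge0// addr_ge0.
have eh0 : 0 < eh by rewrite lt_min d10 divr_gt0// divr_gt0.
have [N /= [[[N1 N2] N3] N4]] := UFne _ (filterI (filterI (filterI (Hy p ap pb _ e10) (Hy q aq qb _ e10)) (Hy s as_ sb _ e10)) (UFh _ eh0)).
have hd1 : h N < d1 by apply: (lt_le_trans N4); rewrite ge_min lexx.
have he : (w + 2 * C * (1 + `|y s|)) * h N <= e / 4.
  rewrite mulrC -ler_pdivlMr//; apply: (le_trans (ltW N4)).
  by rewrite ge_min lexx orbT.
have e1d : e1 <= d / 4 by rewrite ge_min lexx orbT.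
have e1e : e1 <= e / 4 by rewrite ge_min lexx.
have /andP[p1 p2] := kP N p ap; have /andP[q1 q2] := kP N q aq.
have /andP[s1 s2] := kP N s as_.
move: (psd) (qsd); rewrite ltr_norml => /andP[ps1 ps2]; rewrite ltr_norml => /andP[qs1 qs2].
(* The increments of the polygon are those of [K (t N i) (E N i)]. Each is compared with [K s (y s)]
   directly, at the limit value [y s], and the comparison telescopes. *)
have main : `|(E N (k N q) - K s (y s) (t N (k N q))) - (E N (k N p) - K s (y s) (t N (k N p)))|
    <= w * t N (k N q) - w * t N (k N p).
  apply: (@ler_telescope _ (fun i => E N i - K s (y s) (t N i)) (fun i => w * t N i)).
    exact: kmono.
  move=> i /andP[ip iq].
  have iN : (i.+1 <= N.+1)%N by rewrite (leq_trans iq)// kN.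
  have ti1 := tmono N _ _ ip; have ti2 := tmono N _ _ iq.
  have hN0 := h0 N.
  have -> : E N i.+1 - K s (y s) (t N i.+1) - (E N i - K s (y s) (t N i)) =
    K (t N i) (E N i) (t N i.+1) - K (t N i) (E N i) (t N i) - (K s (y s) (t N i.+1) - K s (y s) (t N i)).
    by rewrite -ES; lmod R.
  rewrite -mulrBr; apply: Hd => //.
  - by rewrite as_ sb.
  - by rewrite tS lerDl ltW.
  - exact: tb.
  - rewrite ltr_norml; move: ti1 ti2 p1 p2 q1 q2 ps1 ps2 qs1 qs2 hd1 hN0 d10 d1E L0 .
    rewrite tS; clear; nra.
  - rewrite ltr_norml; move: ti1 ti2 p1 p2 q1 q2 ps1 ps2 qs1 qs2 hd1 hN0 d10 d1E L0 .
    rewrite tS; clear; nra.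
  - have -> : E N i - y s = (E N i - E N (k N s)) + (E N (k N s) - y s) by lmod R.
    apply: (le_lt_trans (ler_normD _ _)).
    have EE : `|E N i - E N (k N s)| <= L * `|t N i - t N (k N s)|.
      have [ik|ki] := leqP (k N s) i.
        rewrite ger0_norm ?subr_ge0 ?tmono// mulrBr.
        by apply: ELip => //; exact: ltnW.
      rewrite distrC [`|t N i - _|]distrC ger0_norm ?subr_ge0 ?tmono ?mulrBr//; last exact: ltnW.
      by apply: ELip; [exact: ltnW|exact: kN].
    have tt : `|t N i - t N (k N s)| <= 2 * d1.
      rewrite ler_norml; move: ti1 ti2 p1 p2 q1 q2 s1 s2 ps1 ps2 qs1 qs2 hd1 hN0.
      rewrite tS; clear; lra.
    have : L * `|t N i - t N (k N s)| <= L * (2 * d1) by rewrite ler_wpM2l.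
    move: EE N3 e1d d1E d10 L0 => /=; clear; nra.
have Kq : `|K s (y s) q - K s (y s) (t N (k N q))| <= C * h N * (1 + `|y s|).
  apply: (@le_trans _ _ (C * (q - t N (k N q)) * (1 + `|y s|))).
    by apply: Kgrow => //; rewrite as_.
  rewrite ler_wpM2r ?addr_ge0// ler_wpM2l//; move: q2; clear; lra.
have Kp : `|K s (y s) p - K s (y s) (t N (k N p))| <= C * h N * (1 + `|y s|).
  apply: (@le_trans _ _ (C * (p - t N (k N p)) * (1 + `|y s|))).
    by apply: Kgrow => //; rewrite as_.
  rewrite ler_wpM2r ?addr_ge0// ler_wpM2l//; move: p2; clear; lra.
have -> : y q - y p - (K s (y s) q - K s (y s) p) =
  ((E N (k N q) - K s (y s) (t N (k N q))) - (E N (k N p) - K s (y s) (t N (k N p))))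
  - (E N (k N q) - y q) + (E N (k N p) - y p)
  - (K s (y s) q - K s (y s) (t N (k N q))) + (K s (y s) p - K s (y s) (t N (k N p))).
  by lmod R.
apply: (le_trans (ler_normD _ _)); apply: (le_trans (lerD (ler_normB _ _) (lexx _))).
apply: (le_trans (lerD (lerD (ler_normD _ _) (lexx _)) (lexx _))).
apply: (le_trans (lerD (lerD (lerD (ler_normB _ _) (lexx _)) (lexx _)) (lexx _))).
have tpq : w * t N (k N q) - w * t N (k N p) <= w * (q - p) + w * h N.
  by rewrite -mulrBr -mulrDr ler_wpM2l ?ltW//; move: p1 p2 q1 q2; clear; lra.
move: main Kq Kp tpq N1 N2 e1e he e0; clear; nra.
Qed.

End sewing.

(** * Means and primitives *)

Section support.
Context {R : realType} (r : nat).
Implicit Types (mu : probability (@borel_rV R r) R) (U : set 'rV[R]_r).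

Lemma borel_measurable_open (A : set 'rV[R]_r) :
  open A -> measurable (A : set (@borel_rV R r)).
Proof. exact: sub_sigma_algebra. Qed.

Lemma borel_measurable_fun (phi : 'rV[R]_r -> R) : continuous phi ->
  measurable_fun setT (phi : @borel_rV R r -> R).
Proof.
move=> cphi.
apply: (measurability (@RGenOInfty.G R)).
  exact: RGenOInfty.measurableE.
move=> _ [_ [x ->] <-]; rewrite setTI.
apply: borel_measurable_open.
by move/continuousP : cphi; apply; exact: interval_open.
Qed.

(** Inner regularity reduces the open set outside [U] to its compact subsets; each of these is
    covered by finitely many of the null open sets that exclude its points from the support. *)
Lemma supp_null mu U : regular_measure mu -> compact U -> supp mu `<=` U ->
  mu (~` U) = 0%E.
Proof.
move=> mureg cU muU.
have oU : open (~` U).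
  by apply: closed_openC; apply: compact_closed => //; exact: norm_hausdorff.
have [_ ->] := mureg _ (borel_measurable_open oU).
apply/eqP; rewrite eq_le; apply/andP; split; last first.
  apply: ereal_sup_ubound.
  by exists set0; [split => //; exact: compact0|rewrite measure0].
apply: ge_ereal_sup => _ [K [cK KU] <-].
have Kn u : K u -> exists V : set 'rV[R]_r, [/\ open V, V u & mu V = 0%E].
  move=> Ku; apply: contrapT => H; apply: (KU _ Ku); apply: muU => V oV Vu.
  rewrite lt0e measure_ge0 andbT; apply/eqP => V0.
  by apply: H; exists V.
have /choice[V HV] : forall u, exists V : set 'rV[R]_r, K u -> [/\ open V, V u & mu V = 0%E].
  move=> u; have [/Kn[V HV]|nK] := pselect (K u); first by exists V.
  by exists set0.
have oK : open (~` K : set 'rV[R]_r).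
  by apply: closed_openC; apply: compact_closed => //; exact: norm_hausdorff.
move: cK; rewrite compact_cover => /(_ _ K V) [||D' D'K KD'].
- by move=> u /HV[].
- by move=> u Ku; exists u => //; case: (HV _ Ku).
set N := (X in _ `<=` X) in KD'.
have : mu.-negligible N.
  rewrite /N /cover bigcup_fset; rewrite big_seq; elim/big_ind : _ => //.
  - exact: negligible_set0.
  - by move=> A B; exact: negligibleU.
  - move=> u /D'K /set_mem Ku; have [oV _ V0] := HV _ Ku.
    by exists (V u); split => //; exact: borel_measurable_open.
have mK : measurable (K : set (@borel_rV R r)).
  by rewrite -(setCK K); apply: (@measurableC _ (@borel_rV R r)); exact: borel_measurable_open.
move=> [A [mA A0 KA]]; rewrite -A0; apply: le_measure => [||u /KD' /KA//].
  exact/mem_set.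
exact/mem_set.
Qed.

Section mean.
Variables (mu : probability (@borel_rV R r) R) (U : set 'rV[R]_r).
Hypotheses (cU : compact U) (muU : mu (~` U) = 0%E).

Let mU : measurable (~` U : set (@borel_rV R r)).
Proof.
apply: borel_measurable_open; apply: closed_openC.
by apply: compact_closed => //; exact: norm_hausdorff.
Qed.

Lemma compact_bound (phi : 'rV[R]_r -> R) : continuous phi ->
  exists2 B : R, 0 < B & forall u, U u -> `|phi u| <= B.
Proof.
move=> cphi.
have [U0|U0] := pselect (U !=set0); last first.
  by exists 1 => // u Uu; case: U0; exists u.
have [|c Uc Hc] := EVT_max_rV (f := fun u => `|phi u|) U0 cU.
  apply: continuous_subspaceT => u; apply: continuous_comp; first exact: cphi.
  exact: norm_continuous.
exists (`|phi c| + 1); first by rewrite ltr_wpDl.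
move=> u Uu; apply: (le_trans (Hc u _)); last by rewrite lerDl.
exact/mem_set.
Qed.

Lemma supp_integrable (phi : 'rV[R]_r -> R) : continuous phi ->
  mu.-integrable setT (EFin \o phi).
Proof.
move=> cphi.
have [B B0 HB] := compact_bound cphi.
have mphi := borel_measurable_fun cphi.
have intC : mu.-integrable setT (EFin \o cst B : @borel_rV R r -> _).
  by apply: measurable_bounded_integrable => //; try exact: bounded_cst; rewrite [X in (X < _)%E](_ : _ = 1%E) ?ltry//; exact: probability_setT.
apply/integrableP; split; first exact/measurable_EFinP.
move/integrableP : intC => [mB]; apply: le_lt_trans.
apply: ae_ge0_le_integral => //=.
- apply/measurable_EFinP; apply: (measurableT_comp _ mphi).
  exact: normr_measurable.
exists (~` U); split => // u /= H Uu; apply: H => _.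
by rewrite /= lee_fin (le_trans (HB _ Uu))// ler_norm.
Qed.

Lemma mean_le (phi : 'rV[R]_r -> R) (k : R) : continuous phi ->
  (forall u, U u -> phi u <= k) -> \int[mu]_(u in setT) phi u <= k.
Proof.
move=> cphi phik.
have [B B0 HB] := compact_bound cphi.
have -> : k = \int[mu]_(u in setT) k by rewrite Rintegral_cst//= probability_setT mulr1.
(* The bound is known on [U] only. Truncation at [k] changes [phi] on a null set and makes the bound
   hold everywhere. *)
have -> : \int[mu]_(u in setT) phi u = \int[mu]_(u in setT) Order.min (phi u) k.
  rewrite /Rintegral; congr fine; apply: ae_eq_integral => //.
  - by apply/measurable_EFinP; exact: borel_measurable_fun.
  - apply/measurable_EFinP; apply: measurable_minr => //; exact: borel_measurable_fun.
  - exists (~` U); split => // u /= H Uu; apply: H => _.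
    by congr EFin; symmetry; apply/min_idPl; exact: phik.
have cmin : continuous (fun u => Order.min (phi u) k).
  move=> u; apply: (@continuous_min _ _ phi (cst k)); first exact: cphi.
  exact: cst_continuous.
apply: le_Rintegral => //.
- exact: supp_integrable.
- apply: (supp_integrable (phi := cst k)); exact: cst_continuous.
- by move=> u _; rewrite ge_min lexx orbT.
Qed.

Lemma mean_linear (I : Type) (s : seq I) (c : I -> R) (g : I -> 'rV[R]_r -> R) :
  (forall i, continuous (g i)) ->
  \sum_(i <- s) c i * (\int[mu]_(u in setT) g i u) =
  \int[mu]_(u in setT) \sum_(i <- s) c i * g i u.
Proof.
move=> cg.
have cs (t : seq I) : continuous (fun u => \sum_(i <- t) c i * g i u).
  elim: t => [|i t IH] u.
    have -> : (fun u => \sum_(i <- [::]) c i * g i u) = cst 0 by apply/funext => v; rewrite big_nil.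
    exact: cst_continuous.
  have -> : (fun u => \sum_(i <- i :: t) c i * g i u) = (fun u => c i * g i u + \sum_(i <- t) c i * g i u).
    by apply/funext => v; rewrite big_cons.
  have ci : continuous_at u (fun v => c i * g i v).
    exact: (continuousM (@cst_continuous _ _ (c i) u) (cg i u)).
  exact: (continuousD ci (IH u)).
elim: s => [|i s IH].
  rewrite big_nil; under eq_Rintegral do rewrite big_nil.
  by rewrite Rintegral_cst//= mul0r.
rewrite big_cons IH; under [RHS]eq_Rintegral do rewrite big_cons.
rewrite RintegralD//; first last.
- exact: supp_integrable.
- apply: (supp_integrable (phi := fun u => c i * g i u)) => u.
  exact: (continuousM (@cst_continuous _ _ (c i) u) (cg i u)).
- by rewrite RintegralZl//; exact: supp_integrable.
Qed.

End mean.
End support.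

Section primitive.
Context {R : realType}.

Lemma ae_imp2 (P Q S : R -> Prop) :
  {ae (@lebesgue_measure R), forall t, P t} ->
  {ae (@lebesgue_measure R), forall t, Q t} ->
  (forall t, P t -> Q t -> S t) -> {ae (@lebesgue_measure R), forall t, S t}.
Proof.
move=> HP HQ PQS; have F := ae_filter_ringOfSetsType (@lebesgue_measure R).
by apply: (@filterS _ _ F) (@filterI _ _ F _ _ HP HQ) => t [] /PQS; apply.
Qed.

Lemma lebesgue_measurable_borel (E : set R) :
  measurable (E : set (@lebesgueR R)) ->
  exists2 A : set R, measurable A & A `<=` E /\
    (@lebesgue_measure R).-negligible (E `\` A).
Proof.
rewrite -[X in X E](_ : (completed_algebra_gen (@lebesgue_measure R)).-sigma.-measurable = _); last first.
  exact: completed_caratheodory_measurable.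
rewrite g_sigma_completed_algebra_genE => -[A mA [N nN <-]].
exists A => //; split; first by move=> t; left.
by apply: negligibleS nN => t [[|]].
Qed.

(** Weak measurability refers to Lebesgue measurable sets, the integral to Borel sets. The
    superlevel sets at rational levels are shrunk to Borel sets up to null sets, and the new
    function at [t] is the supremum of the levels whose shrunken set contains [t]. *)
Lemma lebesgue_borel_version (g : R -> R) (B : R) :
  measurable_fun (setT : set (@lebesgueR R)) (g : @lebesgueR R -> R) ->
  (forall t, `|g t| <= B) ->
  exists g' : R -> R, [/\ measurable_fun setT g', forall t, `|g' t| <= B
    & {ae (@lebesgue_measure R), forall t, g' t = g t}].
Proof.
move=> mg gB.
have /choice[A HA] : forall q : rat, exists A : set R, [/\ measurable A,
    (forall t, A t -> ratr q < g t) &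
    (@lebesgue_measure R).-negligible ([set t | ratr q < g t] `\` A)].
  move=> q.
  have mE : measurable ([set t | ratr q < g t] : set (@lebesgueR R)).
    rewrite (_ : [set _ | _] = setT `&` (g @^-1` `]ratr q, +oo[)); last first.
      by rewrite setTI; apply/seteqP; split => t /=; rewrite in_itv/= andbT.
    exact: mg.
  by have [A mA [AE nA]] := lebesgue_measurable_borel mE; exists A; split.
(* The level [- B] keeps the set nonempty and the supremum above [- B]. *)
pose S t : set R := [set c | c = - B \/ exists2 q : rat, A q t & c = ratr q].
have B0 : 0 <= B by exact: le_trans (gB 0).
have gBl t : - B <= g t by have := gB t; rewrite ler_norml => /andP[].
have gBr t : g t <= B by have := gB t; rewrite ler_norml => /andP[].
have Sub t : ubound (S t) (g t).
  by move=> c [->//|[q Aq ->]]; have [_ Ag _] := HA q; exact/ltW/Ag.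
have hS t : has_sup (S t).
  by split; [exists (- B); left|exists (g t); exact: Sub].
have Sg t : sup (S t) <= g t by apply: ge_sup; [exists (- B); left|exact: Sub].
have SB t : - B <= sup (S t) by apply: ub_le_sup; [exact: (hS t).2|left].
exists (fun t => sup (S t)); split.
- apply: (measurability (@RGenOInfty.G R)).
    exact: RGenOInfty.measurableE.
  move=> _ [_ [c ->] <-]; rewrite setTI.
  have [cB|Bc] := ltP c (- B).
    rewrite (_ : _ @^-1` _ = setT) //.
    by apply/seteqP; split => // t _ /=; rewrite in_itv/= andbT (lt_le_trans cB).
  rewrite (_ : _ @^-1` _ = \bigcup_(q in [set q : rat | c < ratr q]) A q).
    rewrite bigcup_mkcond; apply: bigcupT_measurable_rat => q.
    by case: ifPn => // _; have [] := HA q.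
  apply/seteqP; split => t /=; rewrite in_itv/= andbT.
    move=> cS; have [d Sd dc] := sup_gt (ex_intro _ _ (or_introl erefl)) cS.
    case: Sd dc => [->|[q Aq ->] cq]; first by rewrite ltNge Bc.
    by exists q.
  move=> [q /= cq Aq]; apply: (lt_le_trans cq); apply: ub_le_sup.
    exact: (hS t).2.
  by right; exists q.
- by move=> t; rewrite ler_norml SB (le_trans (Sg t)).
- pose N k := if (@choice.unpickle rat k : option rat) is Some q then [set t | ratr q < g t] `\` A q else set0.
  have : (@lebesgue_measure R).-negligible (\bigcup_k N k).
    apply: negligible_bigcup => k; rewrite /N.
    by case: choice.unpickle => [q|]; [have [] := HA q|exact: negligible_set0].
  apply: negligibleS => t /= H; apply: contrapT => H2; apply: H.
  apply/eqP; rewrite eq_le Sg /= leNgt; apply/negP => Sl.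
  have [q] := rat_in_itvoo Sl; rewrite in_itv/= => /andP[Sq qg].
  have Nq : N (choice.pickle q) = [set t | ratr q < g t] `\` A q.
    by rewrite /N choice.pickleK.
  suff Nt : ([set t | ratr q < g t] `\` A q) t.
    by rewrite -Nq in Nt; exact: (H2 (ex_intro2 _ _ (choice.pickle q) I Nt)).
  split => //= Aq.
  have : ratr q <= sup (S t) by apply: ub_le_sup; [exact: (hS t).2|right; exists q].
  by rewrite leNgt Sq.
Qed.

(** Lebesgue's differentiation theorem for a Borel version of [g], which has the same values almost
    everywhere. *)
Lemma lebesgue_primitive (g : R -> R) (B a : R) :
  measurable_fun (setT : set (@lebesgueR R)) (g : @lebesgueR R -> R) ->
  (forall t, `|g t| <= B) ->
  exists2 W : R -> R,
    (forall p q, a <= p -> p <= q -> `|W q - W p| <= B * (q - p)) &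
    {ae (@lebesgue_measure R), forall t, a < t -> is_derive t 1 W (g t)}.
Proof.
move=> mg gB.
have [f [mf fB fg]] := lebesgue_borel_version mg gB.
pose F x := (\int[lebesgue_measure]_(t in `[a, x]) f t)%R.
have fint (D : set R) : measurable D -> (lebesgue_measure D < +oo)%E ->
    lebesgue_measure.-integrable D (EFin \o f).
  move=> mD Dfin; apply: measurable_bounded_integrable => //.
    exact: measurable_funTS.
  exists B; split; first by rewrite num_real.
  by move=> x Bx t _ /=; rewrite (le_trans (fB t))// ltW.
have itvfin x y : (lebesgue_measure (`[x, y] : set R) < +oo)%E.
  by rewrite lebesgue_measure_itv/=; case: ifP => // _; rewrite -EFinD ltry.
exists F.
- move=> p q ap pq.
  have -> : F q - F p = (\int[lebesgue_measure]_(t in `]p, q]) f t)%R.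
    by rewrite /F Rintegral_itvB// ?bnd_simp//; exact: fint.
  have Ifin : (lebesgue_measure (`]p, q] : set R) < +oo)%E.
    by rewrite lebesgue_measure_itv/=; case: ifP => // _; rewrite -EFinD ltry.
  apply: (le_trans (le_normr_Rintegral _ _)) => //; first exact: fint.
  have -> : B * (q - p) = (\int[lebesgue_measure]_(t in `]p, q]) B)%R.
    have E : lebesgue_measure (`]p, q] : set R) = (q - p)%:E.
      rewrite lebesgue_measure_itv/= lte_fin.
      by move: pq; rewrite le_eqVlt => /predU1P[->|->]//; rewrite ltxx subrr.
    by rewrite Rintegral_cst// [X in fine X](_ : _ = (q - p)%:E).
  apply: le_Rintegral => //.
  - have := fint _ (measurable_itv `]p, q]) Ifin.
    by move/integrable_norm.
  - apply: measurable_bounded_integrable => //; exact: bounded_cst.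
- have loc : locally_integrable [set: R] f.
    split => //; first exact: openT.
    move=> K _ cK; have := fint K (compact_measurable cK) (compact_finite_measure cK).
    by move/integrableP => [_].
  have := @FTC1 R f (BLeft a) (fun y => fint _ (measurable_itv _) (itvfin _ _)) loc.
  cbv zeta => H0; apply: (ae_imp2 fg H0) => t fgt H at_.
  have [|dF dFE] := H; first by rewrite (@lte_fin R).
  by split => //; rewrite -fgt -dFE derive1E.
Qed.

End primitive.

(** * Separation of cones *)

Section separation.
Context {R : realType}.

Lemma mulmx_norm_le m n p (A : 'M[R]_(m, n)) (B : 'M[R]_(n, p)) :
  `|A *m B| <= n%:R * `|A| * `|B|.
Proof.
apply: mx_norm_le => [|i j]; first by rewrite !mulr_ge0.
rewrite mxE; apply: (le_trans (ler_norm_sum _ _ _)).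
apply: (@le_trans _ _ (\sum_(k < n) (`|A| * `|B|))).
  by apply: ler_sum => k _; rewrite normrM ler_pM// mx_entry_le.
by rewrite sumr_const card_ord -[X in X <= _]mulr_natl mulrA.
Qed.

(** The Frobenius inner product. The norm being the sup norm, the nearest point argument of
    [separation] needs this Euclidean structure. *)
Definition mdot m n (A B : 'M[R]_(m, n)) : R := \sum_i \sum_j A i j * B i j.

Section mdot.
Context {m n : nat}.
Implicit Types A B C : 'M[R]_(m, n).

Lemma mdotC A B : mdot A B = mdot B A.
Proof. by apply: eq_bigr => i _; apply: eq_bigr => j _; rewrite mulrC. Qed.

Lemma mdotDr A B C : mdot A (B + C) = mdot A B + mdot A C.
Proof.
rewrite -big_split; apply: eq_bigr => i _; rewrite -big_split.
by apply: eq_bigr => j _; rewrite mxE mulrDr.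
Qed.

Lemma mdotZr k A B : mdot A (k *: B) = k * mdot A B.
Proof.
rewrite /mdot mulr_sumr; apply: eq_bigr => i _; rewrite mulr_sumr.
by apply: eq_bigr => j _; rewrite mxE mulrCA.
Qed.

Lemma mdotNr A B : mdot A (- B) = - mdot A B.
Proof. by rewrite -scaleN1r mdotZr mulN1r. Qed.

Lemma mdotBr A B C : mdot A (B - C) = mdot A B - mdot A C.
Proof. by rewrite mdotDr mdotNr. Qed.

Lemma mdotDl A B C : mdot (A + B) C = mdot A C + mdot B C.
Proof. by rewrite mdotC mdotDr mdotC (mdotC C). Qed.

Lemma mdotZl k A B : mdot (k *: A) B = k * mdot A B.
Proof. by rewrite mdotC mdotZr mdotC. Qed.

Lemma mdotNl A B : mdot (- A) B = - mdot A B.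
Proof. by rewrite mdotC mdotNr mdotC. Qed.

Lemma mdotBl A B C : mdot (A - B) C = mdot A C - mdot B C.
Proof. by rewrite mdotDl mdotNl. Qed.

Lemma mdot0r A : mdot A 0 = 0.
Proof. by rewrite -(scale0r 0) mdotZr mul0r. Qed.

Lemma mdot_le A B : `|mdot A B| <= m%:R * n%:R * `|A| * `|B|.
Proof.
apply: (le_trans (ler_norm_sum _ _ _)).
apply: (@le_trans _ _ (\sum_(i < m) (n%:R * `|A| * `|B|))); last first.
  by rewrite sumr_const card_ord -[X in X <= _]mulr_natl !mulrA.
apply: ler_sum => i _; apply: (le_trans (ler_norm_sum _ _ _)).
apply: (@le_trans _ _ (\sum_(j < n) (`|A| * `|B|))); last first.
  by rewrite sumr_const card_ord -[X in X <= _]mulr_natl !mulrA.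
by apply: ler_sum => j _; rewrite normrM ler_pM// mx_entry_le.
Qed.

Lemma sqr_norm_le_mdot A : `|A| ^+ 2 <= mdot A A.
Proof.
have d0 : 0 <= mdot A A.
  by apply: sumr_ge0 => i _; apply: sumr_ge0 => j _; rewrite -expr2 sqr_ge0.
rewrite -(sqr_sqrtr d0) lerXn2r ?nnegrE ?sqrtr_ge0//.
apply: mx_norm_le; first exact: sqrtr_ge0.
move=> i j; rewrite -sqrtr_sqr ler_wsqrtr// expr2 /mdot (bigD1 i)//= (bigD1 j)//=.
rewrite -addrA lerDl addr_ge0//.
  by apply: sumr_ge0 => k _; rewrite -expr2 sqr_ge0.
by apply: sumr_ge0 => k _; apply: sumr_ge0 => l _; rewrite -expr2 sqr_ge0.
Qed.

Lemma mdot_gt0 A : A != 0 -> 0 < mdot A A.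
Proof.
move=> A0; apply: lt_le_trans (sqr_norm_le_mdot A).
by rewrite exprn_gt0// normr_gt0.
Qed.

End mdot.

(** The second bound makes the index large as well, so that errors of order [1 / N] in the sequence
    can be made small together with the distance to the limit. *)
Lemma ultra_approx m n (F : set_system nat) (u : nat -> 'M[R]_(m, n)) l :
  UltraFilter F -> eventually `<=` F ->
  (forall e : R, 0 < e -> F [set N | `|u N - l| <= e]) ->
  forall e : R, 0 < e -> exists N, `|u N - l| <= e /\ N.+1%:R^-1 <= e.
Proof.
move=> UF Foo Hl e e0.
have FN : F [set N | N.+1%:R^-1 <= e].
  apply: Foo; exists (Num.truncn e^-1) => //= N HN.
  rewrite /= invf_ple ?posrE//; apply: ltW; apply: (lt_le_trans (truncnS_gt _)).
  by rewrite ler_nat.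
by have [N [N1 N2]] := @filter_ex _ F _ _ (filterI (Hl e e0) FN); exists N.
Qed.

(** [L] points from the Euclidean nearest point [l] of the closure of [S] to [p]. Since [S] need not
    be closed, [l] is a limit of a minimizing sequence in [S], and it inherits the distance [eta]
    from that sequence. *)
Lemma separation m n (S : set 'M[R]_(m, n)) (p : 'M[R]_(m, n)) (eta : R) :
  S !=set0 ->
  (forall x y t, 0 < t -> t < 1 -> S x -> S y -> S ((1 - t) *: x + t *: y)) ->
  0 < eta -> (forall c, S c -> eta <= `|p - c|) ->
  exists2 L, eta <= `|L| & forall c, S c -> mdot L c <= mdot L p - mdot L L.
Proof.
move=> [x0 Sx0] Sconv eta0 Sp.
pose D := [set mdot (p - c) (p - c) | c in S].
have dge c : 0 <= mdot (p - c) (p - c).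
  by apply: le_trans (sqr_norm_le_mdot _); rewrite sqr_ge0.
have hD : has_inf D.
  by split; [exists (mdot (p - x0) (p - x0)), x0|exists 0 => _ [c _ <-]].
pose d := inf D.
have dmin c : S c -> d <= mdot (p - c) (p - c).
  by move=> Sc; apply: ge_inf; [exact: hD.2|exists c].
have /choice[c Hc] : forall N : nat, exists c, S c /\ mdot (p - c) (p - c) <= d + N.+1%:R^-1.
  move=> N; have N0 : 0 < N.+1%:R^-1 :> R by rewrite invr_gt0.
  have [_ [c Sc <-] cd] := inf_adherent N0 hD.
  by exists c; split => //; exact: ltW.
have cB N : `|c N| <= `|p| + (d + 1 + 1).
  have [Sc cd] := Hc N.
  have N1 : N.+1%:R^-1 <= 1 :> R by rewrite invf_le1// ler1n.
  have w2 := sqr_norm_le_mdot (p - c N).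
  have wle : `|p - c N| <= d + 1 + 1.
    have w0 := normr_ge0 (p - c N).
    move: w2 cd N1 w0; move: (mdot _ _) (N.+1%:R^-1) `|_| => M iN w; clear; nra.
  have cE : p - (p - c N) = c N by lmod R.
  by rewrite -[leLHS]/(`|c N|) -cE (le_trans (ler_normB _ _))// lerD2l.
have [UF [UFu UFoo]] := ultraFilterLemma (@eventually_filter).
have [l Hl] := bounded_ultra_lim UFu cB.
have approx := ultra_approx UFu UFoo Hl.
exists (p - l).
  apply/ler_addgt0Pr => e e0; have [N [Ne _]] := approx e e0.
  have [Sc _] := Hc N; apply: (le_trans (Sp _ Sc)).
  have -> : p - c N = (p - l) - (c N - l) by lmod R.
  by apply: (le_trans (ler_normB _ _)); rewrite lerD2l.
move=> x Sx.
suff H : mdot (p - l) (x - l) <= 0.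
  move: H; rewrite !mdotBr; move: (mdot _ x) (mdot _ l) (mdot _ p) => a b q; lra.
set L := p - l; set v := x - l.
pose M := m%:R * n%:R * (`|v| + `|L| + 1) : R.
have M0 : 0 <= M by rewrite !mulr_ge0// addr_ge0// addr_ge0.
(* minimality of the distance tested along the segment from [c N] to [x] *)
have main t : 0 < t -> t < 1 -> 2 * mdot L v <= t * (mdot v v).
  move=> t0 t1; apply/ler_addgt0Pr => e e0.
  pose e1 := Order.min 1 (e * t / (10 * M + 2)).
  have den : 0 < 10 * M + 2 by rewrite ltr_wpDl// mulr_ge0.
  have e10 : 0 < e1 by rewrite lt_min ltr01 divr_gt0// mulr_gt0.
  have e11 : e1 <= 1 by rewrite ge_min lexx.
  have e1M : (10 * M + 2) * e1 <= e * t.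
    by rewrite mulrC -ler_pdivlMr// ge_min lexx orbT.
  have [N [Ne Nn]] := approx e1 e10.
  have [Sc cd] := Hc N.
  set w := c N - l in Ne.
  have := dmin _ (Sconv _ _ t t0 t1 Sc Sx).
  have -> : p - ((1 - t) *: c N + t *: x) = (L - w) - t *: (v - w).
    by rewrite /L /w /v; lmod R.
  have E : p - c N = L - w by rewrite /L /w; lmod R.
  rewrite E in cd => H1.
  have {cd}H2 : mdot (L - w) (L - w) <= d + e1.
    by apply: (le_trans cd); rewrite lerD2l.
  have bw A : `|A| <= `|v| + `|L| + 1 -> `|mdot w A| <= M * e1.
    move=> HA; apply: (le_trans (mdot_le _ _)).
    rewrite /M mulrAC; apply: ler_pM => //.
    by apply: ler_wpM2l => //; rewrite mulr_ge0.
  have wv : `|mdot w v| <= M * e1 by apply: bw; rewrite -addrA lerDl addr_ge0.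
  have wL : `|mdot w L| <= M * e1 by apply: bw; rewrite -addrA addrCA lerDl addr_ge0.
  have ww : `|mdot w w| <= M * e1.
    by apply: bw; apply: (le_trans Ne); apply: (le_trans e11); rewrite lerDr addr_ge0.
  clear E; clearbody w L v.
  move: H1; rewrite [X in d <= X]mdotBl !mdotBr !mdotZl !mdotZr !mdotBl !mdotBr.
  move: H2; rewrite mdotBl !mdotBr !(mdotC _ w) (mdotC v L).
  move: wv wL ww; rewrite !ler_norml.
  move: (mdot w v) (mdot w L) (mdot w w) (mdot L v) (mdot L L) (mdot v v) => a1 a2 a3 a4 a5 a6.
  move=> /andP[p1 p2] /andP[p3 p4] /andP[p5 p6] q1 q2.
  have h1 : t * (2 * a4) <= t * (t * a6 + e).
    move: p1 p2 p3 p4 p5 p6 q1 q2 t0 t1 e10 e1M M0; clear.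
    move: (M) => Q p1 p2 p3 p4 p5 p6 q1 q2 t0 t1 e10 e1M Q0.
    have Qe : 0 <= Q * e1 by rewrite mulr_ge0// ltW.
    set z := Q * e1 in p1 p2 p3 p4 p5 p6 Qe.
    have e1M' : 10 * z + 2 * e1 <= e * t by move: e1M; rewrite /z; lra.
    have tz : t * z <= z by rewrite ler_piMl// ltW.
    clearbody z; clear e1M.
    have tt y : - z <= y -> y <= z -> - z <= t * y /\ t * y <= z.
      move=> k1 k2.
      have z1 : 0 <= t * (z - y) by apply: mulr_ge0; [exact: ltW|rewrite subr_ge0].
      have z2 : 0 <= t * (y + z) by apply: mulr_ge0; [exact: ltW|rewrite -lerBlDr sub0r].
      by split; move: z1 z2 tz; clear; lra.
    have [r1 r1'] := tt _ p1 p2.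
    have [r2 r2'] := tt _ p3 p4.
    have [r3 r3'] := tt _ p5 p6.
    have [s1 s1'] := tt _ r1 r1'.
    have [s3 s3'] := tt _ r3 r3'.
    nra.
  by rewrite ler_pM2l in h1.
apply/ler_addgt0Pr => e e0; rewrite add0r.
have v0 : 0 <= mdot v v by apply: le_trans (sqr_norm_le_mdot _); rewrite sqr_ge0.
pose t := Order.min (1 / 2) (e / (mdot v v + 1)).
have den : 0 < mdot v v + 1 by rewrite ltr_wpDl.
have t0 : 0 < t by rewrite lt_min !divr_gt0.
have t1 : t < 1 by rewrite gt_min ltr_pdivrMr// mul1r; apply/orP; left; rewrite ltr1n.
have te : t * (mdot v v + 1) <= e by rewrite -ler_pdivlMr// ge_min lexx orbT.
have mm := main t t0 t1; clearbody t.
by move: mm te t0 v0 e0; move: (mdot L v) (mdot v v) => a b; clear; lra.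
Qed.

Definition is_cone m n (K : set 'M[R]_(m, n)) :=
  [/\ K 0, forall x y, K x -> K y -> K (x + y)
    & forall c x, 0 < c -> K x -> K (c *: x)].

(** If no ball around [y] lies in the closure of [K], there are points [q] arbitrarily close to [y]
    which can be separated from [K]. A form bounded above on a cone is nonpositive there, and it is
    nonnegative at [q] because [K] contains 0. A limit of these forms, normalized, is nonnegative at
    [y] and nonzero. *)
Lemma cone_dichotomy m n (K : set 'M[R]_(m, n)) (y : 'M[R]_(m, n)) :
  is_cone K ->
  (exists2 rho : R, 0 < rho & forall q, `|q - y| <= rho ->
      forall e : R, 0 < e -> exists2 k, K k & `|q - k| <= e) \/
  (exists2 L, L != 0 & 0 <= mdot L y /\ forall k, K k -> mdot L k <= 0).
Proof.
move=> [K0 KD KZ].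
have [H|H] := pselect (exists2 rho : R, 0 < rho & forall q, `|q - y| <= rho ->
      forall e : R, 0 < e -> exists2 k, K k & `|q - k| <= e); [by left|right].
have /choice[L HL] : forall N : nat, exists L, [/\ `|L| = 1,
    - (m%:R * n%:R * N.+1%:R^-1) <= mdot L y & forall k, K k -> mdot L k <= 0].
  move=> N; have N0 : 0 < N.+1%:R^-1 :> R by rewrite invr_gt0.
  apply: contrapT => HN; apply: H; exists N.+1%:R^-1 => // q qy e e0.
  apply: contrapT => HK; apply: HN.
  have [||||L Le HL] := @separation m n K q e.
  - by exists 0.
  - move=> a b t t0 t1 Ka Kb; apply: KD; apply: KZ => //; lra.
  - by [].
  - move=> c Kc; rewrite leNgt; apply/negP => qc; apply: HK; exists c => //.
    exact: ltW.
  have L0 : 0 < `|L| by exact: lt_le_trans Le.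
  have LL : 0 < mdot L L by apply: mdot_gt0; rewrite -normr_gt0.
  have Lq : 0 <= mdot L q.
    by have := HL _ K0; rewrite mdot0r; move: LL; clear; lra.
  have Lk k : K k -> mdot L k <= 0.
    move=> Kk; rewrite leNgt; apply/negP => Lk0.
    (* This multiple of [k] would have the product [mdot L q + mdot L k] with [L], beyond the
       separating value. *)
    pose c := mdot L q / mdot L k + 1.
    have c0 : 0 < c by rewrite ltr_wpDl// divr_ge0// ltW.
    have := HL _ (KZ _ _ c0 Kk); rewrite mdotZr /c mulrDl mulfVK ?gt_eqF//.
    by move: LL Lk0; clear; lra.
  exists (`|L|^-1 *: L); split.
  - by rewrite normrZ normfV normr_id mulVf// gt_eqF.
  - have -> : y = q - (q - y) by lmod R.
    rewrite mdotBr mdotZl.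
    have a1 : 0 <= `|L|^-1 * mdot L q by rewrite mulr_ge0// invr_ge0.
    have a2 : `|mdot (`|L|^-1 *: L) (q - y)| <= m%:R * n%:R * N.+1%:R^-1.
      apply: (le_trans (mdot_le _ _)).
      rewrite normrZ normfV normr_id mulVf ?gt_eqF// mulr1.
      by rewrite ler_wpM2l// mulr_ge0.
    move: a2; rewrite ler_norml => /andP[_ a2].
    by rewrite -[X in X <= _]add0r lerD// lerN2.
  - by move=> k Kk; rewrite mdotZl mulr_ge0_le0 ?invr_ge0//; exact: Lk.
have [UF [UFu UFoo]] := ultraFilterLemma (@eventually_filter).
have LB N : `|L N| <= 1 by have [->] := HL N.
have [l Hl] := bounded_ultra_lim UFu LB.
have approx := ultra_approx UFu UFoo Hl.
have dl N x : `|mdot (L N) x - mdot l x| <= m%:R * n%:R * `|L N - l| * `|x|.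
  by rewrite -mdotBl; exact: mdot_le.
have mn0 : 0 <= m%:R * n%:R :> R by rewrite mulr_ge0.
exists l.
  have [|N [Nl _]] := approx (1 / 2); first by rewrite divr_gt0.
  apply/eqP => l0; move: Nl; rewrite l0 subr0.
  by have [-> _ _] := HL N; clear; lra.
split => [|k Kk].
  rewrite leNgt; apply/negP => ly.
  pose e := - mdot l y / (m%:R * n%:R * (`|y| + 1) + 1).
  have den : 0 < m%:R * n%:R * (`|y| + 1) + 1 :> R.
    by rewrite ltr_wpDl// mulr_ge0// addr_ge0.
  have e0 : 0 < e by rewrite divr_gt0// oppr_gt0.
  have [N [Nl Ne]] := approx e e0.
  have [_ Ly _] := HL N.
  have := dl N y; rewrite ler_norml => /andP[_].
  have b1 : m%:R * n%:R * `|L N - l| * `|y| <= m%:R * n%:R * e * `|y|.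
    by rewrite ler_wpM2r// ler_wpM2l.
  have b2 : m%:R * n%:R * N.+1%:R^-1 <= m%:R * n%:R * e by rewrite ler_wpM2l.
  have b3 : e * (m%:R * n%:R * (`|y| + 1) + 1) = - mdot l y.
    by rewrite mulfVK// gt_eqF.
  clearbody e; move: b1 b2 b3 Ly e0; clear.
  move: (m%:R * n%:R : R) `|y| (mdot (L N) y) (mdot l y) `|L N - l| (N.+1%:R^-1).
  move=> Q ny a b c d h1 h2 h3 h4 h5 h6; lra.
rewrite leNgt; apply/negP => ly.
pose e := mdot l k / (m%:R * n%:R * (`|k| + 1) + 1).
have den : 0 < m%:R * n%:R * (`|k| + 1) + 1 :> R.
  by rewrite ltr_wpDl// mulr_ge0// addr_ge0.
have e0 : 0 < e by rewrite divr_gt0.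
have [N [Nl Ne]] := approx e e0.
have [_ _ /(_ _ Kk)Ly] := HL N.
have := dl N k; rewrite ler_norml => /andP[+ _].
have b1 : m%:R * n%:R * `|L N - l| * `|k| <= m%:R * n%:R * e * `|k|.
  by rewrite ler_wpM2r// ler_wpM2l.
have b3 : e * (m%:R * n%:R * (`|k| + 1) + 1) = mdot l k.
  by rewrite mulfVK// gt_eqF.
have b4 : 0 <= m%:R * n%:R * e by rewrite mulr_ge0// ltW.
clearbody e; move: b1 b3 b4 Ly e0; clear.
move: (m%:R * n%:R : R) `|k| (mdot (L N) k) (mdot l k) `|L N - l|.
move=> Q ny a b c h1 h2 h3 h4 h5 h6; lra.
Qed.

(** Positivity is strict because the weights become durations of steps, which must not
    degenerate. *)
Definition weights (T : eqType) (U : set T) (s : seq (R * T)) :=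
  [/\ forall x, x \in s -> 0 < x.1 /\ U x.2 & \sum_(x <- s) x.1 = 1].

(** Membership in the closed convex hull is tested by its support function, which is the form that a
    mean value inequality can verify. A separating [L] would satisfy [mdot L L <= |L| * eta],
    against [|L| ^+ 2 <= mdot L L] and [2 * eta <= |L|]. *)
Lemma hull_approx (T : eqType) (U : set T) m n (F : T -> 'M[R]_(m, n))
    (p : 'M[R]_(m, n)) (eta : R) :
  U !=set0 -> 0 < eta ->
  (forall L k, (forall u, U u -> mdot L (F u) <= k) ->
     mdot L p <= k + `|L| * eta) ->
  exists2 s, weights U s & `|p - \sum_(x <- s) x.1 *: F x.2| <= 2 * eta.
Proof.
move=> [u0 Uu0] eta0 Hp.
pose S := [set c | exists2 s, weights U s & c = \sum_(x <- s) x.1 *: F x.2].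
apply: contrapT => H.
have SF u : U u -> S (F u).
  move=> Uu; exists [:: (1, u)]; last by rewrite big_seq1 scale1r.
  by split; [move=> x; rewrite inE => /eqP->|rewrite big_seq1].
have [||||L Le HL] := @separation m n S p (2 * eta).
- by exists (F u0); exact: SF.
- move=> _ _ t t0 t1 [s [s1 s2] ->] [s' [s1' s2'] ->].
  exists ([seq ((1 - t) * x.1, x.2) | x <- s] ++ [seq (t * x.1, x.2) | x <- s']).
    split.
      move=> x; rewrite mem_cat => /orP[] /mapP[z zs -> /=].
        by move: zs => /s1[z1 z2]; split => //; rewrite mulr_gt0// subr_gt0.
      by move: zs => /s1'[z1 z2]; split => //; rewrite mulr_gt0.
    by rewrite big_cat !big_map /= -!mulr_sumr s2 s2'; ring.
  rewrite big_cat !big_map /= !scaler_sumr.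
  by congr (_ + _); apply: eq_bigr => x _; rewrite scalerA.
- by rewrite mulr_gt0.
- move=> c [s sw ->]; rewrite leNgt; apply/negP => Hlt; apply: H.
  by exists s => //; exact: ltW.
have := Hp L (mdot L p - mdot L L) (fun u Uu => HL _ (SF _ Uu)).
have := sqr_norm_le_mdot L.
move: Le eta0; move: `|L| (mdot L L) (mdot L p) => a b c; clear; nra.
Qed.

End separation.

(** * Trajectories of step controls *)

Section lipschitz.
Context {R : realType} {V : normedModType R}.
Implicit Types x y : R -> V.

Definition lip_on (a b C : R) x :=
  forall p q, a <= p -> p <= q -> q <= b -> `|x q - x p| <= C * (q - p).

Lemma lip_onW a b a' b' C x : a <= a' -> b' <= b -> lip_on a b C x ->
  lip_on a' b' C x.
Proof.
move=> aa bb H p q ap pq qb; apply: H => //; first exact: le_trans ap.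
exact: le_trans bb.
Qed.

Lemma lip_onB a b C C' x y : lip_on a b C x -> lip_on a b C' y ->
  lip_on a b (C + C') (fun t => x t - y t).
Proof.
move=> hx hy p q ap pq qb.
have -> : x q - y q - (x p - y p) = (x q - x p) - (y q - y p) by lmod R.
by apply: (le_trans (ler_normB _ _)); rewrite mulrDl lerD ?hx ?hy.
Qed.

Lemma lip_on_ac a b C x : 0 <= C -> lip_on a b C x -> abs_continuous a b x.
Proof.
move=> C0 H e e0; exists (e / (C + 1)).
  by rewrite divr_gt0// ltr_wpDl.
move=> s s1 _ s3.
have : \sum_(p <- s) `|x p.2 - x p.1| <= C * \sum_(p <- s) (p.2 - p.1).
  rewrite mulr_sumr; elim: s s1 {s3} => [_|p s IH /= /andP[/and3P[p1 p2 p3] ps]].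
    by rewrite !big_nil.
  by rewrite !big_cons lerD ?H ?IH.
move=> /le_lt_trans; apply.
have s0 : 0 <= \sum_(p <- s) (p.2 - p.1).
  elim: s s1 {s3} => [_|p s IH /= /andP[/and3P[p1 p2 p3] ps]].
    by rewrite big_nil.
  by rewrite big_cons addr_ge0 ?subr_ge0 ?IH.
have C1 : 0 < C + 1 by rewrite ltr_wpDl.
apply: (@le_lt_trans _ _ ((C + 1) * \sum_(p <- s) (p.2 - p.1))).
  by rewrite ler_wpM2r// lerDl.
by rewrite mulrC -ltr_pdivlMr.
Qed.

Lemma lipschitz_mvi a b C x dx v k : a <= b -> 0 <= k -> 0 <= C ->
  lip_on a b C x -> (forall t, a < t -> t < b -> is_derive t 1 x (dx t)) ->
  (forall t, a < t -> t < b -> `|dx t - v| <= k) ->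
  `|x b - x a - (b - a) *: v| <= k * (b - a).
Proof.
move=> ab k0 C0 lipx dxP dxk.
apply: abs_continuous_mvi => //; first exact: lip_on_ac lipx.
exists set0; split => // t /= H; apply: H.
rewrite in_itv/= => /andP[at_ tb].
by exists (dx t); [exact: dxP|exact: dxk].
Qed.

(** The largest displacement [M] satisfies [M <= E + M / 2] with [E = (b - a) * (C * |x a| + k)]; on
    such a short interval the exponential of Gronwall's inequality is replaced by the factor 2. *)
Lemma gronwall_small a b C C' x dx k : a <= b -> 0 <= C -> 0 <= k -> 0 <= C' ->
  lip_on a b C' x -> (forall t, a < t -> t < b -> is_derive t 1 x (dx t)) ->
  (forall t, a < t -> t < b -> `|dx t| <= C * `|x t| + k) ->
  C * (b - a) <= 1 / 2 ->
  forall t, a <= t -> t <= b ->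
    `|x t - x a| <= 2 * (b - a) * (C * `|x a| + k).
Proof.
move=> ab C0 k0 C'0 lipx dxP dxk Cab.
pose S := [set `|x t - x a| | t in [set t | a <= t <= b]].
have hS : has_sup S.
  split; first by exists `|x a - x a|, a => //=; rewrite lexx.
  exists (C' * (b - a)) => _ [t /= /andP[at_ tb] <-].
  by apply: (le_trans (lipx _ _ _ _ _)) => //; rewrite ler_wpM2l// lerD2r.
have SM t : a <= t -> t <= b -> `|x t - x a| <= sup S.
  by move=> at_ tb; apply: ub_le_sup; [exact: hS.2|exists t => //=; rewrite at_].
set M := sup S in SM.
have M0 : 0 <= M by apply: le_trans (SM a (lexx _) ab).
have E0 : 0 <= (b - a) * (C * `|x a| + k).
  by rewrite mulr_ge0 ?subr_ge0// addr_ge0// mulr_ge0.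
have Mle : M <= (b - a) * (C * `|x a| + k) + 1 / 2 * M.
  apply: ge_sup; first exact: hS.1.
  move=> _ [t /= /andP[at_ tb] <-].
  have K0 : 0 <= C * `|x a| + C * M + k.
    by rewrite !addr_ge0// mulr_ge0.
  have := @lipschitz_mvi a t C' x dx 0 _ at_ K0 C'0 (lip_onW (lexx _) tb lipx).
  rewrite scaler0 subr0 => H.
  apply: (@le_trans _ _ ((C * `|x a| + C * M + k) * (t - a))).
    apply: H => z az zt; first by apply: dxP => //; exact: lt_le_trans tb.
    have zb := lt_le_trans zt tb.
    rewrite subr0; apply: (le_trans (dxk z az zb)); rewrite lerD2r -mulrDr ler_wpM2l//.
    have -> : x z = x a + (x z - x a) by rewrite addrC subrK.
    by apply: (le_trans (ler_normD _ _)); rewrite lerD2l SM ?ltW.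
  apply: (@le_trans _ _ ((C * `|x a| + C * M + k) * (b - a))).
    by rewrite ler_wpM2l// lerD2r.
  have : C * (b - a) * M <= 1 / 2 * M by rewrite ler_wpM2r.
  move: (C * `|x a|); clear; move=> q; lra.
move=> t at_ tb; apply: (le_trans (SM t at_ tb)).
rewrite -mulrA; move: Mle; move: (_ * (_ + k)) => q; hclear; lra.
Qed.

End lipschitz.

Section follows.
Context {R : realType} {n r : nat}.
Variables (F : R -> 'rV[R]_n -> 'rV[R]_r -> 'rV[R]_n) (U : set 'rV[R]_r).

(** Nothing is required at the ends of the steps, where the velocity jumps; continuity across them
    comes from a separate [lip_on] hypothesis. *)
Fixpoint follows (l : seq (R * 'rV[R]_r)) (a : R) (x : R -> 'rV[R]_n) : Prop :=
  if l is (d, w) :: l' then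
    (forall t, a < t -> t < a + d -> is_derive t 1 x (F t (x t) w)) /\
    follows l' (a + d) x
  else True.

Definition tot (T : Type) (l : seq (R * T)) : R := \sum_(p <- l) p.1.

Definition steps_in (l : seq (R * 'rV[R]_r)) :=
  forall p, p \in l -> 0 < p.1 /\ U p.2.

Lemma tot_cons (T : Type) (p : R * T) l : tot (p :: l) = p.1 + tot l.
Proof. by rewrite /tot big_cons. Qed.

Lemma tot_cat (T : Type) (l1 l2 : seq (R * T)) : tot (l1 ++ l2) = tot l1 + tot l2.
Proof. by rewrite /tot big_cat. Qed.

Lemma steps_in_cons p l : steps_in (p :: l) <-> (0 < p.1 /\ U p.2) /\ steps_in l.
Proof.
split=> [H|[Hp Hl] q]; last by rewrite inE => /predU1P[->|/Hl].
by split=> [|q ql]; apply: H; rewrite inE ?eqxx ?ql ?orbT.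
Qed.

Lemma tot_ge0 l : steps_in l -> 0 <= tot l.
Proof.
elim: l => [_|p l IH /steps_in_cons[[p0 _] /IH]]; first by rewrite /tot big_nil.
by rewrite tot_cons => l0; rewrite addr_ge0// ltW.
Qed.

Lemma follows_cat l1 l2 a x :
  follows (l1 ++ l2) a x <-> follows l1 a x /\ follows l2 (a + tot l1) x.
Proof.
elim: l1 a => [|[d w] l1 IH] a /=.
  by rewrite /tot big_nil addr0; split => // -[].
rewrite tot_cons addrA; split.
  by move=> [H1 /IH[H2 H3]].
by move=> [[H1 H2] H3]; split => //; apply/IH.
Qed.

Lemma is_derive_local (V : normedModType R) (x y : R -> V) t v (e : R) : 0 < e ->
  (forall q, `|q - t| < e -> x q = y q) ->
  is_derive t 1 y v -> is_derive t 1 x v.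
Proof.
move=> e0 xy /is_deriveP H; apply/is_deriveP => k k0.
have [d d0 Hd] := H k k0.
exists (Order.min d e); first by rewrite lt_min d0.
move=> q; rewrite lt_min => /andP[qd qe].
by rewrite (xy q qe) (xy t) ?subrr ?normr0//; exact: Hd.
Qed.

Lemma follows_eq l a x y : steps_in l -> (forall t, a <= t -> x t = y t) ->
  follows l a y -> follows l a x.
Proof.
elim: l a => [//|[d w] l IH] a /steps_in_cons[/= [d0 _] Hl] xy [H1 H2]; split.
  move=> t at_ tad; rewrite (xy t (ltW at_)).
  apply: (@is_derive_local _ _ y _ _ (t - a)); first by rewrite subr_gt0.
    by move=> q; rewrite ltr_norml => /andP[q1 _]; apply: xy; move: q1; hclear; lra.
  exact: H1.
apply: IH => // t adt; apply: xy; apply: le_trans adt; rewrite lerDl; exact: ltW.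
Qed.

Variables (t1 T1 C : R).
Hypothesis FC0 : (0 <= C) /\
  forall t x u, t1 <= t -> t <= T1 -> U u -> `|F t x u| <= C.
Hypothesis Fcont : forall k : R, 0 < k -> exists2 d : R, 0 < d &
  forall t s x x' u, t1 <= t -> t <= T1 -> t1 <= s -> s <= T1 -> U u ->
    `|t - s| < d -> `|x - x'| < d -> `|F t x u - F s x' u| <= k.

(** The field is bounded for all states, so the solution cannot escape and lives on the whole
    step. *)
Lemma ode_exists a d w x0 : t1 <= a -> 0 < d -> a + d <= T1 -> U w ->
  exists x, [/\ x a = x0, lip_on a (a + d) C x &
    forall t, a < t -> t < a + d -> is_derive t 1 x (F t (x t) w)].
Proof.
move=> ta d0 dT Uw; have [C0 FC] := FC0.
have aad : a < a + d by rewrite ltrDl.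
have Kd s y p q : (q *: F s y w - p *: F s y w) = (q - p) *: F s y w :> 'rV[R]_n.
  by rewrite scalerBl.
have [|w' w'0|x [xa [L L0 xL] xK]] :=
  @sewing R 1 n a (a + d) C (fun s y q => q *: F s y w) x0 aad C0.
- move=> s y p q /andP[as_ sb] ap pq qb.
  rewrite Kd normrZ ger0_norm ?subr_ge0// mulrC.
  apply: (@le_trans _ _ (C * (q - p))).
    by rewrite ler_wpM2r ?subr_ge0// FC// ?(le_trans ta)// (le_trans sb).
  by rewrite ler_peMr ?lerDl// mulr_ge0// subr_ge0.
- have [e e0 He] := Fcont w'0; exists e => // s y p q z /andP[as_ sb] ap pq qb ps qs zy.
  rewrite !Kd -scalerBr normrZ ger0_norm ?subr_ge0// mulrC ler_wpM2r ?subr_ge0//.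
  apply: He => //; try exact: (le_trans ta); first exact: (le_trans pq (le_trans qb dT)).
  exact: (le_trans sb dT).
have dx t : a < t -> t < a + d -> is_derive t 1 x (F t (x t) w).
  move=> at_ tad; apply/is_deriveP => e e0.
  have [k k0 Hk] := xK e e0.
  pose m := Order.min k (Order.min (t - a) (a + d - t)).
  have m0 : 0 < m by rewrite !lt_min k0 !subr_gt0 at_.
  exists m => // q; rewrite !lt_min => /and3P[qk].
  rewrite !ltr_norml => /andP[q1 q2] /andP[q3 q4].
  have [tq|qt] := leP t q.
    have := Hk t t q; rewrite !Kd subrr normr0 ger0_norm ?subr_ge0//; apply => //.
    - by rewrite !ltW.
    - exact: ltW.
    - by move: q4; hclear; lra.
    - by move: qk; rewrite ger0_norm ?subr_ge0.
  have H := Hk t q t; rewrite !Kd subrr normr0 in H.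
  have -> : x q - x t - (q - t) *: F t (x t) w = - (x t - x q - (t - q) *: F t (x t) w).
    by lmod R.
  rewrite normrN [`|q - t|]distrC (ger0_norm (_ : 0 <= t - q)) ?subr_ge0; last exact: ltW.
  apply: H => //.
  - by rewrite !ltW.
  - by move: q1 q2 q3 q4; hclear; lra.
  - exact: ltW.
  - exact: ltW.
exists x; split => //.
move=> p q ap pq qad.
(* [sewing] provides some Lipschitz constant [L]; the mean value inequality improves it to the bound
   [C] of the field. *)
have := @lipschitz_mvi R _ p q L x (fun t => F t (x t) w) 0 C pq C0 L0.
rewrite scaler0 subr0; apply.
- by move=> p' q' pp pq' qq; apply: xL => //; [exact: le_trans pp|exact: le_trans qad].
- move=> t pt tq; apply: dx; first exact: le_lt_trans pt.
  exact: lt_le_trans qad.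
- move=> t pt tq; rewrite subr0; apply: FC => //.
    by rewrite (le_trans ta)// (le_trans ap)// ltW.
  by rewrite (le_trans _ dT)// (le_trans _ qad)// ltW.
Qed.

Lemma follows_exists l a x0 : steps_in l -> t1 <= a -> a + tot l <= T1 ->
  exists x, [/\ x a = x0, forall b, lip_on a b C x & follows l a x].
Proof.
have [C0 FC] := FC0.
elim: l a x0 => [|[d w] l IH] a x0.
  (* After the last step the curve is constant, so that the Lipschitz bound holds up to any [b]. *)
  move=> _ _ _; exists (fun=> x0); split => // b p q _ pq _.
  by rewrite subrr normr0 mulr_ge0// subr_ge0.
move=> /steps_in_cons[/= [d0 Uw] Hl] ta; rewrite tot_cons /= addrA => HT.
have l0 := tot_ge0 Hl.
have adT : a + d <= T1 by apply: le_trans HT; rewrite lerDl.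
have [y [ya ylip dy]] := ode_exists x0 ta d0 adT Uw.
have tad : t1 <= a + d by rewrite (le_trans ta)// lerDl ltW.
have [z [za zlip zl]] := IH (a + d) (y (a + d)) Hl tad HT.
pose x t := if t < a + d then y t else z t.
have xz t : a + d <= t -> x t = z t by move=> adt; rewrite /x ltNge adt.
have xy t : t <= a + d -> x t = y t.
  rewrite le_eqVlt /x => /predU1P[->|->//]; by rewrite ltxx za.
exists x; split.
- by rewrite xy// lerDl ltW.
- move=> b p q ap pq _.
  have [qad|adq] := leP q (a + d).
    by rewrite !xy//; [exact: ylip|exact: le_trans qad].
  have [adp|pad] := leP (a + d) p.
    by rewrite !xz//; [apply: (zlip q)|exact: ltW].
  rewrite (xy p (ltW pad)) (xz q (ltW adq)).
  have -> : z q - y p = (z q - z (a + d)) + (y (a + d) - y p) by rewrite za addrA subrK.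
  have -> : q - p = (q - (a + d)) + ((a + d) - p) by rewrite addrA subrK.
  apply: (le_trans (ler_normD _ _)); rewrite mulrDr lerD//.
    by apply: (zlip q) => //; exact: ltW.
  by apply: ylip => //; exact: ltW.
- split; last exact: (@follows_eq _ _ _ z).
  move=> t at_ tad'; rewrite (xy t (ltW tad')).
  apply: (@is_derive_local _ _ y _ _ (a + d - t)); first by rewrite subr_gt0.
    by move=> q; rewrite ltr_norml => /andP[_ q2]; apply: xy; move: q2; hclear; lra.
  exact: dy.
Qed.

End follows.

(** * First order effect of a needle variation *)

Section needle.
Context {R : realType} {n r : nat}.
Variables (F : R -> 'rV[R]_n -> 'rV[R]_r -> 'rV[R]_n) (U : set 'rV[R]_r).
Variables (xt : R -> 'rV[R]_n) (D : R -> 'rV[R]_r -> 'M[R]_n) (t1 T1 C : R).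

(** [1 <= C] lets a single constant absorb the others through its powers. [D s u] stands for the
    derivative of [F s] in the state at the reference point [xt s]. *)
Definition regular_field :=
  [/\ 1 <= C,
      forall t x u, t1 <= t -> t <= T1 -> U u -> `|F t x u| <= C,
      forall t x x' u, t1 <= t -> t <= T1 -> U u ->
        `|F t x u - F t x' u| <= C * `|x - x'| &
      forall s (z : 'rV[R]_n) u, t1 <= s -> s <= T1 -> U u -> `|z *m D s u| <= C * `|z| ].

(** The second part is strict differentiability: both states move near the reference point, and the
    error is relative to their distance. This is what makes the end point a contraction in the
    intensities. *)
Definition approx_field (k d : R) :=
  (forall s t x u, t1 <= s -> s <= T1 -> t1 <= t -> t <= T1 -> `|t - s| < d ->
     `|x - xt s| < d -> U u -> `|F t x u - F s (xt s) u| <= k) /\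
  (forall s t x x' u, t1 <= s -> s <= T1 -> t1 <= t -> t <= T1 -> `|t - s| < d ->
     `|x - xt s| < d -> `|x' - xt s| < d -> U u ->
     `|F t x u - F t x' u - (x - x') *m D s u| <= k * `|x - x'|).

Hypothesis HF : regular_field /\ True.

(** For [c' <= c] the piece has three phases: [w] for both trajectories, then [u] against [w] during
    [(c - c') * l], then [u] for both. The middle phase produces the first order term, the others
    transport the difference linearly. The last one does so with [D s u] instead of [D s w], which
    costs an error of order [cb * l] because it lasts [c' * l]. *)
Lemma piece_diff_wlog (k d s a l : R) w u (c c' cb : R) (x x' : R -> 'rV[R]_n) (Cx : R) :
  approx_field k d -> 0 <= k -> t1 <= s -> s <= T1 -> t1 <= a -> 0 < l ->
  a + l <= T1 -> U w -> U u -> 6 * C * l <= 1 ->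
  0 <= c' -> c' <= c -> c <= cb -> c <= 1 -> 0 <= Cx ->
  (forall t, a <= t -> t <= a + l ->
     [/\ `|t - s| < d, `|x t - xt s| < d & `|x' t - xt s| < d]) ->
  lip_on a (a + l) Cx x -> lip_on a (a + l) Cx x' ->
  follows F [:: ((1 - c) * l, w); (c * l, u)] a x ->
  follows F [:: ((1 - c') * l, w); (c' * l, u)] a x' ->
  let z (t : R) : 'rV[R]_n := x t - x' t in
  `|z (a + l) - z a| <= 20 * C ^+ 2 * l * (`|z a| + (c - c')) /\
  `|z (a + l) - z a - l *: (z a *m D s w) -
      ((c - c') * l) *: (F s (xt s) u - F s (xt s) w)|
    <= 20 * C ^+ 2 * l * (k + l + cb) * (`|z a| + (c - c')).
Proof.
move=> [A1 A2] k0 ts sT ta l0 aT Uw Uu Cl c'0 c'c ccb c1 Cx0 reg lx lx'.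
have [[C1 FC FL DC] _] := HF.
move=> [dx1 [dx2 _]] [dx1' [dx2' _]] z.
set p := a + (1 - c) * l in dx1 dx2; set p' := a + (1 - c') * l in dx1' dx2'.
have C0 : 0 <= C by exact: le_trans C1.
have pc : p + c * l = a + l by rewrite /p; ring.
have pc' : p' + c' * l = a + l by rewrite /p'; ring.
rewrite pc in dx2; rewrite pc' in dx2'.
have ap : a <= p by rewrite /p lerDl mulr_ge0 ?subr_ge0// ltW.
have l0' := ltW l0.
have pp' : p <= p' by rewrite /p /p' lerD2l ler_wpM2r// lerD2l lerN2.
have p'e : p' <= a + l by rewrite -pc' lerDl mulr_ge0.
have pp'E : p' - p = (c - c') * l by rewrite /p' /p; ring.
have peE : a + l - p' = c' * l by rewrite /p'; ring.
have paE : p - a = (1 - c) * l by rewrite /p; ring.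
set e := a + l in aT reg lx lx' dx2 dx2' pc pc' p'e peE *.
clearbody p p'.
have ae : a <= e by rewrite /e lerDl.
have eaE : e - a = l by rewrite /e addrAC subrr add0r.
clearbody e.
have zlip : lip_on a e (Cx + Cx) z by exact: lip_onB.
have Cxx : 0 <= Cx + Cx by rewrite addr_ge0.
have tI t : a <= t -> t <= e -> t1 <= t /\ t <= T1.
  by move=> at_ te; rewrite (le_trans ta)// (le_trans te).
have dz (t : R) (v v' : 'rV[R]_n) : is_derive t 1 x v -> is_derive t 1 x' v' -> is_derive t 1 z (v - v').
  by move=> h1 h2; exact: (is_deriveB h1 h2).
pose g v v' t := F t (x t) v - F t (x' t) v'.
have g1 t : a < t -> t < p -> is_derive t 1 z (g w w t).
  by move=> at_ tp; apply: dz; [exact: dx1|apply: dx1'; rewrite // (lt_le_trans tp)].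
have g2 t : p < t -> t < p' -> is_derive t 1 z (g u w t).
  move=> pt tp; apply: dz; first by apply: dx2 => //; exact: lt_le_trans p'e.
  by apply: dx1' => //; exact: le_lt_trans pt.
have g3 t : p' < t -> t < e -> is_derive t 1 z (g u u t).
  by move=> pt te; apply: dz; [apply: dx2; rewrite // (le_lt_trans pp')|exact: dx2'].
set de := c - c'; have de0 : 0 <= de by rewrite subr_ge0.
have cl1 : C * l <= 1 / 6 by move: Cl; hclear; lra.
have Cl0 : 0 <= C * l by rewrite mulr_ge0.
have lipF t v : a <= t -> t <= e -> U v -> `|g v v t| <= C * `|z t| + 0.
  by move=> at_ te Uv; rewrite addr0; have [? ?] := tI t at_ te; exact: FL.
have z1 t : a <= t -> t <= p -> `|z t - z a| <= 2 * l * (C * `|z a|).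
  move=> at_ tp.
  have pl : p - a <= l by rewrite -eaE lerD2r (le_trans pp').
  have := @gronwall_small R _ a p C (Cx + Cx) z (g w w) 0 ap C0 (lexx 0) Cxx.
  rewrite addr0 => H; apply: (@le_trans _ _ (2 * (p - a) * (C * `|z a|))).
    apply: H => //.
    - by apply: lip_onW zlip; rewrite ?(le_trans pp').
    - move=> q aq qp; apply: lipF => //; [exact: ltW|].
      by rewrite (le_trans (ltW qp))// (le_trans pp').
    - have : C * (p - a) <= C * l by rewrite ler_wpM2l.
      by move: cl1; hclear; lra.
  by rewrite ler_wpM2r ?mulr_ge0// ler_wpM2l.
have za1 : `|z p| <= 2 * `|z a|.
  have := z1 p ap (lexx _).
  have -> : z p = z a + (z p - z a) by rewrite addrC subrK.
  move=> h; apply: (le_trans (ler_normD _ _)).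
  move: h; rewrite [z a + _]addrC subrK => h.
  have : C * l * `|z a| <= 1 / 6 * `|z a| by rewrite ler_wpM2r.
  have := normr_ge0 (z a).
  move: h; hclear; move: (`|z p - z a|) `|z a| => A B; nra.
have z2 t : p <= t -> t <= p' -> `|z t - z p| <= 2 * C * de * l.
  move=> pt tp'.
  have C2 : 0 <= 2 * C by rewrite mulr_ge0.
  have := @lipschitz_mvi R _ p t (Cx + Cx) z (g u w) 0 (2 * C) pt C2 Cxx.
  rewrite scaler0 subr0 => H; apply: (@le_trans _ _ (2 * C * (t - p))).
    apply: H => //.
    - by apply: lip_onW zlip => //; rewrite (le_trans tp').
    - by move=> q pq qt; apply: g2 => //; exact: lt_le_trans tp'.
    - move=> q pq qt; rewrite subr0 (le_trans (ler_normB _ _))//.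
      have [q1 q2] := tI q (le_trans ap (ltW pq)) (le_trans (ltW qt) (le_trans tp' p'e)).
      have := FC q (x q) u q1 q2 Uu; have := FC q (x' q) w q1 q2 Uw.
      by hclear; lra.
  by rewrite -[_ * de * l]mulrA ler_wpM2l// -pp'E lerD2r.
have za2 : `|z p'| <= 2 * `|z a| + de.
  have -> : z p' = z p + (z p' - z p) by rewrite addrC subrK.
  apply: (le_trans (ler_normD _ _)); apply: lerD => //.
  apply: (le_trans (z2 p' pp' (lexx _))).
  have : C * l * de <= 1 / 6 * de by rewrite ler_wpM2r.
  by move: de0; hclear; nra.
have z3 t : p' <= t -> t <= e -> `|z t - z p'| <= 2 * l * (C * (2 * `|z a| + de)).
  move=> pt te.
  have pl : e - p' <= l by rewrite -eaE lerD2l lerN2 (le_trans ap).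
  have := @gronwall_small R _ p' e C (Cx + Cx) z (g u u) 0 p'e C0 (lexx 0) Cxx.
  rewrite addr0 => H; apply: (@le_trans _ _ (2 * (e - p') * (C * `|z p'|))).
    apply: H => //.
    - by apply: lip_onW zlip; rewrite ?(le_trans ap).
    - move=> q aq qp; apply: lipF => //; [|exact: ltW].
      by rewrite (le_trans ap)// (le_trans pp')// ltW.
    - have : C * (e - p') <= C * l by rewrite ler_wpM2l.
      by move: cl1; hclear; lra.
  apply: ler_pM; rewrite ?mulr_ge0// ?subr_ge0//.
    by rewrite ler_wpM2l.
  by rewrite ler_wpM2l.
set B := `|z a| + de.
have za0 := normr_ge0 (z a).
have B0 : 0 <= B by rewrite addr_ge0.
have CCl : 0 <= C * l * `|z a| by rewrite mulr_ge0.
have CCd : 0 <= C * l * de by rewrite mulr_ge0.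
have zall t : a <= t -> t <= e -> `|z t - z a| <= 6 * C * l * B.
  move=> at_ te; have [tp|pt] := leP t p.
    apply: (le_trans (z1 t at_ tp)); rewrite /B; move: CCl CCd; hclear; nra.
  have h1 := z1 p ap (lexx _).
  have [tp'|p't] := leP t p'.
    have h2 := z2 t (ltW pt) tp'.
    have -> : z t - z a = (z t - z p) + (z p - z a) by rewrite addrA subrK.
    apply: (le_trans (ler_normD _ _)); rewrite /B; move: h1 h2 CCl CCd; hclear; nra.
  have h2 := z2 p' pp' (lexx _); have h3 := z3 t (ltW p't) te.
  have -> : z t - z a = (z t - z p') + (z p' - z p) + (z p - z a) by lmod R.
  apply: (le_trans (ler_normD _ _)); apply: (le_trans (lerD (ler_normD _ _) (lexx _))).
  rewrite /B; move: h1 h2 h3 CCl CCd; hclear; nra.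
(* Since [6 * C * l <= 1], the difference stays within twice [|z a| + (c - c')], so that the error
   terms can be measured by the data at the start of the piece. *)
have zB t : a <= t -> t <= e -> `|z t| <= 2 * B.
  move=> at_ te; have h := zall t at_ te.
  have -> : z t = z a + (z t - z a) by rewrite addrC subrK.
  apply: (le_trans (ler_normD _ _)).
  have : C * l * B <= 1 / 6 * B by rewrite ler_wpM2r.
  move: h B0 de0 za0; rewrite /B; hclear; move: (`|z t - z a|) => q; nra.
have C20 : 0 <= C ^+ 2 by rewrite exprn_ge0.
have CC2 : C <= C ^+ 2 by rewrite expr2 ler_peMr.
have one2 : 1 <= C ^+ 2 by rewrite exprn_ege1.
split.
  apply: (le_trans (zall e ae (lexx _))); rewrite ler_wpM2r// ler_wpM2r//.
  by move: CC2 C20; hclear; lra.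
pose M := 2 * k + 6 * C ^+ 2 * l.
have M0 : 0 <= M by rewrite addr_ge0 ?mulr_ge0.
have gD t v : a <= t -> t <= e -> U v -> `|g v v t - z a *m D s v| <= M * B.
  move=> at_ te Uv; have [q1 q2] := tI t at_ te; have [r1 r2 r3] := reg t at_ te.
  have -> : g v v t - z a *m D s v =
      (F t (x t) v - F t (x' t) v - z t *m D s v) + (z t - z a) *m D s v.
    have mB : (z t - z a) *m D s v = z t *m D s v - z a *m D s v by exact: mulmxBl.
    by rewrite mB /g; lmod R.
  apply: (le_trans (ler_normD _ _)); rewrite /M mulrDl lerD//.
    apply: (le_trans (A2 s t _ _ v ts sT q1 q2 r1 r2 r3 Uv)).
    by rewrite -mulrA mulrCA ler_wpM2l// zB.
  apply: (le_trans (DC s _ v ts sT Uv)).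
  have := ler_wpM2l C0 (zall t at_ te); rewrite expr2; hclear.
  by move: (C * _) => q; lra.
have MB0 : 0 <= M * B by rewrite mulr_ge0.
have b1 : `|z p - z a - (p - a) *: (z a *m D s w)| <= M * B * (p - a).
  apply: (@lipschitz_mvi R _ a p (Cx + Cx) z (g w w)) => //.
    by apply: lip_onW zlip; rewrite ?(le_trans pp').
  move=> t at_ tp; apply: gD => //; first exact: ltW.
  by rewrite (le_trans (ltW tp))// (le_trans pp').
have b2 : `|z p' - z p - (p' - p) *: (F s (xt s) u - F s (xt s) w)| <= 2 * k * (p' - p).
  apply: (@lipschitz_mvi R _ p p' (Cx + Cx) z (g u w)) => //.
  - by rewrite mulr_ge0.
  - exact: lip_onW zlip.
  - move=> t pt tp'.
    have at_ := le_trans ap (ltW pt); have te := le_trans (ltW tp') p'e.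
    have [q1 q2] := tI t at_ te; have [r1 r2 r3] := reg t at_ te.
    have -> : g u w t - (F s (xt s) u - F s (xt s) w) =
      (F t (x t) u - F s (xt s) u) - (F t (x' t) w - F s (xt s) w) by rewrite /g; lmod R.
    apply: (le_trans (ler_normB _ _)).
    have := A1 s t (x t) u ts sT q1 q2 r1 r2 Uu.
    have := A1 s t (x' t) w ts sT q1 q2 r1 r3 Uw.
    by hclear; lra.
have b3 : `|z e - z p' - (e - p') *: (z a *m D s u)| <= M * B * (e - p').
  apply: (@lipschitz_mvi R _ p' e (Cx + Cx) z (g u u)) => //.
    by apply: lip_onW zlip; rewrite ?(le_trans ap).
  move=> t at_ tp; apply: gD => //; last exact: ltW.
  by rewrite (le_trans ap)// (le_trans pp')// ltW.
have -> : z e - z a - l *: (z a *m D s w) - (de * l) *: (F s (xt s) u - F s (xt s) w) =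
  (z p - z a - (p - a) *: (z a *m D s w)) +
  (z p' - z p - (p' - p) *: (F s (xt s) u - F s (xt s) w)) +
  (z e - z p' - (e - p') *: (z a *m D s u)) - (c * l) *: (z a *m D s w)
   + (c' * l) *: (z a *m D s u).
  rewrite paE pp'E peE /de; move: (F s (xt s) u - F s (xt s) w) => f0; lmod R.
apply: (le_trans (ler_normD _ _)); apply: (le_trans (lerD (ler_normB _ _) (lexx _))).
apply: (le_trans (lerD (lerD (ler_normD _ _) (lexx _)) (lexx _))).
apply: (le_trans (lerD (lerD (lerD (ler_normD _ _) (lexx _)) (lexx _)) (lexx _))).
have c0 : 0 <= c by exact: le_trans c'c.
have n1 : `|(c * l) *: (z a *m D s w)| <= cb * l * C * B.
  rewrite normrZ ger0_norm ?mulr_ge0//.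
  apply: (@le_trans _ _ (c * l * (C * `|z a|))).
    by rewrite ler_wpM2l ?mulr_ge0// DC.
  rewrite -[leRHS]mulrA; apply: ler_pM => //.
  - by rewrite mulr_ge0.
  - by rewrite mulr_ge0.
  - by rewrite ler_wpM2r.
  - by rewrite ler_wpM2l// lerDl.
have n2 : `|(c' * l) *: (z a *m D s u)| <= cb * l * C * B.
  rewrite normrZ ger0_norm ?mulr_ge0//.
  apply: (@le_trans _ _ (c' * l * (C * `|z a|))).
    by rewrite ler_wpM2l ?mulr_ge0// DC.
  rewrite -[leRHS]mulrA; apply: ler_pM => //.
  - by rewrite mulr_ge0.
  - by rewrite mulr_ge0.
  - by rewrite ler_wpM2r// (le_trans c'c).
  - by rewrite ler_wpM2l// lerDl.
have cb0 : 0 <= cb by rewrite (le_trans c'0)// (le_trans c'c).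
have m1 : M * B * (p - a) <= M * B * l by rewrite ler_wpM2l// -eaE lerD2r (le_trans pp').
have m3 : M * B * (e - p') <= M * B * l.
  by rewrite ler_wpM2l// -eaE lerD2l lerN2 (le_trans ap).
have m2 : 2 * k * (p' - p) <= 2 * k * (B * l).
  rewrite ler_wpM2l ?mulr_ge0// pp'E ler_wpM2r//.
  by rewrite /B lerDr.
have Bl : 0 <= B * l by rewrite mulr_ge0.
apply: (@le_trans _ _ ((2 * M + 2 * k + 2 * cb * C) * (B * l))).
  move: b1 b2 b3 n1 n2 m1 m2 m3; hclear.
  move: (`|z p - z a - _|) (`|z p' - z p - _|) (`|z e - z p' - _|) => X1 X2 X3.
  move: (`|(c * l) *: _|) (`|(c' * l) *: _|) => X4 X5; lra.
have -> : 20 * C ^+ 2 * l * (k + l + cb) * B = 20 * C ^+ 2 * (k + l + cb) * (B * l) by ring.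
rewrite ler_wpM2r// /M.
have h1 : k <= C ^+ 2 * k by rewrite ler_peMl.
have h2 : 0 <= C ^+ 2 * l by rewrite mulr_ge0.
have h3 : C * cb <= C ^+ 2 * cb by rewrite ler_wpM2r.
have h4 : 0 <= C ^+ 2 * k by rewrite mulr_ge0.
have h5 : 0 <= C ^+ 2 * cb by rewrite mulr_ge0.
move: h1 h2 h3 h4 h5; rewrite expr2; hclear; nra.
Qed.

End needle.

(** * Accumulation of the first order effects over one cell *)

Section cell.
Context {R : realType} {n r : nat} {I : Type}.
Variables (F : R -> 'rV[R]_n -> 'rV[R]_r -> 'rV[R]_n) (U : set 'rV[R]_r).
Variables (xt : R -> 'rV[R]_n) (D : R -> 'rV[R]_r -> 'M[R]_n) (t1 T1 C : R).

Hypothesis HF : regular_field F U D t1 T1 C /\ True.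

(** By symmetry: exchanging the two trajectories changes the sign of [z]. *)
Lemma piece_diff (k d s a l : R) w u (c c' cb de : R) (x x' : R -> 'rV[R]_n) (Cx : R) :
  approx_field F U xt D t1 T1 k d -> 0 <= k -> t1 <= s -> s <= T1 -> t1 <= a -> 0 < l ->
  a + l <= T1 -> U w -> U u -> 6 * C * l <= 1 ->
  0 <= c -> c <= cb -> 0 <= c' -> c' <= cb -> cb <= 1 -> `|c - c'| <= de -> 0 <= Cx ->
  (forall t, a <= t -> t <= a + l ->
     [/\ `|t - s| < d, `|x t - xt s| < d & `|x' t - xt s| < d]) ->
  lip_on a (a + l) Cx x -> lip_on a (a + l) Cx x' ->
  follows F [:: ((1 - c) * l, w); (c * l, u)] a x ->
  follows F [:: ((1 - c') * l, w); (c' * l, u)] a x' ->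
  let z (t : R) : 'rV[R]_n := x t - x' t in
  `|z (a + l) - z a| <= 20 * C ^+ 2 * l * (`|z a| + de) /\
  `|z (a + l) - z a - l *: (z a *m D s w) -
      ((c - c') * l) *: (F s (xt s) u - F s (xt s) w)|
    <= 20 * C ^+ 2 * l * (k + l + cb) * (`|z a| + de).
Proof.
move=> A k0 ts sT ta l0 aT Uw Uu Cl c0 ccb c'0 c'cb cb1 cde Cx0 reg lx lx' fx fx' z.
have C1 : 1 <= C by have [[]] := HF.
have C20 : 0 <= C ^+ 2 by rewrite exprn_ge0// (le_trans _ C1).
have K1 : 0 <= 20 * C ^+ 2 * l by apply: mulr_ge0; [apply: mulr_ge0|exact: ltW].
have cb0 : 0 <= cb by exact: le_trans ccb.
have K2 : 0 <= 20 * C ^+ 2 * l * (k + l + cb) by rewrite mulr_ge0// !addr_ge0//; exact: ltW.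
have [c'c|cc'] := leP c' c.
  rewrite ger0_norm ?subr_ge0// in cde.
  have [h1 h2] := piece_diff_wlog HF A k0 ts sT ta l0 aT Uw Uu Cl c'0 c'c ccb
    (le_trans ccb cb1) Cx0 reg lx lx' fx fx'.
  have le1 : `|z a| + (c - c') <= `|z a| + de by rewrite lerD2l.
  split; [apply: (le_trans h1)|apply: (le_trans h2)]; exact: ler_wpM2l.
rewrite ltr0_norm ?subr_lt0// opprB in cde.
have reg' t : a <= t -> t <= a + l ->
    [/\ `|t - s| < d, `|x' t - xt s| < d & `|x t - xt s| < d].
  by move=> h1 h2; have [] := reg t h1 h2.
have [h1 h2] := piece_diff_wlog HF A k0 ts sT ta l0 aT Uw Uu Cl c0 (ltW cc') c'cb
  (le_trans c'cb cb1) Cx0 reg' lx' lx fx' fx.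
have zE t : x' t - x t = - z t by rewrite opprB.
have le1 : `|z a| + (c' - c) <= `|z a| + de by rewrite lerD2l.
rewrite !zE normrN -opprD normrN in h1.
split; first by apply: (le_trans h1); exact: ler_wpM2l.
rewrite !zE normrN in h2.
have E : z (a + l) - z a - l *: (z a *m D s w) -
      ((c - c') * l) *: (F s (xt s) u - F s (xt s) w) =
  - (- z (a + l) - - z a - l *: (- z a *m D s w) -
      ((c' - c) * l) *: (F s (xt s) u - F s (xt s) w)).
  have mN : - z a *m D s w = - (z a *m D s w) by exact: mulNmx.
  by rewrite mN; lmod R.
rewrite E normrN; apply: (le_trans h2); exact: ler_wpM2l.
Qed.

(* A piece [(l, (w, u, j))] is a time interval of length [l] with base control
   [w], whose last fraction [g j] is replaced by [u]. *)
Definition piece : Type := R * ('rV[R]_r * 'rV[R]_r * I).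

Fixpoint needles (g : I -> R) (P : seq piece) : seq (R * 'rV[R]_r) :=
  if P is (l, (w, u, j)) :: P' then
    ((1 - g j) * l, w) :: (g j * l, u) :: needles g P'
  else [::].

Fixpoint pieces_ok (P : seq piece) : Prop :=
  if P is (l, (w, u, j)) :: P' then [/\ 0 < l, U w & U u] /\ pieces_ok P' else True.

Lemma tot_needles g P : tot (needles g P) = tot P.
Proof.
elim: P => [|[l [[w u] j]] P IH] /=; first by rewrite /tot !big_nil.
by rewrite !tot_cons /= IH; ring.
Qed.

Lemma needles_cat g P Q : needles g (P ++ Q) = needles g P ++ needles g Q.
Proof. by elim: P => [//|[l [[w u] j]] P IH] /=; rewrite IH. Qed.

Lemma pieces_ok_cat P Q : pieces_ok P -> pieces_ok Q -> pieces_ok (P ++ Q).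
Proof. by elim: P => [//|[l [[w u] j]] P IH] /= [H HP] HQ; split => //; exact: IH. Qed.

Lemma steps_in_needles g P : (forall j, 0 < g j < 1) -> pieces_ok P ->
  steps_in U (needles g P).
Proof.
move=> g01; elim: P => [//|[l [[w u] j]] P IH] /= [[l0 Uw Uu] HP].
have /andP[g0 g1] := g01 j.
apply/steps_in_cons; split => /=; first by rewrite mulr_gt0// subr_gt0.
apply/steps_in_cons; split => /=; first by rewrite mulr_gt0.
exact: IH.
Qed.

Lemma tot_pieces_ge0 P : pieces_ok P -> 0 <= tot P.
Proof.
elim: P => [_|[l [[w u] j]] P IH] /=; first by rewrite /tot big_nil.
by move=> [[l0 _ _] /IH P0]; rewrite tot_cons /= addr_ge0// ltW.
Qed.

(** Induction over the pieces, with the linearization frozen at the difference [z a] at the start of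
    the cell. The hypothesis on [z b - z a] is the drift so far; [40 * C ^+ 2 * h <= 1] keeps it
    below [B], and freezing costs [C] times this drift per unit of time. *)
Lemma cell_diff (k d s a h cb de : R) (g g' : I -> R) (x x' : R -> 'rV[R]_n) (Cx : R) :
  approx_field F U xt D t1 T1 k d -> 0 <= k -> t1 <= s -> s <= T1 -> t1 <= a ->
  a + h <= T1 -> 40 * C ^+ 2 * h <= 1 -> cb <= 1 -> 0 <= Cx ->
  (forall j, 0 < g j <= cb) -> (forall j, 0 < g' j <= cb) ->
  (forall j, `|g j - g' j| <= de) -> 0 <= de ->
  (forall t, a <= t -> t <= a + h ->
     [/\ `|t - s| < d, `|x t - xt s| < d & `|x' t - xt s| < d]) ->
  lip_on a (a + h) Cx x -> lip_on a (a + h) Cx x' ->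
  let z (t : R) : 'rV[R]_n := x t - x' t in
  let B := `|z a| + de in
  forall P b, a <= b -> b + tot P <= a + h -> pieces_ok P ->
    follows F (needles g P) b x -> follows F (needles g' P) b x' ->
    `|z b - z a| <= 40 * C ^+ 2 * (b - a) * B ->
  `|z (b + tot P) - z b| <= 40 * C ^+ 2 * tot P * B /\
  `|z (b + tot P) - z b - \sum_(p <- P) (p.1 *: (z a *m D s p.2.1.1) +
      ((g p.2.2 - g' p.2.2) * p.1) *: (F s (xt s) p.2.1.2 - F s (xt s) p.2.1.1))|
    <= tot P * (80 * C ^+ 3 * (k + h + cb)) * B.
Proof.
move=> A k0 ts sT ta aT Ch cb1 Cx0 gcb g'cb gde de0 reg lx lx' z B.
have [[C1 _ _ DC] _] := HF.
have C0 : 0 <= C by exact: le_trans C1.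
have C20 : 0 <= C ^+ 2 by rewrite exprn_ge0.
have C21 : 1 <= C ^+ 2 by rewrite exprn_ege1.
have za0 := normr_ge0 (z a).
have B0 : 0 <= B by rewrite addr_ge0.
elim=> [|[l [[w u] j]] P IH] b ab bh ok fx fx' zb.
  by rewrite /tot !big_nil addr0 subrr subr0 normr0 mulr0 !mul0r.
move: ok => /= [[l0 Uw Uu] okP].
have tP := tot_pieces_ge0 okP.
rewrite tot_cons /= in bh *.
have /andP[g0 gb] := gcb j; have /andP[g'0 g'b] := g'cb j.
have cb0 : 0 <= cb by rewrite (le_trans (ltW g0)).
have bl : b + l <= a + h by move: bh tP; hclear; lra.
have h0 : 0 <= h by move: ab bl l0; hclear; lra.
have lh : l <= h by move: ab bl; hclear; lra.
have bah : b - a <= h by move: bl l0; hclear; lra.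
have fb : follows F [:: ((1 - g j) * l, w); (g j * l, u)] b x.
  by move: fx => /= [? [? _]].
have fb' : follows F [:: ((1 - g' j) * l, w); (g' j * l, u)] b x'.
  by move: fx' => /= [? [? _]].
have bE (c : R) : b + (1 - c) * l + c * l = b + l by ring.
have fP : follows F (needles g P) (b + l) x.
  by move: fx => /= [_ [_]]; rewrite bE.
have fP' : follows F (needles g' P) (b + l) x'.
  by move: fx' => /= [_ [_]]; rewrite bE.
have Cl : 6 * C * l <= 1.
  have e1 : C * l <= C ^+ 2 * h.
    by rewrite expr2; apply: ler_pM => //; [exact: ltW|rewrite ler_peMr].
  have e2 : 0 <= C ^+ 2 * h by rewrite mulr_ge0.
  by move: e1 e2 Ch; hclear; lra.
have [|p1 p2] := piece_diff A k0 ts sT (le_trans ta ab) l0 (le_trans bl aT) Uw Uu Cl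
    (ltW g0) gb (ltW g'0) g'b cb1 (gde j) Cx0 _ (lip_onW ab bl lx) (lip_onW ab bl lx') fb fb'.
  by move=> t bt tb; apply: reg; [exact: le_trans bt|exact: le_trans bl].
have zbB : `|z b| + de <= 2 * B.
  have -> : z b = z a + (z b - z a) by rewrite addrC subrK.
  have : 40 * C ^+ 2 * (b - a) * B <= 40 * C ^+ 2 * h * B.
    by rewrite ler_wpM2r// ler_wpM2l// mulr_ge0.
  have : 40 * C ^+ 2 * h * B <= 1 * B by rewrite ler_wpM2r.
  have := ler_normD (z a) (z b - z a).
  by move: zb; rewrite /B; hclear; lra.
have Kl0 : 0 <= 20 * C ^+ 2 * l by apply: mulr_ge0; [apply: mulr_ge0|exact: ltW].
have q1 : `|z (b + l) - z b| <= 40 * C ^+ 2 * l * B.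
  apply: (le_trans p1); apply: (@le_trans _ _ (20 * C ^+ 2 * l * (2 * B))).
    exact: ler_wpM2l.
  by rewrite -subr_ge0 (_ : _ - _ = 0)//; ring.
have zbl : `|z (b + l) - z a| <= 40 * C ^+ 2 * (b + l - a) * B.
  have -> : z (b + l) - z a = (z (b + l) - z b) + (z b - z a) by lmod R.
  apply: (le_trans (ler_normD _ _)); apply: (le_trans (lerD q1 zb)).
  by rewrite -subr_ge0 (_ : _ - _ = 0)//; ring.
have abl : a <= b + l by rewrite (le_trans ab)// lerDl ltW.
rewrite addrA in bh.
have [h1 h2] := IH (b + l) abl bh okP fP fP' zbl.
rewrite addrA; split.
  have -> : z (b + l + tot P) - z b = (z (b + l + tot P) - z (b + l)) + (z (b + l) - z b).
    by lmod R.
  apply: (le_trans (ler_normD _ _)); apply: (le_trans (lerD h1 q1)).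
  by rewrite -subr_ge0 (_ : _ - _ = 0)//; ring.
rewrite big_cons /=.
set S := \sum_(p <- P) _ in h2 *.
set f0 := F s (xt s) u - F s (xt s) w in p2 *.
have -> : z (b + l + tot P) - z b - (l *: (z a *m D s w) + ((g j - g' j) * l) *: f0 + S) =
   (z (b + l + tot P) - z (b + l) - S) +
   (z (b + l) - z b - l *: (z b *m D s w) - ((g j - g' j) * l) *: f0) +
   l *: ((z b - z a) *m D s w).
  have mB : (z b - z a) *m D s w = z b *m D s w - z a *m D s w by exact: mulmxBl.
  by rewrite mB; lmod R.
apply: (le_trans (ler_normD _ _)); apply: (le_trans (lerD (ler_normD _ _) (lexx _))).
have n3 : `|l *: ((z b - z a) *m D s w)| <= l * (C * (40 * C ^+ 2 * h * B)).
  rewrite normrZ ger0_norm ?ler_wpM2l//; try exact: ltW.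
  apply: (le_trans (DC s _ _ ts sT Uw)); rewrite ler_wpM2l//.
  apply: (le_trans zb); rewrite ler_wpM2r// ler_wpM2l// mulr_ge0//.
have n2 : 20 * C ^+ 2 * l * (k + l + cb) * (`|z b| + de) <=
    20 * C ^+ 2 * l * (k + h + cb) * (2 * B).
  apply: ler_pM => //.
  - by rewrite mulr_ge0// !addr_ge0// ltW.
  - by rewrite addr_ge0.
  - by rewrite ler_wpM2l// lerD2r lerD2l.
apply: (le_trans (lerD (lerD h2 (le_trans p2 n2)) n3)).
have kk : 0 <= k + cb by rewrite addr_ge0.
have C3 : C ^+ 2 <= C ^+ 3 by rewrite exprS ler_peMl.
have lB : 0 <= l * B by rewrite mulr_ge0// ltW.
have e1 : C ^+ 2 * (k + h + cb) <= C ^+ 3 * (k + h + cb) by rewrite ler_wpM2r// !addr_ge0.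
have e2 : C ^+ 3 * h <= C ^+ 3 * (k + h + cb).
  rewrite ler_wpM2l ?exprn_ge0//; move: kk; hclear; lra.
have -> : (l + tot P) * (80 * C ^+ 3 * (k + h + cb)) * B =
  tot P * (80 * C ^+ 3 * (k + h + cb)) * B + l * B * (80 * (C ^+ 3 * (k + h + cb))).
  by ring.
rewrite -addrA lerD2l.
have -> : 20 * C ^+ 2 * l * (k + h + cb) * (2 * B) = l * B * (40 * (C ^+ 2 * (k + h + cb))) by ring.
have -> : l * (C * (40 * C ^+ 2 * h * B)) = l * B * (40 * (C ^+ 3 * h)) by ring.
rewrite -mulrDr ler_wpM2l//; move: e1 e2; hclear; lra.
Qed.

(** The term [2 * C * cb] pays for the fraction of time, at most [cb], in which a variation replaces
    the base control. *)
Lemma cell_close (E cb s : R) (g : I -> R) (x : R -> 'rV[R]_n) (Cx : R) :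
  t1 <= s -> s <= T1 -> 0 <= E -> 0 <= Cx -> cb <= 1 -> (forall j, 0 < g j <= cb) ->
  forall P b, pieces_ok P -> 
    lip_on b (b + tot P) Cx x -> follows F (needles g P) b x ->
    (forall t u, b <= t -> t <= b + tot P -> U u ->
        `|F t (x t) u - F s (xt s) u| <= E) ->
  `|x (b + tot P) - x b - \sum_(p <- P) p.1 *: F s (xt s) p.2.1.1| <=
    tot P * (E + 2 * C * cb).
Proof.
move=> ts sT E0 Cx0 cb1 gcb; have [[C1 FC _ _] _] := HF.
have C0 : 0 <= C by exact: le_trans C1.
elim=> [|[l [[w u] j]] P IH] b ok lx fx FE.
  by rewrite /tot !big_nil addr0 subrr subr0 normr0 mul0r.
move: ok => /= [[l0 Uw Uu] okP].
have tP := tot_pieces_ge0 okP.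
rewrite tot_cons /= in lx FE *.
have /andP[g0 gb] := gcb j.
have bE : b + (1 - g j) * l + g j * l = b + l by ring.
move: fx => /= [f1 [f2]]; rewrite bE in f2 * => fP.
have bl : b <= b + l by rewrite lerDl ltW.
rewrite addrA in lx FE.
have h1 := IH (b + l) okP (lip_onW bl (lexx _) lx) fP (fun t v bt => FE t v (le_trans bl bt)).
set m := b + (1 - g j) * l in f1 f2.
have bm : b <= m by rewrite /m lerDl mulr_ge0 ?subr_ge0 ?(le_trans gb)// ltW.
have mbl : m <= b + l by rewrite -bE lerDl mulr_ge0// ltW.
have blP : b + l <= b + l + tot P by rewrite lerDl.
have mb : m - b = (1 - g j) * l by rewrite /m addrAC subrr add0r.
have blm : b + l - m = g j * l by rewrite /m; ring.
clearbody m.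
have h2 : `|x m - x b - (m - b) *: F s (xt s) w| <= E * (m - b).
  apply: (@lipschitz_mvi R _ b m Cx x (fun t => F t (x t) w)) => //.
    by apply: lip_onW lx; rewrite ?(le_trans mbl).
  move=> t bt tm; apply: FE => //; first exact: ltW.
  by rewrite (le_trans (ltW tm))// (le_trans mbl).
have h3 : `|x (b + l) - x m - (b + l - m) *: F s (xt s) u| <= E * (b + l - m).
  apply: (@lipschitz_mvi R _ m (b + l) Cx x (fun t => F t (x t) u)) => //.
    by apply: lip_onW lx.
  move=> t bt tm; apply: FE => //; first by rewrite (le_trans bm)// ltW.
  by rewrite (le_trans (ltW tm)).
rewrite addrA big_cons /=.
set S := \sum_(p <- P) _ in h1 *.
have -> : x (b + l + tot P) - x b - (l *: F s (xt s) w + S) =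
  (x (b + l + tot P) - x (b + l) - S) + (x m - x b - (m - b) *: F s (xt s) w) +
  (x (b + l) - x m - (b + l - m) *: F s (xt s) u) +
  (g j * l) *: (F s (xt s) u - F s (xt s) w).
  by rewrite mb blm; lmod R.
apply: (le_trans (ler_normD _ _)); apply: (le_trans (lerD (ler_normD _ _) (lexx _))).
apply: (le_trans (lerD (lerD (ler_normD _ _) (lexx _)) (lexx _))).
have h4 : `|(g j * l) *: (F s (xt s) u - F s (xt s) w)| <= cb * l * (2 * C).
  have gl : 0 <= g j * l by rewrite mulr_ge0// ltW.
  rewrite normrZ ger0_norm//; apply: ler_pM => //.
    by rewrite ler_wpM2r// ltW.
  have := FC s (xt s) u ts sT Uu; have := FC s (xt s) w ts sT Uw.
  by have := ler_normB (F s (xt s) u) (F s (xt s) w); hclear; lra.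
apply: (le_trans (lerD (lerD (lerD h1 h2) h3) h4)).
rewrite mb blm -subr_ge0 (_ : _ - _ = 0)//; ring.
Qed.

End cell.

(** * Accumulation over the grid and transport to its end *)

Section grid.
Context {R : realType} {n r m : nat}.
Variables (F : R -> 'rV[R]_n -> 'rV[R]_r -> 'rV[R]_n) (U : set 'rV[R]_r).
Variables (xt : R -> 'rV[R]_n) (D : R -> 'rV[R]_r -> 'M[R]_n) (t1 T1 C : R).

Hypothesis HF : regular_field F U D t1 T1 C /\ True.

Variables (h : R) (pw : nat -> seq (R * 'rV[R]_r)) (vu : 'I_m.+1 -> 'rV[R]_r).
Variable act : nat -> 'I_m.+1 -> bool.

(* Each cell is cut into m.+1 equal parts, the j-th of which is used for the
   j-th variation; the weights [pw i] give the time shares of the controls. *)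
Definition cellP (i : nat) : seq (@piece R r 'I_m.+1) :=
  [seq (h / m.+1%:R * p.1, (p.2, if act i j then vu j else p.2, j))
    | j <- enum 'I_m.+1, p <- pw i].

Fixpoint gridP (M : nat) : seq (@piece R r 'I_m.+1) :=
  if M is M'.+1 then gridP M' ++ cellP M' else [::].

Definition ti (i : nat) : R := t1 + i%:R * h.

Lemma sum_cellP (V : nmodType) (G : @piece R r 'I_m.+1 -> V) i :
  \sum_(q <- cellP i) G q = \sum_j \sum_(p <- pw i)
    G (h / m.+1%:R * p.1, (p.2, if act i j then vu j else p.2, j)).
Proof. by rewrite /cellP big_allpairs_dep big_enum. Qed.

Hypothesis Hpw : (0 < h /\ True) /\ forall i, weights U (pw i).
Hypothesis Hvu : forall j, U (vu j).

Lemma tiS i : ti i.+1 = ti i + h.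
Proof. by rewrite /ti -natr1 mulrDl mul1r addrA. Qed.

Lemma tot_cellP i : tot (cellP i) = h.
Proof.
have [_ /(_ i) [_ s1]] := Hpw.
rewrite /tot sum_cellP /=.
under eq_bigr do rewrite -mulr_sumr s1 mulr1.
by rewrite sumr_const card_ord -[_ *+ _]mulr_natr mulfVK.
Qed.

Lemma cellP_ok i : pieces_ok U (cellP i).
Proof.
have [[h0 _] /(_ i) [s1 _]] := Hpw.
rewrite /cellP; elim: (enum 'I_m.+1) => [//|j js IH].
rewrite allpairs_cons; apply: pieces_ok_cat => //.
elim: (pw i) s1 => [//|p s IH2] s1 /=; split.
  have [p0 Up] := s1 p (mem_head _ _).
  split => //; first by rewrite mulr_gt0// divr_gt0.
  by case: ifP.
by apply: IH2 => q qs; apply: s1; rewrite inE qs orbT.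
Qed.

Lemma gridP_ok M : pieces_ok U (gridP M).
Proof.
elim: M => [//|M IH] /=; apply: pieces_ok_cat => //; exact: cellP_ok.
Qed.

Lemma tot_gridP M : tot (gridP M) = M%:R * h.
Proof.
elim: M => [|M IH] /=; first by rewrite /tot big_nil mul0r.
by rewrite tot_cat IH tot_cellP -natr1 mulrDl mul1r.
Qed.

Lemma follows_gridP g x M i : (i < M)%N -> follows F (needles g (gridP M)) t1 x ->
  follows F (needles g (cellP i)) (ti i) x.
Proof.
elim: M => [//|M IH] /=; rewrite ltnS leq_eqVlt => /predU1P[->|iM].
  by rewrite needles_cat => /follows_cat[_]; rewrite tot_needles tot_gridP.
by rewrite needles_cat => /follows_cat[/(IH iM)].
Qed.

Lemma ti_ge i : t1 <= ti i.
Proof. by have [[h0 _] _] := Hpw; rewrite /ti lerDl mulr_ge0// ltW. Qed.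

Lemma ti_le i j : (i <= j)%N -> ti i <= ti j.
Proof. by have [[h0 _] _] := Hpw; move=> ij; rewrite /ti lerD2l ler_pM2r// ler_nat. Qed.

Lemma discrete_gronwall (B : nat -> R) (K : R) M : 0 <= K ->
  (forall i, (i < M)%N -> B i.+1 <= (1 + K * h) * B i) -> 0 <= B 0%N -> ti M <= T1 ->
  forall i, (i <= M)%N -> B i <= expR (K * (T1 - t1)) * B 0%N.
Proof.
have [[h0 _] _] := Hpw.
move=> K0 HB B0 tM i iM.
have KH : 0 <= K * h by rewrite mulr_ge0// ltW.
have Bi : B i <= (1 + K * h) ^+ i * B 0%N.
  elim: i iM => [|i IH] iM; first by rewrite expr0 mul1r.
  apply: (le_trans (HB i iM)); rewrite exprS -mulrA ler_wpM2l ?addr_ge0//.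
  by apply: IH; exact: ltnW.
apply: (le_trans Bi); rewrite ler_wpM2r//.
apply: (@le_trans _ _ (expR (i%:R * (K * h)))).
  by rewrite expRM_natl lerXn2r ?nnegrE ?expR_ge0 ?addr_ge0// expR_ge1Dx.
rewrite ler_expR mulrCA ler_wpM2l//.
rewrite lerBrDl; exact: le_trans (ti_le iM) tM.
Qed.

(** In each cell the base controls reproduce the increment of [xt] up to [eta * h]; freezing time
    and state at the left node costs [C * h] times the current distance and terms which vanish with
    [k] and [h]. Gronwall's inequality sums these errors up. *)
Theorem grid_close (k cb eta : R) (g : 'I_m.+1 -> R) (x : R -> 'rV[R]_n) M :
  0 <= k -> 0 <= eta -> cb <= 1 -> ti M <= T1 ->
  (forall j, 0 < g j <= cb) ->
  lip_on t1 (ti M) C x -> lip_on t1 (ti M) C xt -> x t1 = xt t1 ->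
  follows F (needles g (gridP M)) t1 x ->
  (forall s t u, t1 <= s -> s <= T1 -> t1 <= t -> t <= T1 -> `|t - s| <= h -> U u ->
     `|F t (xt t) u - F s (xt s) u| <= k) ->
  (forall i, (i < M)%N ->
    `|h *: (\sum_(p <- pw i) p.1 *: F (ti i) (xt (ti i)) p.2) -
      (xt (ti i.+1) - xt (ti i))| <= eta * h) ->
  forall i, (i <= M)%N -> `|x (ti i) - xt (ti i)| <=
    expR (C * (T1 - t1)) * (T1 - t1) * (k + 2 * C ^+ 2 * h + 2 * C * cb + eta).
Proof.
move=> k0 eta0 cb1 tM gcb lx lxt x0 fx Hk Hf.
have [[h0 _] Hw] := Hpw; have [[C1 _ FL _] _] := HF.
have h0' := ltW h0.
have C0 : 0 <= C by exact: le_trans C1.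
have cb0 : 0 <= cb by have /andP[g0 gb] := gcb ord0; apply: le_trans gb; exact: ltW.
set err := k + _ + _ + eta.
have err0 : 0 <= err by rewrite !addr_ge0// !mulr_ge0// exprn_ge0.
have C2 : 0 <= C ^+ 2 by rewrite exprn_ge0.
have step i : (i < M)%N -> `|x (ti i.+1) - xt (ti i.+1)| <=
    (1 + C * h) * `|x (ti i) - xt (ti i)| + h * err.
  move=> iM.
  have tiM : ti i.+1 <= T1 by apply: le_trans tM; exact: ti_le.
  have tiM' : ti i.+1 <= ti M by exact: ti_le.
  have tii : ti i <= ti i.+1 by exact: ti_le.
  have t1i := ti_ge i.
  set di := `|x (ti i) - xt (ti i)|.
  have di0 : 0 <= di by exact: normr_ge0.
  pose E := C * (di + 2 * C * h) + k.
  have E0 : 0 <= E by rewrite addr_ge0 ?mulr_ge0 ?addr_ge0 ?mulr_ge0.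
  have := @cell_close R n r 'I_m.+1 F U xt D t1 T1 C HF E cb (ti i) g x C t1i (le_trans tii tiM)
     E0 C0 cb1 gcb (cellP i) (ti i) (cellP_ok i).
  rewrite tot_cellP -tiS => H.
  have {}H := H (lip_onW t1i tiM' lx) (follows_gridP iM fx) _.
  have Ht : forall t u, ti i <= t -> t <= ti i.+1 -> U u ->
      `|F t (x t) u - F (ti i) (xt (ti i)) u| <= E.
    move=> t u it ti1 Uu.
    have t1t := le_trans t1i it; have tT := le_trans ti1 tiM.
    have tih : t - ti i <= h by move: ti1; rewrite tiS; hclear; lra.
    have -> : F t (x t) u - F (ti i) (xt (ti i)) u =
      (F t (x t) u - F t (xt t) u) + (F t (xt t) u - F (ti i) (xt (ti i)) u) by lmod R.
    apply: (le_trans (ler_normD _ _)); apply: lerD; last first.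
      apply: Hk => //; first exact: le_trans tiM.
      by rewrite ger0_norm ?subr_ge0.
    apply: (le_trans (FL _ _ _ _ t1t tT Uu)); rewrite ler_wpM2l//.
    have -> : x t - xt t = (x (ti i) - xt (ti i)) + (x t - x (ti i)) - (xt t - xt (ti i)).
      by lmod R.
    apply: (le_trans (ler_normB _ _)); apply: (le_trans (lerD (ler_normD _ _) (lexx _))).
    have a1 : `|x t - x (ti i)| <= C * h.
      apply: (le_trans (lx _ _ t1i it (le_trans ti1 tiM'))).
      by rewrite ler_wpM2l.
    have a2 : `|xt t - xt (ti i)| <= C * h.
      apply: (le_trans (lxt _ _ t1i it (le_trans ti1 tiM'))).
      by rewrite ler_wpM2l.
    by rewrite -/di; move: a1 a2; hclear; lra.
  have {}H := H Ht.
  have sE : \sum_(p <- cellP i) p.1 *: F (ti i) (xt (ti i)) p.2.1.1 =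
     h *: (\sum_(p <- pw i) p.1 *: F (ti i) (xt (ti i)) p.2).
    rewrite sum_cellP /=.
    under eq_bigr do under eq_bigr do rewrite -scalerA.
    under eq_bigr do rewrite -scaler_sumr.
    rewrite sumr_const card_ord -scaler_nat scalerA mulrC mulfVK//.
  rewrite sE in H.
  have Hfi := Hf i iM.
  set S := h *: _ in H Hfi.
  have -> : x (ti i.+1) - xt (ti i.+1) = (x (ti i) - xt (ti i)) +
    (x (ti i.+1) - x (ti i) - S) + (S - (xt (ti i.+1) - xt (ti i))) by lmod R.
  apply: (le_trans (ler_normD _ _)); apply: (le_trans (lerD (ler_normD _ _) (lexx _))).
  rewrite -/di; apply: (le_trans (lerD (lerD (lexx _) H) Hfi)).
  by rewrite -subr_ge0 /E /err (_ : _ - _ = 0)//; ring.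
have [M0|M0] := posnP M.
  move=> i; rewrite M0 leqn0 => /eqP->; rewrite /ti mul0r addr0 x0 subrr normr0.
  apply: mulr_ge0 => //; apply: mulr_ge0; first exact: expR_ge0.
  by rewrite subr_ge0 (le_trans (ti_ge M)).
(* Adding the errors still to come makes the recursion homogeneous, as [discrete_gronwall]
   requires. *)
pose B i := `|x (ti i) - xt (ti i)| + (M%:R - i%:R) * h * err.
move=> i iM.
have Mi : 0 <= (M%:R - i%:R) * h * err.
  by rewrite !mulr_ge0// subr_ge0 ler_nat.
apply: (@le_trans _ _ (B i)); first by rewrite /B lerDl.
have tE : ti 0 = t1 by rewrite /ti mul0r addr0.
have B0E : B 0%N = M%:R * h * err by rewrite /B tE x0 subrr normr0 add0r subr0.
have Mh : M%:R * h <= T1 - t1 by rewrite lerBrDl.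
apply: (@le_trans _ _ (expR (C * (T1 - t1)) * B 0%N)).
  apply: (@discrete_gronwall B C M) => //.
    move=> l lM; rewrite /B.
    have := step l lM.
    have e1 : 0 <= (M%:R - l%:R) * h * err by rewrite !mulr_ge0// subr_ge0 ler_nat ltnW.
    have e2 : 0 <= C * h * ((M%:R - l%:R) * h * err) by rewrite mulr_ge0// mulr_ge0.
    rewrite -natr1; move: e2; move: (`|x _ - _|) (`|x _ - _|) => a b; hclear.
    by move: (C * h) => c; nra.
  by rewrite B0E !mulr_ge0.
rewrite B0E -[leRHS]mulrA; apply: ler_wpM2l; first exact: expR_ge0.
exact: ler_wpM2r.
Qed.

(** Multiplication by [Psi] transports the difference to the end: its linear evolution then cancels
    up to [eta * h] per cell, and only the contributions of the variations remain and add up. The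
    factor [1 / m.+1] is the share of a cell given to each variation. Every error is proportional to
    [de]. *)
Theorem grid_diff (k d cb de eta : R) (g g' : 'I_m.+1 -> R) (x x' : R -> 'rV[R]_n)
    (W Psi : R -> 'M[R]_n) (dV : nat -> 'I_m.+1 -> 'rV[R]_n) M :
  approx_field F U xt D t1 T1 k d -> 0 <= k -> 0 <= eta -> ti M <= T1 ->
  40 * C ^+ 2 * h <= 1 -> cb <= 1 ->
  (forall j, 0 < g j <= cb) -> (forall j, 0 < g' j <= cb) ->
  (forall j, `|g j - g' j| <= de) -> 0 <= de ->
  lip_on t1 (ti M) C x -> lip_on t1 (ti M) C x' -> x t1 = x' t1 ->
  follows F (needles g (gridP M)) t1 x -> follows F (needles g' (gridP M)) t1 x' ->
  (forall i t, (i < M)%N -> ti i <= t -> t <= ti i.+1 ->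
     [/\ `|t - ti i| < d, `|x t - xt (ti i)| < d & `|x' t - xt (ti i)| < d]) ->
  (forall i, (i < M)%N ->
    [/\ `|h *: (\sum_(p <- pw i) p.1 *: F (ti i) (xt (ti i)) p.2) -
          (xt (ti i.+1) - xt (ti i))| <= eta * h,
        forall z : 'rV[R]_n, `|h *: (\sum_(p <- pw i) p.1 *: (z *m D (ti i) p.2)) -
            z *m (W (ti i.+1) - W (ti i))| <= eta * h * `|z|,
        forall z : 'rV[R]_n, `|z *m Psi (ti i) -
          (z + z *m (W (ti i.+1) - W (ti i))) *m Psi (ti i.+1)| <= eta * h * `|z|,
        forall z : 'rV[R]_n, `|z *m Psi (ti i.+1)| <= C * `|z| &
        forall j, (act i j ->
          `|(h *: F (ti i) (xt (ti i)) (vu j) - (xt (ti i.+1) - xt (ti i))) *m Psi (ti i.+1)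
             - dV i j| <= eta * h) /\ (~~ act i j -> dV i j = 0)]) ->
  let z (t : R) : 'rV[R]_n := x t - x' t in
  let Q := expR (40 * C ^+ 2 * (T1 - t1)) in
  (forall i, (i <= M)%N -> `|z (ti i)| <= Q * de) /\
  `|z (ti M) *m Psi (ti M) -
     \sum_j ((g j - g' j) / m.+1%:R) *: \sum_(i < M) dV i j| <=
    82 * C ^+ 4 * (T1 - t1) * Q * (k + h + cb + eta) * de.
Proof.
move=> A k0 eta0 tM Ch cb1 gcb g'cb gde de0 lx lx' x0 fx fx' reg Hc z Q.
have [[h0 _] Hw] := Hpw; have [[C1 _ FL _] _] := HF.
have h0' := ltW h0.
have C0 : 0 <= C by exact: le_trans C1.
have cb0 : 0 <= cb by have /andP[g0 gb] := gcb ord0; apply: le_trans gb; exact: ltW.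
have C2 : 0 <= C ^+ 2 by rewrite exprn_ge0.
have C3 : 0 <= C ^+ 3 by rewrite exprn_ge0.
pose B i := `|z (ti i)| + de.
have B0 i : 0 <= B i by rewrite addr_ge0.
pose kk := k + h + cb + eta.
have kk0 : 0 <= kk by rewrite !addr_ge0.
have m0 : 0 < m.+1%:R :> R by rewrite ltr0n.
(* First order gain of the [j]-th variation over the relaxed motion in a whole cell. In an inactive
   cell the variation repeats the base control, so the gain is zero. *)
pose a i j : 'rV[R]_n := if act i j then h *: F (ti i) (xt (ti i)) (vu j) - (xt (ti i.+1) - xt (ti i)) else 0.
pose cf j := (g j - g' j) / m.+1%:R.
have cfde j : `|cf j| <= de / m.+1%:R.
  rewrite /cf normrM normfV (ger0_norm (ler0n _ _)).
  by apply: ler_wpM2r => //; rewrite invr_ge0.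
have avg (v : 'I_m.+1 -> 'rV[R]_n) e : (forall j, `|v j| <= e) ->
    `|\sum_j cf j *: v j| <= de * e.
  move=> ve; apply: (le_trans (ler_norm_sum _ _ _)).
  apply: (@le_trans _ _ (\sum_(j < m.+1) (de / m.+1%:R * e))).
    by apply: ler_sum => j _; rewrite normrZ ler_pM.
  rewrite sumr_const card_ord -[_ *+ _]mulr_natl.
  by rewrite mulrA [m.+1%:R * _]mulrC mulfVK// gt_eqF.
have cell i : (i < M)%N ->
  `|z (ti i.+1) - z (ti i)| <= 40 * C ^+ 2 * h * B i /\
  `|z (ti i.+1) - z (ti i) - z (ti i) *m (W (ti i.+1) - W (ti i)) - \sum_j cf j *: a i j|
     <= 81 * C ^+ 3 * kk * h * B i.
  move=> iM.
  have tiM : ti i.+1 <= T1 by apply: le_trans tM; exact: ti_le.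
  have tiM' : ti i.+1 <= ti M by exact: ti_le.
  have tii : ti i <= ti i.+1 by exact: ti_le.
  have t1i := ti_ge i.
  have := @cell_diff R n r 'I_m.+1 F U xt D t1 T1 C HF k d (ti i) (ti i) h cb de g g' x x' C A k0 t1i (le_trans tii tiM)
     t1i _ Ch cb1 C0 gcb g'cb gde de0.
  rewrite -tiS => /(_ tiM (fun t => reg i t iM) (lip_onW t1i tiM' lx) (lip_onW t1i tiM' lx')).
  cbv zeta => /(_ (cellP i) (ti i) (lexx _)).
  rewrite tot_cellP -tiS => /(_ (lexx _) (cellP_ok i) (follows_gridP iM fx) (follows_gridP iM fx')).
  rewrite -/(z _) -/(z _) -/(B _) !subrr normr0 mulr0 mul0r => /(_ (lexx _)) [p1 p2].
  split => //.
  have [Hf HD _ _ _] := Hc i iM.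
  have sE : \sum_(p <- cellP i) (p.1 *: (z (ti i) *m D (ti i) p.2.1.1) +
      ((g p.2.2 - g' p.2.2) * p.1) *: (F (ti i) (xt (ti i)) p.2.1.2 - F (ti i) (xt (ti i)) p.2.1.1)) =
    h *: (\sum_(p <- pw i) p.1 *: (z (ti i) *m D (ti i) p.2)) +
    \sum_j cf j *: (if act i j then h *: F (ti i) (xt (ti i)) (vu j) -
        h *: (\sum_(p <- pw i) p.1 *: F (ti i) (xt (ti i)) p.2) else 0).
    rewrite sum_cellP /=.
    under eq_bigr do rewrite big_split.
    rewrite big_split /=; congr (_ + _).
      under eq_bigr do under eq_bigr do rewrite -scalerA.
      under eq_bigr do rewrite -scaler_sumr.
      by rewrite sumr_const card_ord -scaler_nat scalerA mulrC mulfVK ?gt_eqF.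
    apply: eq_bigr => j _; case: ifP => _; last first.
      by rewrite scaler0 big1// => p _; rewrite subrr scaler0.
    have [_ s1] := Hw i.
    rewrite -scalerBr scalerA.
    have -> : F (ti i) (xt (ti i)) (vu j) = \sum_(p <- pw i) p.1 *: F (ti i) (xt (ti i)) (vu j).
      by rewrite -scaler_suml s1 scale1r.
    rewrite -sumrB scaler_sumr; apply: eq_bigr => p _.
    by rewrite -scaler_suml s1 scale1r -scalerBr scalerA; congr (_ *: _); rewrite /cf; field; rewrite gt_eqF.
  rewrite sE in p2.
  set S1 := h *: _ in p2; set S2 := \sum_j _ in p2.
  have n1 := HD (z (ti i)); rewrite -/S1 in n1.
  have n2 : `|S2 - \sum_j cf j *: a i j| <= de * (eta * h).
    rewrite /S2 -sumrB; under eq_bigr do rewrite -scalerBr.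
    apply: avg => j; rewrite /a; case: ifP => _; last by rewrite subrr normr0 mulr_ge0.
    rewrite -[X in `|X|]opprK normrN.
    by apply: le_trans Hf; rewrite le_eqVlt; apply/orP; left; apply/eqP; congr `|_|; lmod R.
  have -> : z (ti i.+1) - z (ti i) - z (ti i) *m (W (ti i.+1) - W (ti i)) - \sum_j cf j *: a i j =
    (z (ti i.+1) - z (ti i) - (S1 + S2)) + (S1 - z (ti i) *m (W (ti i.+1) - W (ti i))) +
    (S2 - \sum_j cf j *: a i j).
    by clear; lmod R.
  apply: (le_trans (ler_normD _ _)); apply: (le_trans (lerD (ler_normD _ _) (lexx _))).
  apply: (le_trans (lerD (lerD p2 n1) n2)).
  have e1 : h * (80 * C ^+ 3 * (k + h + cb)) * B i <= 80 * C ^+ 3 * kk * h * B i.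
    rewrite ler_wpM2r// mulrC ler_wpM2r// ler_wpM2l ?mulr_ge0// /kk lerDl//.
  have e2 : eta * h * `|z (ti i)| + de * (eta * h) <= C ^+ 3 * kk * h * B i.
    have -> : eta * h * `|z (ti i)| + de * (eta * h) = eta * h * B i by rewrite /B; ring.
    rewrite ler_wpM2r// ler_wpM2r//.
    apply: (@le_trans _ _ (1 * kk)); first by rewrite mul1r /kk lerDr !addr_ge0.
    by rewrite ler_wpM2r// exprn_ege1.
  by move: e1 e2; hclear; lra.
have Tt : 0 <= T1 - t1 by rewrite subr_ge0 (le_trans (ti_ge M)).
have Q1 : 1 <= Q.
  by rewrite /Q -expR0 ler_expR; apply: mulr_ge0 => //; exact: mulr_ge0.
have BQ i : (i <= M)%N -> B i <= Q * de.
  move=> iM; have B0E : B 0%N = de.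
    by rewrite /B /z /ti mul0r addr0 x0 subrr normr0 add0r.
  rewrite -[X in Q * X]B0E; apply: (@discrete_gronwall B (40 * C ^+ 2) M) => //.
    by rewrite mulr_ge0.
  move=> l lM; have [p1 _] := cell l lM.
  rewrite /B; have -> : z (ti l.+1) = z (ti l) + (z (ti l.+1) - z (ti l)) by lmod R.
  have := ler_normD (z (ti l)) (z (ti l.+1) - z (ti l)).
  by move: p1; rewrite /B; hclear; lra.
split.
  by move=> i iM; apply: le_trans (BQ i iM); rewrite /B lerDl.
(* The transported difference minus its predicted value: it starts at zero, and each cell changes it
   only by an error. *)
pose y i := z (ti i) *m Psi (ti i) - \sum_j cf j *: \sum_(l < i) dV l j.
have C4 : 0 <= C ^+ 4 by rewrite exprn_ge0.
have ystep i : (i < M)%N -> `|y i.+1 - y i| <= 82 * C ^+ 4 * kk * h * (Q * de).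
  move=> iM; have [p1 p2] := cell i iM.
  have [Hf HD HP HPC HV] := Hc i iM.
  set S := \sum_j cf j *: a i j in p2.
  set e := (X in `|X|) in p2.
  have zE : z (ti i.+1) = z (ti i) + z (ti i) *m (W (ti i.+1) - W (ti i)) + S + e.
    by rewrite /e; clear; lmod R.
  have sV : \sum_j cf j *: \sum_(l < i.+1) dV l j =
      \sum_j cf j *: \sum_(l < i) dV l j + \sum_j cf j *: dV i j.
    by rewrite -big_split; apply: eq_bigr => j _; rewrite big_ord_recr /= scalerDr.
  have n1 := HP (z (ti i)).
  have n2 : `|S *m Psi (ti i.+1) - \sum_j cf j *: dV i j| <= de * (eta * h).
    rewrite mulmx_suml -sumrB; under eq_bigr do rewrite -scalemxAl -scalerBr.
    apply: avg => j; rewrite /a; have [h1 h2] := HV j.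
    case: ifP => aj; first exact: h1.
    by rewrite (h2 (negbT aj)) mul0mx subrr normr0 mulr_ge0.
  have n3 : `|e *m Psi (ti i.+1)| <= C * (81 * C ^+ 3 * kk * h * B i).
    by apply: (le_trans (HPC e)); rewrite ler_wpM2l.
  have -> : y i.+1 - y i =
     - (z (ti i) *m Psi (ti i) - (z (ti i) + z (ti i) *m (W (ti i.+1) - W (ti i))) *m Psi (ti i.+1))
     + (S *m Psi (ti i.+1) - \sum_j cf j *: dV i j) + e *m Psi (ti i.+1).
    rewrite /y sV [in LHS]zE !mulmxDl; clear; lmod R.
  apply: (le_trans (ler_normD _ _)); apply: (le_trans (lerD (ler_normD _ _) (lexx _))).
  rewrite normrN; apply: (le_trans (lerD (lerD n1 n2) n3)).
  apply: (@le_trans _ _ (82 * C ^+ 4 * kk * h * B i)); last first.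
    apply: ler_wpM2l; last by apply: BQ; exact: ltnW.
    by apply: mulr_ge0 => //; apply: mulr_ge0 => //; exact: mulr_ge0.
  have e2 : eta * h * `|z (ti i)| + de * (eta * h) <= C ^+ 4 * kk * h * B i.
    have -> : eta * h * `|z (ti i)| + de * (eta * h) = eta * h * B i by rewrite /B; ring.
    rewrite ler_wpM2r// ler_wpM2r//.
    apply: (@le_trans _ _ (1 * kk)); first by rewrite mul1r /kk lerDr !addr_ge0.
    by rewrite ler_wpM2r// exprn_ege1.
  have -> : C * (81 * C ^+ 3 * kk * h * B i) = 81 * (C ^+ 4 * kk * h * B i) by ring.
  by move: e2; hclear; lra.
have y0 : y 0%N = 0.
  rewrite /y /z /ti mul0r addr0 x0 subrr mul0mx sub0r.
  by rewrite big1 ?oppr0// => j _; rewrite big_ord0 scaler0.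
have := @ler_telescope R _ y (fun i => i%:R * (82 * C ^+ 4 * kk * h * (Q * de))) 0 M (leq0n _) _.
rewrite y0 subr0 mul0r subr0 => H; rewrite -/(cf _) -/kk.
apply: (le_trans (H _)).
  move=> i /andP[_ iM]; rewrite -natr1 mulrDl mul1r [X in _ <= X - _]addrC addrK; exact: ystep.
have Mh : M%:R * h <= T1 - t1 by rewrite lerBrDl.
have -> : M%:R * (82 * C ^+ 4 * kk * h * (Q * de)) = M%:R * h * (82 * C ^+ 4 * Q * kk * de) by ring.
have -> : 82 * C ^+ 4 * (T1 - t1) * Q * kk * de = (T1 - t1) * (82 * C ^+ 4 * Q * kk * de) by ring.
have Q0 : 0 <= Q by exact: le_trans Q1.
apply: ler_wpM2r => //; apply: mulr_ge0 => //; apply: mulr_ge0 => //.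
by apply: mulr_ge0 => //; exact: mulr_ge0.
Qed.

End grid.

(** * Uniformity on compact sets *)

Section compactness.
Context {R : realType} {n r : nat}.

(** A common cluster point for times, states and controls, together with an index as large as
    desired. *)
Lemma compact_seq (a b B : R) (U : set 'rV[R]_r) (t : nat -> R) (x : nat -> 'rV[R]_n)
    (u : nat -> 'rV[R]_r) : compact U ->
  (forall N, a <= t N <= b) -> (forall N, `|x N| <= B) -> (forall N, U (u N)) ->
  exists t0 x0 u0, U u0 /\ forall e : R, 0 < e -> exists N,
    [/\ N.+1%:R^-1 <= e, `|t N - t0| <= e, `|x N - x0| <= e & `|u N - u0| <= e].
Proof.
move=> cU tab xB uU.
have [UF [UFu UFoo]] := ultraFilterLemma (@eventually_filter).
have [M [_ HM]] := compact_bounded cU.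
have uB N : `|u N| <= `|M| + 1.
  by apply: HM (uU N); apply: (le_lt_trans (ler_norm M)); rewrite ltrDl.
(* The times are turned into 1 by 1 matrices in order to apply [bounded_ultra_lim]. *)
have tB N : `|(t N)%:M : 'M[R]_1| <= `|a| + `|b|.
  apply: mx_norm_le => [|i j]; first by rewrite addr_ge0.
  rewrite !ord1 mxE mulr1n; have /andP[a1 a2] := tab N.
  rewrite ler_norml; have := ler_norm a; have := ler_norm (- a); have := ler_norm b.
  have := ler_norm (- b); have := normr_ge0 a; have := normr_ge0 b.
  rewrite !normrN; move: a1 a2; clear; move=> *; apply/andP; split; lra.
have [tl Htl] := bounded_ultra_lim UFu tB.
have [xl Hxl] := bounded_ultra_lim UFu xB.
  have [ul Hul] := bounded_ultra_lim UFu uB.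
  have H e : 0 < e -> exists N,
    [/\ N.+1%:R^-1 <= e, `|t N - tl 0 0| <= e, `|x N - xl| <= e & `|u N - ul| <= e].
    move=> e0.
    have FN : UF [set N | N.+1%:R^-1 <= e].
      apply: UFoo; exists (Num.truncn e^-1) => //= N HN.
      rewrite /= invf_ple ?posrE//; apply: ltW; apply: (lt_le_trans (truncnS_gt _)).
      by rewrite ler_nat.
    have [N [[[N1 N2] N3] N4]] := @filter_ex _ UF _ _
      (filterI (filterI (filterI FN (Htl e e0)) (Hxl e e0)) (Hul e e0)).
    exists N; split => //; apply: le_trans N2.
    by have := mx_entry_le ((t N)%:M - tl) 0 0; rewrite !mxE mulr1n.
  exists (tl 0 0), xl, ul; split => //.
  have clU : closed U by apply: compact_closed => //; exact: norm_hausdorff.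
  apply: clU => A /nbhs_ballP[e /= e0 eA].
  have e20 : 0 < e / 2 by rewrite divr_gt0.
  have [N [_ _ _ uN]] := H _ e20.
  exists (u N); split => //; apply: eA; rewrite -ball_normE /= distrC.
  by apply: (le_lt_trans uN); rewrite ltr_pdivrMr// mulr_natr mulr2n ltrDl.
Qed.

Variables (p q : nat) (g : R * 'rV[R]_n * 'rV[R]_r -> 'M[R]_(p, q)).
Variables (a b B : R) (U : set 'rV[R]_r).
Hypotheses (cg : continuous g) (cU : compact U).

Lemma continuous_dist (t0 : R) (x0 : 'rV[R]_n) (u0 : 'rV[R]_r) (e : R) : 0 < e -> exists2 d : R, 0 < d &
  forall t x u, `|t - t0| < d -> `|x - x0| < d -> `|u - u0| < d ->
    `|g (t, x, u) - g (t0, x0, u0)| <= e.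
Proof.
move=> e0; move/cvgrPdist_le : (@cg (t0, x0, u0)) => /(_ _ e0).
move=> /nbhs_ballP[d /= d0 Hd]; exists d => // t x u td xd ud.
rewrite distrC; apply: Hd; split => /=.
  by split; rewrite /= -ball_normE /= distrC.
by rewrite -ball_normE /= distrC.
Qed.

(** In a sequence of counterexamples with distances tending to zero, both arguments of [g] have the
    same cluster point, against the continuity of [g] there. *)
Lemma compact_uniform (k : R) : 0 < k -> exists2 d : R, 0 < d &
  forall t s x y u, a <= t <= b -> a <= s <= b -> `|x| <= B -> `|y| <= B -> U u ->
    `|t - s| <= d -> `|x - y| <= d -> `|g (t, x, u) - g (s, y, u)| <= k.
Proof.
move=> k0; apply: contrapT => H.
have /choice[w Hw] : forall N : nat, exists w : R * R * 'rV[R]_n * 'rV[R]_n * 'rV[R]_r,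
    let: (t, s, x, y, u) := w in
    [/\ a <= t <= b /\ a <= s <= b, `|x| <= B /\ `|y| <= B, U u,
    `|t - s| <= N.+1%:R^-1 /\ `|x - y| <= N.+1%:R^-1 & k < `|g (t, x, u) - g (s, y, u)|].
  move=> N; apply: contrapT => HN; apply: H; exists N.+1%:R^-1 => //.
  move=> t s x y u h1 h2 h3 h4 h5 h6 h7; rewrite leNgt; apply/negP => h8.
  by apply: HN; exists (t, s, x, y, u).
have [|||t0 [x0 [u0 [Uu0 Hlim]]]] := @compact_seq a b B U (fun N => (w N).1.1.1.1)
  (fun N => (w N).1.1.2) (fun N => (w N).2) cU.
- by move=> N; have := Hw N; case: (w N) => -[[[t s] x] y] u /= [[]].
- by move=> N; have := Hw N; case: (w N) => -[[[t s] x] y] u /= [_ []].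
- by move=> N; have := Hw N; case: (w N) => -[[[t s] x] y] u /= [].
have k20 : 0 < k / 2 by rewrite divr_gt0.
have [d d0 Hd] := continuous_dist t0 x0 u0 k20.
have d30 : 0 < d / 3 by rewrite divr_gt0.
have [N [N1 Nt Nx Nu]] := Hlim _ d30.
have := Hw N; case: (w N) Nt Nx Nu => -[[[t s] x] y] u /= Nt Nx Nu [_ _ _ [ts xy] kg].
have g1 : `|g (t, x, u) - g (t0, x0, u0)| <= k / 2.
  by apply: Hd; [move: Nt|move: Nx|move: Nu]; move: d0; hclear; lra.
have g2 : `|g (s, y, u) - g (t0, x0, u0)| <= k / 2.
  apply: Hd.
  - have -> : s - t0 = (t - t0) - (t - s) by ring.
    by apply: (le_lt_trans (ler_normB _ _)); move: Nt ts N1 d0; move: N.+1%:R^-1 `|t - t0| `|t - s| => iN A1 A2; hclear; lra.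
  - have -> : y - x0 = (x - x0) - (x - y) by lmod R.
    by apply: (le_lt_trans (ler_normB _ _)); move: Nx xy N1 d0; move: N.+1%:R^-1 `|x - x0| `|x - y| => iN A1 A2; hclear; lra.
  - by move: Nu d0; hclear; lra.
have := ler_normB (g (t, x, u) - g (t0, x0, u0)) (g (s, y, u) - g (t0, x0, u0)).
have -> : g (t, x, u) - g (t0, x0, u0) - (g (s, y, u) - g (t0, x0, u0)) = g (t, x, u) - g (s, y, u).
  by lmod R.
by move: g1 g2 kg; hclear; lra.
Qed.

Lemma compact_bounded3 : exists2 C : R, 0 < C &
  forall t x u, a <= t <= b -> `|x| <= B -> U u -> `|g (t, x, u)| <= C.
Proof.
apply: contrapT => H.
have /choice[w Hw] : forall N : nat, exists w : R * 'rV[R]_n * 'rV[R]_r,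
    let: (t, x, u) := w in
    [/\ a <= t <= b, `|x| <= B, U u & N.+1%:R < `|g (t, x, u)|].
  move=> N; apply: contrapT => HN; apply: H; exists N.+1%:R => //.
  move=> t x u h1 h2 h3; rewrite leNgt; apply/negP => h8.
  by apply: HN; exists (t, x, u).
have [|||t0 [x0 [u0 [Uu0 Hlim]]]] := @compact_seq a b B U (fun N => (w N).1.1)
  (fun N => (w N).1.2) (fun N => (w N).2) cU.
- by move=> N; have := Hw N; case: (w N) => -[t x] u /= [].
- by move=> N; have := Hw N; case: (w N) => -[t x] u /= [].
- by move=> N; have := Hw N; case: (w N) => -[t x] u /= [].
have [d d0 Hd] := continuous_dist t0 x0 u0 ltr01.
pose e := Order.min (d / 2) (`|g (t0, x0, u0)| + 2)^-1.
have g20 : 0 < `|g (t0, x0, u0)| + 2 by rewrite ltr_wpDl.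
have e0 : 0 < e by rewrite lt_min divr_gt0//= invr_gt0.
have [N [N1 Nt Nx Nu]] := Hlim _ e0.
have ed : e < d.
  have : e <= d / 2 by rewrite ge_min lexx.
  by move: d0; hclear; lra.
have := Hw N; case: (w N) Nt Nx Nu => -[t x] u /= Nt Nx Nu [_ _ _ kg].
have g1 := Hd t x u (le_lt_trans Nt ed) (le_lt_trans Nx ed) (le_lt_trans Nu ed).
have : `|g (t0, x0, u0)| + 2 <= N.+1%:R.
  have N2 : N.+1%:R^-1 <= (`|g (t0, x0, u0)| + 2)^-1.
    by apply: (le_trans N1); rewrite ge_min lexx orbT.
  by rewrite lef_pV2 ?posrE// in N2.
have := ler_normD (g (t, x, u) - g (t0, x0, u0)) (g (t0, x0, u0)).
rewrite subrK; move: g1 kg; hclear; lra.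
Qed.

End compactness.

Section segment.
Context {R : realType} {n q : nat}.
Variable f : 'rV[R]_n -> 'rV[R]_q.

Lemma is_derive_line (x v : 'rV[R]_n) (l : R) :
  differentiable f (x + l *: v) ->
  is_derive l 1 (fun h : R => f (x + h *: v)) (v *m 'J f (x + l *: v)).
Proof.
set p := x + l *: v => df; apply/is_deriveP => e e0.
have dfv : derivable f p v by exact: diff_derivable.
have : h^-1 *: (f (h *: v + p) - f p) @[h --> 0^'] --> v *m 'J f p.
  have -> : v *m 'J f p = 'D_v f p by rewrite deriveE// /jacobian mul_rV_lin1.
  exact: dfv.
move/cvgrPdist_le => /(_ e e0) [d /= d0 Hd].
exists d => // s sd.
have [->|sl] := eqVneq s l.
  by rewrite !subrr scale0r subr0 !normr0 mulr0.
have sl0 : s - l != 0 by rewrite subr_eq0.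
have := Hd (s - l); rewrite /ball_ /= sub0r normrN => /(_ sd sl0).
have -> : (s - l) *: v + p = x + s *: v by rewrite /p; lmod R.
move=> H.
have -> : f (x + s *: v) - f p - (s - l) *: (v *m 'J f p) =
   - ((s - l) *: (v *m 'J f p - (s - l)^-1 *: (f (x + s *: v) - f p))).
  by rewrite scalerBr scalerA divff// scale1r opprB.
by rewrite normrN normrZ mulrC ler_wpM2r.
Qed.

Lemma segment_mvi (x y : 'rV[R]_n) (w : 'rV[R]_q) (k : R) : 0 <= k ->
  (forall z, differentiable f z) ->
  (forall l, 0 <= l -> l <= 1 -> `|(y - x) *m 'J f (x + l *: (y - x)) - w| <= k) ->
  `|f y - f x - w| <= k.
Proof.
move=> k0 df H.
pose phi (h : R) := f (x + h *: (y - x)).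
have dphi (l : R) : is_derive l 1 phi ((y - x) *m 'J f (x + l *: (y - x))).
  exact: is_derive_line.
have M0 : 0 <= `|w| + k by rewrite addr_ge0.
(* [lipschitz_mvi] asks for some Lipschitz constant. The bound of the derivative plus 1 propagates
   along [[0, 1]], the 1 absorbing the remainders of the local expansions. *)
have lip : lip_on 0 1 (`|w| + k + 1) phi.
  move=> p s p0 ps s1.
  apply: (@real_induction R p s (fun t => `|phi t - phi p| <= (`|w| + k + 1) * (t - p))) => //.
    by rewrite !subrr normr0 mulr0.
  move=> t /andP[pt ts].
  have /is_deriveP/(_ 1 ltr01) [d d0 Hd] := dphi t.
  exists d => // a b pa at_ tb bs ta bt IH.
  set D := (y - x) *m _ in Hd.
  have DB : `|D| <= `|w| + k.
    have t0 : 0 <= t by rewrite (le_trans p0).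
    have t1 : t <= 1 by rewrite (le_trans ts).
    have -> : D = w + (D - w) by lmod R.
    by apply: (le_trans (ler_normD _ _)); rewrite lerD2l H.
  have h1 : `|phi b - phi t - (b - t) *: D| <= b - t.
    have := Hd b; rewrite ger0_norm ?subr_ge0// mul1r; apply.
    by move: bt; hclear; lra.
  have h2 : `|phi a - phi t - (a - t) *: D| <= t - a.
    have := Hd a; rewrite distrC ger0_norm ?subr_ge0// mul1r; apply.
    by move: ta; hclear; lra.
  have -> : phi b - phi p = (phi a - phi p) + (phi b - phi t - (b - t) *: D) -
     (phi a - phi t - (a - t) *: D) + (b - a) *: D by lmod R.
  apply: (le_trans (ler_normD _ _)); apply: (le_trans (lerD (ler_normB _ _) (lexx _))).
  apply: (le_trans (lerD (lerD (ler_normD _ _) (lexx _)) (lexx _))).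
  have ab : 0 <= b - a by rewrite subr_ge0 (le_trans at_).
  rewrite normrZ (ger0_norm ab).
  have : (b - a) * `|D| <= (b - a) * (`|w| + k) by rewrite ler_wpM2l.
  by move: IH h1 h2; hclear; move: (`|w| + k) => Q; nra.
have := @lipschitz_mvi R _ 0 1 (`|w| + k + 1) phi (fun l => (y - x) *m 'J f (x + l *: (y - x))) w k
  ler01 k0 _ lip (fun t _ _ => dphi t).
have -> : phi 1 = f y by rewrite /phi scale1r addrC subrK.
have -> : phi 0 = f x by rewrite /phi scale0r addr0.
rewrite subr0 scale1r mulr1; apply.
  by rewrite addr_ge0.
by move=> t t0 t1; apply: H; exact: ltW.
Qed.

End segment.

Section clip.
Context {R : realType} {n : nat}.
Implicit Types c x : 'rV[R]_n.

(* The nearest point of the unit ball around [c] for the sup norm. *)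
Definition clip c x : 'rV[R]_n :=
  \row_j Order.max (c 0 j - 1) (Order.min (x 0 j) (c 0 j + 1)).

Lemma clip_near c x : `|clip c x - c| <= 1.
Proof.
apply: mx_norm_le => // i j; rewrite !ord1 !mxE ler_norml.
by rewrite /Order.max /Order.min; case: ifP; case: ifP; lra.
Qed.

Lemma clip_id c x : `|x - c| <= 1 -> clip c x = x.
Proof.
move=> xc; apply/rowP => j; rewrite !mxE.
have := le_trans (mx_entry_le (x - c) 0 j) xc; rewrite !mxE ler_norml.
by rewrite /Order.max /Order.min; case: ifP; case: ifP; lra.
Qed.

Lemma clip_dist c c' x x' e : `|c - c'| <= e -> `|x - x'| <= e ->
  `|clip c x - clip c' x'| <= e.
Proof.
move=> ce xe; apply: mx_norm_le => [|i j]; first exact: le_trans ce.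
have := le_trans (mx_entry_le (c - c') 0 j) ce.
have := le_trans (mx_entry_le (x - x') 0 j) xe.
rewrite !ord1 !mxE !ler_norml /Order.max /Order.min.
by case: ifP; case: ifP; case: ifP; case: ifP; clear; lra.
Qed.

End clip.

(** * Clipping the field to a neighbourhood of the reference curve *)

Section regularize.
Context {R : realType} {n r : nat}.
Variables (f : R -> 'rV[R]_n -> 'rV[R]_r -> 'rV[R]_n) (U : set 'rV[R]_r).
Variables (xt : R -> 'rV[R]_n) (t1 T1 : R).

Definition clipped t x u := f t (clip (xt t) x) u.
Definition jac s u := fx f s (xt s) u.

Definition equicontinuous_field (F : R -> 'rV[R]_n -> 'rV[R]_r -> 'rV[R]_n) :=
  forall k : R, 0 < k -> exists2 d : R, 0 < d &
    forall t s x x' u, t1 <= t -> t <= T1 -> t1 <= s -> s <= T1 -> U u ->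
      `|t - s| < d -> `|x - x'| < d -> `|F t x u - F s x' u| <= k.

Lemma segment_norm (x y c : 'rV[R]_n) (e l : R) : 0 <= l -> l <= 1 ->
  `|x - c| <= e -> `|y - c| <= e -> `|x + l *: (y - x) - c| <= e.
Proof.
move=> l0 l1 xc yc.
have -> : x + l *: (y - x) - c = (1 - l) *: (x - c) + l *: (y - c) by lmod R.
apply: (le_trans (ler_normD _ _)); rewrite !normrZ.
rewrite (ger0_norm l0) ger0_norm ?subr_ge0//.
have h1 : (1 - l) * `|x - c| <= (1 - l) * e by rewrite ler_wpM2l// subr_ge0.
have h2 : l * `|y - c| <= l * e by rewrite ler_wpM2l.
by move: h1 h2; hclear; lra.
Qed.

Lemma regularize (B L : R) : continuous_with_fx_fxx f -> compact U -> 0 <= L ->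
  (forall t, t1 <= t -> t <= T1 -> `|xt t| <= B) -> lip_on t1 T1 L xt ->
  exists C, [/\ forall C', C <= C' -> regular_field clipped U jac t1 T1 C',
    forall k : R, 0 < k -> exists2 d : R, 0 < d & approx_field clipped U xt jac t1 T1 k d &
    equicontinuous_field clipped].
Proof.
move=> [cf [df cfx] _] cU L0 xB xL.
have [C1 C10 HC1] := compact_bounded3 t1 T1 (B + 1) cf cU.
have [C2 C20 HC2] := compact_bounded3 t1 T1 (B + 1) cfx cU.
have nC2 : 0 <= n%:R * C2 by rewrite mulr_ge0// ltW.
have clB t x : t1 <= t -> t <= T1 -> `|clip (xt t) x| <= B + 1.
  move=> h1 h2; have -> : clip (xt t) x = xt t + (clip (xt t) x - xt t) by lmod R.
  by apply: (le_trans (ler_normD _ _)); rewrite lerD ?clip_near ?xB.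
have clx t : clip (xt t) (xt t) = xt t by apply: clip_id; rewrite subrr normr0.
have xtd t s : t1 <= t -> t <= T1 -> t1 <= s -> s <= T1 -> `|xt t - xt s| <= L * `|t - s|.
  move=> h1 h2 h3 h4; have [ts|st] := leP s t; first by rewrite ger0_norm ?subr_ge0 ?xL.
  by rewrite distrC ltr0_norm ?subr_lt0// opprB xL// ltW.
exists (1 + C1 + n%:R * C2); split.
- move=> C' CC.
  have C'C1 : C1 <= C' by move: CC nC2; hclear; lra.
  have C'C2 : n%:R * C2 <= C' by move: CC C10; hclear; lra.
  split.
  + by move: CC nC2 C10; hclear; lra.
  + move=> t x u h1 h2 Uu; apply: le_trans C'C1; apply: (HC1 t (clip (xt t) x) u) => //.
      by rewrite h1.
    exact: clB.
  + move=> t x x' u h1 h2 Uu.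
    apply: (@le_trans _ _ (n%:R * C2 * `|clip (xt t) x - clip (xt t) x'|)); last first.
      apply: ler_pM => //; apply: clip_dist => //.
      by rewrite subrr normr0.
    rewrite /clipped -[leLHS]/(`|_|) -[X in `|X|]subr0.
    apply: (@segment_mvi R n n (fun y => f t y u)); first by rewrite mulr_ge0.
      by move=> z; exact: df.
    move=> l l0 l1; rewrite subr0.
    apply: (le_trans (mulmx_norm_le _ _)).
    have h3 : `|'J (fun y : 'rV_n => f t y u) (clip (xt t) x' + l *: (clip (xt t) x - clip (xt t) x'))| <= C2.
      apply: (HC2 t _ u) => //=; first by rewrite h1.
      have := @segment_norm (clip (xt t) x') (clip (xt t) x) 0 (B + 1) l l0 l1.
      by rewrite !subr0; apply; exact: clB.
    by rewrite [leRHS]mulrAC ler_wpM2l// mulr_ge0.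
  + move=> s z u h1 h2 Uu; apply: (le_trans (mulmx_norm_le _ _)).
    have h3 : `|jac s u| <= C2.
      apply: (HC2 s (xt s) u) => //=; first by rewrite h1.
      by apply: (le_trans (xB _ h1 h2)); rewrite lerDl.
    apply: (@le_trans _ _ (n%:R * C2 * `|z|)); last by rewrite ler_wpM2r.
    by rewrite mulrAC ler_wpM2r// ler_wpM2l.
- move=> k k0.
  have [d1 d10 Hd1] := compact_uniform t1 T1 (B + 1) cf cU k0.
  have k'0 : 0 < k / (n%:R + 1) by rewrite divr_gt0// ltr_wpDl.
  have [d2 d20 Hd2] := compact_uniform t1 T1 (B + 1) cfx cU k'0.
  (* The last term gives [d * (L + 1) <= 1]: a state within [d] of [xt s] is still in the unit ball
     around [xt t], hence not clipped. *)
  pose d := Order.min (Order.min d1 d2) (1 / (L + 1)).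
  have L1 : 0 < L + 1 by rewrite ltr_wpDl.
  have dd1 : d <= d1 by rewrite !ge_min lexx.
  have dd2 : d <= d2 by rewrite !ge_min lexx orbT.
  have dL : d * (L + 1) <= 1 by rewrite -ler_pdivlMr// ge_min lexx orbT.
  have d0 : 0 < d by rewrite !lt_min d10 d20 divr_gt0.
  exists d => //.
  have xin s x : t1 <= s -> s <= T1 -> `|x - xt s| <= 1 -> `|x| <= B + 1.
    move=> h1 h2 h3; have -> : x = xt s + (x - xt s) by lmod R.
    by apply: (le_trans (ler_normD _ _)); rewrite lerD ?xB.
  have d1' : d <= 1.
    have : 0 <= d * L by rewrite mulr_ge0// ltW.
    by move: dL; hclear; lra.
  have clE s t x u : t1 <= s -> s <= T1 -> t1 <= t -> t <= T1 -> `|t - s| < d ->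
     `|x - xt s| < d -> clipped t x u = f t x u.
    move=> h1 h2 h3 h4 h5 h6; rewrite /clipped clip_id//.
    have -> : x - xt t = (x - xt s) - (xt t - xt s) by lmod R.
    apply: (le_trans (ler_normB _ _)); have h7 := xtd t s h3 h4 h1 h2.
    have : L * `|t - s| <= L * d by rewrite ler_wpM2l// ltW.
    by move: h6 h7 dL; hclear; lra.
  split.
  + move=> s t x u h1 h2 h3 h4 h5 h6 Uu.
    rewrite (clE s t x u)// /clipped clx; apply: (Hd1 t s x (xt s) u) => //.
    * by rewrite h3.
    * by rewrite h1.
    * apply: (xin s) => //; exact: (le_trans (ltW h6)).
    * by apply: (le_trans (xB _ h1 h2)); rewrite lerDl.
    * exact: (le_trans (ltW h5)).
    * exact: (le_trans (ltW h6)).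
  + move=> s t x x' u h1 h2 h3 h4 h5 h6 h7 Uu.
    rewrite (clE s t x u)// (clE s t x' u)//.
    have k0' := ltW k0.
    apply: (@segment_mvi R n n (fun y => f t y u)); first by rewrite mulr_ge0.
      by move=> z; exact: df.
    move=> l l0 l1; rewrite -mulmxBr.
    apply: (le_trans (mulmx_norm_le _ _)).
    have h8 : `|x' + l *: (x - x') - xt s| <= d by apply: segment_norm => //; exact: ltW.
    have h9 : `|'J (fun y : 'rV_n => f t y u) (x' + l *: (x - x')) - jac s u| <= k / (n%:R + 1).
      apply: (Hd2 t s _ (xt s) u) => //=.
      * by rewrite h3.
      * by rewrite h1.
      * apply: (xin s) => //; exact: (le_trans h8).
      * by apply: (le_trans (xB _ h1 h2)); rewrite lerDl.
      * exact: (le_trans (ltW h5)).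
      * exact: (le_trans h8).
    apply: (@le_trans _ _ (n%:R * `|x - x'| * (k / (n%:R + 1)))).
      by rewrite ler_wpM2l// mulr_ge0.
    rewrite mulrAC ler_wpM2r// mulrCA ger_pMr//.
    by rewrite ler_pdivrMr ?ltr_wpDl// mul1r lerDl.
- move=> k k0.
  have [d1 d10 Hd1] := compact_uniform t1 T1 (B + 1) cf cU k0.
  have L1 : 0 < L + 1 by rewrite ltr_wpDl.
  pose d := d1 / (L + 1).
  have d0 : 0 < d by rewrite divr_gt0.
  have dE : d * (L + 1) = d1 by rewrite mulfVK// gt_eqF.
  have Ld : 0 <= L * d by rewrite mulr_ge0// ltW.
  exists d => // t s x x' u h1 h2 h3 h4 Uu ts xx.
  have tsd : `|t - s| <= d1 by move: ts dE Ld; hclear; lra.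
  apply: (Hd1 t s (clip (xt t) x) (clip (xt s) x') u) => //.
  + by rewrite h1.
  + by rewrite h3.
  + exact: clB.
  + exact: clB.
  + apply: clip_dist.
      apply: (le_trans (xtd t s h1 h2 h3 h4)).
      have : L * `|t - s| <= L * d by rewrite ler_wpM2l// ltW.
      by move: dE d0; hclear; lra.
    by move: xx dE Ld; hclear; lra.
Qed.

End regularize.

(** * The relaxed pair *)

Lemma continuous_eps (R : realType) (V W : normedModType R) (g : V -> W) :
  (forall x e, 0 < e -> exists2 d : R, 0 < d &
     forall y, `|y - x| < d -> `|g y - g x| <= e) -> continuous g.
Proof.
move=> H x; apply/cvgrPdist_le => e e0; have [d d0 Hd] := H x e e0.
apply/nbhs_ballP; exists d => //= y; rewrite -ball_normE /= distrC => yx.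
by rewrite distrC; exact: Hd.
Qed.

Section mean_mdot.
Context {R : realType} (r : nat).
Variables (mu : probability (@borel_rV R r) R) (U : set 'rV[R]_r).
Hypotheses (cU : compact U) (muU : mu (~` U) = 0%E).

Lemma continuous_entry (T : topologicalType) p q (G : T -> 'M[R]_(p, q)) i j :
  continuous G -> continuous (fun x => G x i j).
Proof.
by move=> cG x; exact: (continuous_comp (cG x) (@coord_continuous _ _ _ i j (G x))).
Qed.

Lemma continuous_sum (T : topologicalType) (I : Type) (s : seq I)
    (c : I -> R) (g : I -> T -> R) :
  (forall i, continuous (g i)) -> continuous (fun x => \sum_(i <- s) c i * g i x).
Proof.
move=> cg; elim: s => [|i s IH] x.
  have -> : (fun x => \sum_(i <- [::]) c i * g i x) = cst 0 by apply/funext => y; rewrite big_nil.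
  exact: cst_continuous.
have -> : (fun x => \sum_(i <- i :: s) c i * g i x) =
    (fun x => c i * g i x + \sum_(i <- s) c i * g i x) by apply/funext => y; rewrite big_cons.
have ci : continuous_at x (fun v => c i * g i v).
  exact: (continuousM (@cst_continuous _ _ (c i) x) (cg i x)).
exact: (continuousD ci (IH x)).
Qed.

Lemma mean_mdot p q (G : 'rV[R]_r -> 'M[R]_(p, q)) (L : 'M[R]_(p, q)) :
  continuous G -> mdot L (mean mu G) = \int[mu]_(u in setT) mdot L (G u).
Proof.
move=> cG; rewrite /mdot.
have inner i : \sum_j L i j * mean mu G i j = \int[mu]_(u in setT) \sum_j L i j * G u i j.
  under eq_bigr do rewrite mxE.
  by apply: (mean_linear cU muU) => j; exact: continuous_entry.
under eq_bigr do rewrite inner.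
have H := mean_linear cU muU (index_enum 'I_p) (fun=> 1) (g := fun i u => \sum_j L i j * G u i j)
  (fun i => continuous_sum (fun j => continuous_entry cG)).
transitivity (\sum_i 1 * (\int[mu]_(u in setT) \sum_j L i j * G u i j)).
  by apply: eq_bigr => i _; rewrite mul1r.
by rewrite H; apply: eq_Rintegral => u _; apply: eq_bigr => i _; rewrite mul1r.
Qed.

Lemma mean_mdot_le p q (G : 'rV[R]_r -> 'M[R]_(p, q)) (L : 'M[R]_(p, q)) (k : R) :
  continuous G -> (forall u, U u -> mdot L (G u) <= k) -> mdot L (mean mu G) <= k.
Proof.
move=> cG HG; rewrite mean_mdot//; apply: (mean_le cU muU) => //.
have -> : (fun u => mdot L (G u)) = (fun u => \sum_i 1 * \sum_j L i j * G u i j).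
  by apply/funext => u; apply: eq_bigr => i _; rewrite mul1r.
by apply: continuous_sum => i; apply: continuous_sum => j; exact: continuous_entry.
Qed.

Lemma mean_norm_le p q (G : 'rV[R]_r -> 'M[R]_(p, q)) (k : R) : 0 <= k ->
  continuous G -> (forall u, U u -> `|G u| <= k) -> `|mean mu G| <= k.
Proof.
move=> k0 cG HG; apply: mx_norm_le => // i j; rewrite mxE ler_norml; apply/andP; split.
  rewrite lerNl -[leLHS]mulN1r.
  have := mean_linear cU muU [:: tt] (fun=> -1) (g := fun _ u => G u i j)
    (fun=> continuous_entry cG).
  rewrite big_seq1 => ->; apply: (mean_le cU muU).
    by apply: continuous_sum => _; exact: continuous_entry.
  move=> u Uu; rewrite big_seq1 mulN1r.
  have := le_trans (mx_entry_le (G u) i j) (HG u Uu).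
  by rewrite ler_norml lerNl => /andP[].
apply: (mean_le cU muU); first exact: continuous_entry.
move=> u Uu; apply: le_trans (HG u Uu).
by apply: (le_trans (ler_norm _)); rewrite mx_entry_le.
Qed.

End mean_mdot.

Section pair.
Context {R : realType} {n r : nat}.
Variables (f : R -> 'rV[R]_n -> 'rV[R]_r -> 'rV[R]_n) (U : set 'rV[R]_r).
Variables (t1 t2 : R) (x1 : 'rV[R]_n) (xh : R -> 'rV[R]_n).
Variable muh : R -> probability (@borel_rV R r) R.
Hypotheses (hf : continuous_with_fx_fxx f) (U0 : U !=set0) (cU : compact U).
Hypothesis t12 : (t1 < t2) /\ True.
Hypothesis hadm : admissible_pair f U t1 t2 x1 xh muh.

Let Amx t : 'M[R]_n := mean (muh t) (fx f t (xh t)).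

Lemma muh_full : {ae (@lebesgue_measure R), forall t, muh t (~` U) = 0%E}.
Proof.
have [[[reg _ _] supU] _ _ _] := hadm.
apply: (ae_imp2 supU supU) => t st _.
exact: supp_null.
Qed.

Lemma continuous_fu t x : continuous (fun u => f t x u).
Proof.
have [cf _ _] := hf; apply: continuous_eps => u e e0.
have [d d0 Hd] := continuous_dist cf t x u e0.
by exists d => // v uv; apply: (Hd t x v) => //; rewrite subrr normr0.
Qed.

Lemma continuous_fxu t x : continuous (fun u => fx f t x u).
Proof.
have [_ [_ cf] _] := hf; apply: continuous_eps => u e e0.
have [d d0 Hd] := continuous_dist cf t x u e0.
by exists d => // v uv; apply: (Hd t x v) => //; rewrite subrr normr0.
Qed.

Lemma abs_continuous_bounded : exists B : R, forall t, t1 <= t -> t <= t2 -> `|xh t| <= B.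
Proof.
have [t12' _] := t12; have [_ acx _ _] := hadm.
have [d d0 Hd] := acx 1 ltr01.
suff [B HB] : exists B : R, forall t, t1 <= t -> t <= t2 -> `|xh t| <= B by exists B.
apply: (@real_induction R t1 t2 (fun q => exists B : R, forall t, t1 <= t -> t <= q -> `|xh t| <= B)).
- exact: ltW.
- by exists `|xh t1| => t ta at_; have -> : t = t1 by apply/le_anti; rewrite ta at_.
move=> t /andP[ta tb]; exists (d / 2); first by rewrite divr_gt0.
move=> p q ap pt tq qb pd qd [B HB]; exists (B + 1) => s as_ sq.
have B0 : 0 <= B by apply: le_trans (HB t1 (lexx _) ap).
have [sp|ps] := leP s p; first by rewrite (le_trans (HB s as_ sp))// lerDl.
have := Hd [:: (p, s)]; rewrite /= !big_seq1 /= ap (ltW ps) (le_trans sq qb) => /(_ isT isT).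
have sd : s - p < d by move: sq pd qd; hclear; lra.
move=> /(_ sd) h1; have -> : xh s = xh p + (xh s - xh p) by lmod R.
by apply: (le_trans (ler_normD _ _)); rewrite lerD ?HB// ltW.
Qed.

Lemma is_derive_mx p q (M : R -> 'M[R]_(p, q)) (A : 'M[R]_(p, q)) (t : R) :
  (forall i j, is_derive t 1 (fun s => M s i j) (A i j)) -> is_derive t 1 M A.
Proof.
move=> H.
have dM : derivable M t 1 by apply/derivable_mxP => i j; have [] := H i j.
split => //; rewrite derive_mx//; apply/matrixP => i j; rewrite mxE.
by have [] := H i j.
Qed.

(** Boundedness of [xh] bounds the velocities over [U], hence their means; an absolutely continuous
    curve with bounded derivative is Lipschitz. *)
Lemma pair_lip : exists B C : R, [/\ 0 <= C, forall t, t1 <= t -> t <= t2 -> `|xh t| <= B,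
  lip_on t1 t2 C xh & forall t u, t1 <= t -> t <= t2 -> U u ->
   `|f t (xh t) u| <= C /\ `|fx f t (xh t) u| <= C].
Proof.
have [B HB] := abs_continuous_bounded.
have [cf [_ cfx] _] := hf.
have [C1 C10 HC1] := compact_bounded3 t1 t2 B cf cU.
have [C2 C20 HC2] := compact_bounded3 t1 t2 B cfx cU.
have C0 : 0 <= C1 + C2 by rewrite addr_ge0// ltW.
have [_ acx dx _] := hadm.
have fC t u : t1 <= t -> t <= t2 -> U u ->
    `|f t (xh t) u| <= C1 + C2 /\ `|fx f t (xh t) u| <= C1 + C2.
  move=> h1 h2 Uu; have tt : t1 <= t <= t2 by rewrite h1.
  have q1 := HC1 t (xh t) u tt (HB t h1 h2) Uu.
  have q2 := HC2 t (xh t) u tt (HB t h1 h2) Uu.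
  split; [apply: (le_trans q1)|apply: (le_trans q2)].
    by rewrite lerDl ltW.
  by rewrite lerDr ltW.
exists B, (C1 + C2); split => //.
move=> p q ap pq qb.
have := @abs_continuous_mvi R _ p q xh 0 (C1 + C2) pq C0.
rewrite scaler0 subr0; apply.
  move=> e e0; have [d d0 Hd] := acx e e0; exists d => // s s1; apply: Hd.
  by apply: sub_all s1 => i /and3P[i1 -> i2]; rewrite (le_trans ap i1) (le_trans i2 qb).
apply: (ae_imp2 dx muh_full) => t dxt mut; rewrite in_itv/= => /andP[pt tq].
exists (mean (muh t) (f t (xh t))).
  by apply: dxt; rewrite in_itv/= (le_lt_trans ap pt) (lt_le_trans tq qb).
rewrite subr0; apply: (mean_norm_le cU mut) => //; first exact: continuous_fu.
move=> u Uu; have h1 := le_trans ap (ltW pt); have h2 := le_trans (ltW tq) qb.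
by have [] := fC t u h1 h2 Uu.
Qed.

Definition clamp (t : R) : R := Order.max t1 (Order.min t t2).

Lemma clamp_id t : t1 <= t -> t <= t2 -> clamp t = t.
Proof. by move=> h1 h2; rewrite /clamp (min_idPl h2) (max_idPr h1). Qed.

Lemma clamp_in t : t1 <= clamp t /\ clamp t <= t2.
Proof.
have [t12' _] := t12.
by rewrite /clamp; split; rewrite ?le_max ?lexx// ge_max (ltW t12') ge_min lexx orbT.
Qed.

Lemma clamp_dist s t : s <= t -> clamp s <= clamp t /\ clamp t - clamp s <= t - s.
Proof.
have [t12' _] := t12; move: t12'; rewrite /clamp /Order.max /Order.min.
by case: ifP; case: ifP; case: ifP; case: ifP; hclear; move=> *; split; lra.
Qed.

Lemma lip_clamp C a b : 0 <= C -> lip_on t1 t2 C xh -> lip_on a b C (xh \o clamp).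
Proof.
move=> C0 lx p q _ pq _ /=; have [h1 h2] := clamp_dist pq.
have [p1 _] := clamp_in p; have [_ q2] := clamp_in q.
by apply: (le_trans (lx _ _ p1 h1 q2)); rewrite ler_wpM2l.
Qed.

(** Weak measurability speaks of row-valued functions continuous on all of the product of time and
    control space. So [xh] is extended by [clamp], the matrix [fx] is read row by row, and the
    entries of the mean are truncated at [C] to be bounded for all times; truncation changes nothing
    inside the interval at times when the measure is carried by [U]. *)
Lemma pair_primitive : exists C W, [/\ 0 <= C, lip_on t1 t2 C W &
  {ae (@lebesgue_measure R), forall t, t \in `]t1, t2[ -> is_derive t 1 W (Amx t)}].
Proof.
have [B [C [C0 HB xL fC]]] := pair_lip.
have [[[_ _ wm] _] _ _ _] := hadm.
have [_ [_ cfx] _] := hf.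
pose xt := xh \o clamp.
have xtd s t : `|xt s - xt t| <= C * `|s - t|.
  have H (a b : R) : a <= b -> `|xt b - xt a| <= C * `|b - a|.
    move=> ab; rewrite ger0_norm ?subr_ge0//.
    exact: (lip_clamp C0 xL (lexx a) ab (lexx b)).
  have [ts|st] := leP t s; first exact: H.
  by rewrite distrC [`|s - t|]distrC; apply: H; exact: ltW.
have HW i j : exists2 W : R -> R,
    (forall p q, t1 <= p -> p <= q -> `|W q - W p| <= C * (q - p)) &
    {ae (@lebesgue_measure R), forall t, t1 < t ->
       is_derive t 1 W (Order.max (- C) (Order.min C (mean (muh t) (fx f t (xt t)) i j)))}.
  apply: lebesgue_primitive.
    pose g (p : R * 'rV[R]_r) : 'rV[R]_n := row i (fx f p.1 (xt p.1) p.2).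
    have cg : continuous g.
      move=> p; apply/cvgrPdist_le => e e0.
      have [d d0 Hd] := continuous_dist cfx p.1 (xt p.1) p.2 e0.
      have C1 : 0 < C + 1 by rewrite ltr_wpDl.
      pose d' := Order.min d (d / (C + 1)).
      have d'0 : 0 < d' by rewrite lt_min d0 divr_gt0.
      exists (ball p.1 d', ball p.2 d') => /=.
        by split; exact: nbhsx_ballx.
      move=> q [/= q1 q2]; move: q1 q2; rewrite -!ball_normE /= => q1 q2.
      have pq : `|fx f q.1 (xt q.1) q.2 - fx f p.1 (xt p.1) p.2| <= e.
        apply: (Hd q.1 (xt q.1) q.2).
        - by rewrite distrC (lt_le_trans q1)// ge_min lexx.
        - apply: (le_lt_trans (xtd _ _)).
          have : `|p.1 - q.1| < d / (C + 1) by rewrite (lt_le_trans q1)// ge_min lexx orbT.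
          rewrite ltr_pdivlMr// distrC; have := normr_ge0 (q.1 - p.1); hclear.
          by move: `|q.1 - p.1| => z; lra.
        - by rewrite distrC (lt_le_trans q2)// ge_min lexx.
      apply: le_trans pq; rewrite distrC; apply: mx_norm_le => // k l; rewrite !mxE.
      have := mx_entry_le (fx f q.1 (xt q.1) q.2 - fx f p.1 (xt p.1) p.2) i l.
      by rewrite !mxE.
    have := wm g cg 0 j.
    rewrite (_ : (fun t => _) = (fun t => mean (muh t) (fx f t (xt t)) i j)); last first.
      by apply/funext => t; rewrite !mxE; apply: eq_Rintegral => u _; rewrite !mxE.
    move=> mg; apply: measurable_maxr; first exact: measurable_cst.
    by apply: measurable_minr => //; exact: measurable_cst.
  move=> t; rewrite ler_norml le_max lexx /= ge_max ge_min lexx andbT.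
  by move: C0; hclear; lra.
have /choice[W1 HW1] : forall i, exists W1 : 'I_n -> R -> R, forall j,
    (forall p q, t1 <= p -> p <= q -> `|W1 j q - W1 j p| <= C * (q - p)) /\
    {ae (@lebesgue_measure R), forall t, t1 < t ->
       is_derive t 1 (W1 j) (Order.max (- C) (Order.min C (mean (muh t) (fx f t (xt t)) i j)))}.
  move=> i; have /choice[W1 H1] : forall j, exists W : R -> R,
    (forall p q, t1 <= p -> p <= q -> `|W q - W p| <= C * (q - p)) /\
    {ae (@lebesgue_measure R), forall t, t1 < t ->
       is_derive t 1 W (Order.max (- C) (Order.min C (mean (muh t) (fx f t (xt t)) i j)))}.
    by move=> j; have [W h1 h2] := HW i j; exists W.
  by exists W1.
exists C, (fun t => \matrix_(i, j) W1 i j t); split => //.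
  move=> p q ap pq qb; apply: mx_norm_le => [|i j]; first by rewrite mulr_ge0// subr_ge0.
  by rewrite !mxE; apply: (HW1 i j).1.
have F := ae_filter_ringOfSetsType (@lebesgue_measure R).
have Hall : {ae (@lebesgue_measure R), forall t, forall ij : 'I_n * 'I_n, t1 < t ->
       is_derive t 1 (W1 ij.1 ij.2) (Order.max (- C) (Order.min C (mean (muh t) (fx f t (xt t)) ij.1 ij.2)))}.
  have HH (ij : 'I_n * 'I_n) := (HW1 ij.1 ij.2).2.
  exact: (@filter_forall _ _ (fun (ij : 'I_n * 'I_n) (t : R) => t1 < t ->
       is_derive t 1 (W1 ij.1 ij.2) (Order.max (- C) (Order.min C (mean (muh t) (fx f t (xt t)) ij.1 ij.2)))) _ F HH).
apply: (ae_imp2 Hall muh_full) => t Ht mut; rewrite in_itv/= => /andP[t1t tt2].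
have xtE : xt t = xh t by rewrite /xt /= clamp_id// ltW.
apply: is_derive_mx => i j.
have := Ht (i, j) t1t; rewrite /= xtE.
have : `|Amx t| <= C.
  apply: (mean_norm_le cU mut) => //; first exact: continuous_fxu.
  by move=> u Uu; have [] := fC t u (ltW t1t) (ltW tt2) Uu.
move=> /(le_trans (mx_entry_le (Amx t) i j)); rewrite -/(Amx t) ler_norml => /andP[a1 a2].
rewrite (min_idPr a2) (max_idPr a1).
by rewrite (_ : (fun s => _) = W1 i j)//; apply/funext => s; rewrite mxE.
Qed.

(** One list of weights serves both relations: otherwise the imitating control could have the right
    velocity with a wrong linearization. *)
Definition slopes_in_hull (W : R -> 'M[R]_n) :=
  forall eta : R, 0 < eta -> exists2 d : R, 0 < d & forall a b,
    t1 <= a -> a < b -> b <= t2 -> b - a <= d -> exists s, [/\ weights U s,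
      `|\sum_(p <- s) p.1 *: f a (xh a) p.2 - (b - a)^-1 *: (xh b - xh a)| <= eta &
      `|\sum_(p <- s) p.1 *: fx f a (xh a) p.2 - (b - a)^-1 *: (W b - W a)| <= eta].

(** The slope of [xh] and [W], stacked in one matrix, averages means of [f] and [fx] stacked alike.
    It therefore satisfies every linear inequality of their values at time [a] up to a small error,
    and [hull_approx] turns this into weights. *)
Lemma pair_hull (C' : R) (W : R -> 'M[R]_n) : 0 <= C' -> lip_on t1 t2 C' W ->
  {ae (@lebesgue_measure R), forall t, t \in `]t1, t2[ -> is_derive t 1 W (Amx t)} ->
  slopes_in_hull W.
Proof.
move=> C'0 WL dW eta eta0.
have [B [C [C0 HB xL fC]]] := pair_lip.
have [cf [_ cfx] _] := hf.
have [_ _ dx _] := hadm.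
pose G t u : 'M[R]_(1 + n, n) := col_mx (f t (xh t) u) (fx f t (xh t) u).
pose Y t : 'M[R]_(1 + n, n) := col_mx (xh t) (W t).
have col_norm (A : 'M[R]_(1, n)) (D : 'M[R]_(n, n)) e : `|A| <= e -> `|D| <= e -> `|col_mx A D| <= e.
  move=> Ae De; apply: mx_norm_le => [|i j]; first exact: le_trans Ae.
  rewrite /col_mx mxE; case: (fintype.split i) => l.
    exact: le_trans (mx_entry_le A l j) Ae.
  exact: le_trans (mx_entry_le D l j) De.
have cG t : continuous (G t).
  apply: continuous_eps => u e e0.
  have [d1 d10 H1] := continuous_dist cf t (xh t) u e0.
  have [d2 d20 H2] := continuous_dist cfx t (xh t) u e0.
  exists (Order.min d1 d2); first by rewrite lt_min d10.
  move=> v; rewrite lt_min => /andP[v1 v2]; rewrite /G opp_col_mx add_col_mx.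
  apply: col_norm; first by apply: (H1 t (xh t) v); rewrite // subrr normr0.
  by apply: (H2 t (xh t) v); rewrite // subrr normr0.
pose q : R := (1 + n)%:R * n%:R.
have q0 : 0 <= q by rewrite mulr_ge0.
pose eta' := eta / 2 / (q + 1).
have q1 : 0 < q + 1 by rewrite ltr_wpDl.
have eta'0 : 0 < eta' by rewrite !divr_gt0.
have qeta : q * eta' <= eta / 2.
  have : (q + 1) * eta' = eta / 2 by rewrite /eta' mulrC mulfVK// gt_eqF.
  by move: eta'0; hclear; lra.
have [d1 d10 Hd1] := compact_uniform t1 t2 B cf cU eta'0.
have [d2 d20 Hd2] := compact_uniform t1 t2 B cfx cU eta'0.
pose d := Order.min d1 d2 / (C + 1).
have C1 : 0 < C + 1 by rewrite ltr_wpDl.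
have d0 : 0 < d by rewrite divr_gt0// lt_min d10.
have dE : d * (C + 1) = Order.min d1 d2 by rewrite mulfVK// gt_eqF.
have Cd0 : 0 <= C * d by rewrite mulr_ge0// ltW.
exists d => // a b ta ab bt bad.
have abW := ltW ab.
have GU t u : a <= t -> t <= b -> U u -> `|G t u - G a u| <= eta'.
  move=> at_ tb Uu.
  have tt1 := le_trans ta at_; have tt2 := le_trans tb bt.
  have at2 := le_trans abW bt.
  have ta1 : `|t - a| <= d by rewrite ger0_norm ?subr_ge0//; move: tb bad; hclear; lra.
  have xa : `|xh t - xh a| <= C * d.
    apply: (le_trans (xL _ _ ta at_ tt2)); rewrite ler_wpM2l//.
    by move: tb bad; hclear; lra.
  have m1 : Order.min d1 d2 <= d1 by rewrite ge_min lexx.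
  have m2 : Order.min d1 d2 <= d2 by rewrite ge_min lexx orbT.
  rewrite /G opp_col_mx add_col_mx; apply: col_norm.
    apply: (Hd1 t a (xh t) (xh a) u); rewrite ?tt1 ?ta ?HB//.
      by move: ta1 dE m1 Cd0; hclear; lra.
    by move: xa dE m1 d0; hclear; lra.
  apply: (Hd2 t a (xh t) (xh a) u); rewrite ?tt1 ?ta ?HB//.
    by move: ta1 dE m2 Cd0; hclear; lra.
  by move: xa dE m2 d0; hclear; lra.
have meanG t : mean (muh t) (G t) = col_mx (mean (muh t) (f t (xh t))) (Amx t).
  apply/matrixP => i j; rewrite [LHS]mxE [RHS]mxE.
  under eq_Rintegral do rewrite mxE.
  by case: (fintype.split i) => l; rewrite mxE.
have YL : lip_on t1 t2 (C + C') Y.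
  move=> p s tp ps st; rewrite /Y opp_col_mx add_col_mx.
  have sp : 0 <= s - p by rewrite subr_ge0.
  apply: col_norm; [apply: (le_trans (xL _ _ tp ps st))|apply: (le_trans (WL _ _ tp ps st))].
    by rewrite ler_wpM2r// lerDl.
  by rewrite ler_wpM2r// lerDr.
have main L k : (forall u, U u -> mdot L (G a u) <= k) ->
     mdot L ((b - a)^-1 *: (Y b - Y a)) <= k + `|L| * (eta / 2).
  move=> Hk; set k1 := k + _.
  (* The mean value inequality is two-sided. The velocities lie between [- K] and [k1]; taking the
     centre and the radius of this interval, its upper half is the desired bound by [k1]. *)
  pose K := q * `|L| * C + `|k1|.
  have K0 : 0 <= q * `|L| * C by rewrite !mulr_ge0.
  have k1K : - k1 <= K by rewrite /K; have := ler_norm (- k1); rewrite normrN; move: K0; hclear; lra.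
  have mB : forall A : 'M[R]_(1 + n, n), `|mdot L A| <= q * `|L| * `|A| by move=> A; exact: mdot_le.
  have acy : abs_continuous a b (fun t => mdot L (Y t)).
    apply: (@lip_on_ac _ _ _ _ (q * `|L| * (C + C'))).
      by rewrite mulr_ge0 ?addr_ge0// mulr_ge0.
    move=> p s ap ps sb; rewrite -mdotBr; apply: (le_trans (mB _)).
    rewrite -[leRHS]mulrA ler_wpM2l ?mulr_ge0//; apply: YL => //.
      exact: le_trans ap.
    exact: le_trans bt.
  have := @abs_continuous_mvi R _ a b (fun t => mdot L (Y t)) ((k1 - K) / 2) ((k1 + K) / 2) abW _ acy _.
  have kk0 : 0 <= (k1 + K) / 2 by move: k1K; hclear; lra.
  move=> /(_ kk0) H.
  have {H} : `|mdot L (Y b) - mdot L (Y a) - (b - a) *: ((k1 - K) / 2)| <= (k1 + K) / 2 * (b - a).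
    apply: H; apply: (ae_imp2 (ae_imp2 dx dW (fun t h1 h2 => conj h1 h2)) muh_full).
    move=> t [dxt dWt] mut; rewrite in_itv/= => /andP[at_ tb].
    have tI : t \in `]t1, t2[ by rewrite in_itv/= (le_lt_trans ta at_) (lt_le_trans tb bt).
    exists (mdot L (mean (muh t) (G t))).
      move/is_deriveP: (dxt tI) => D1; move/is_deriveP: (dWt tI) => D2.
      apply/is_deriveP => e e0.
      have qL : 0 < q * `|L| + 1 by rewrite ltr_wpDl// mulr_ge0.
      have e'0 : 0 < e / (q * `|L| + 1) by rewrite divr_gt0.
      have [r1 r10 Hr1] := D1 _ e'0; have [r2 r20 Hr2] := D2 _ e'0.
      exists (Order.min r1 r2); first by rewrite lt_min r10.
      move=> s; rewrite lt_min => /andP[s1 s2].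
      rewrite meanG -mdotBr.
      have -> : (s - t) *: mdot L (col_mx (mean (muh t) (f t (xh t))) (Amx t)) =
         mdot L ((s - t) *: col_mx (mean (muh t) (f t (xh t))) (Amx t)) by rewrite mdotZr.
      rewrite -mdotBr; apply: (le_trans (mB _)).
      have cn : `|Y s - Y t - (s - t) *: col_mx (mean (muh t) (f t (xh t))) (Amx t)| <= e / (q * `|L| + 1) * `|s - t|.
        rewrite /Y scale_col_mx !opp_col_mx !add_col_mx; apply: col_norm.
          exact: Hr1.
        exact: Hr2.
      apply: (@le_trans _ _ (q * `|L| * (e / (q * `|L| + 1) * `|s - t|))).
        by rewrite ler_wpM2l// mulr_ge0.
      rewrite mulrA ler_wpM2r// mulrCA ger_pMr// ler_pdivrMr// mul1r lerDl//.
    have up : mdot L (mean (muh t) (G t)) <= k1.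
      apply: (mean_mdot_le cU mut) => // u Uu.
      have -> : G t u = G a u + (G t u - G a u) by lmod R.
      rewrite mdotDr; apply: lerD; first exact: Hk.
      apply: (le_trans (ler_norm _)); apply: (le_trans (mB _)).
      rewrite mulrAC mulrC ler_wpM2l//; apply: le_trans qeta.
      by rewrite ler_wpM2l// GU// ltW.
    have lo : - K <= mdot L (mean (muh t) (G t)).
      have GC : `|mean (muh t) (G t)| <= C.
        apply: (mean_norm_le cU mut) => // u Uu.
        have [f1 f2] := fC t u (le_trans ta (ltW at_)) (le_trans (ltW tb) bt) Uu.
        exact: col_norm.
      have := mB (mean (muh t) (G t)).
      have : q * `|L| * `|mean (muh t) (G t)| <= q * `|L| * C by rewrite ler_wpM2l// mulr_ge0.
      rewrite ler_norml /K => h1 /andP[h2 _].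
      by move: h1 h2 (normr_ge0 k1); hclear; lra.
    by rewrite ler_norml; move: up lo; hclear; move=> *; apply/andP; split; lra.
  rewrite ler_norml => /andP[_ H].
  rewrite mdotZr mdotBr mulrC ler_pdivrMr ?subr_gt0//.
  by move: H; rewrite /GRing.scale/=; hclear; lra.
have e20 : 0 < eta / 2 by rewrite divr_gt0.
have [s sw sG] := hull_approx U0 e20 main.
have etaE : 2 * (eta / 2) = eta by rewrite mulrC mulfVK.
rewrite etaE in sG.
have sE : \sum_(x <- s) x.1 *: G a x.2 =
   col_mx (\sum_(x <- s) x.1 *: f a (xh a) x.2) (\sum_(x <- s) x.1 *: fx f a (xh a) x.2).
  elim: (s) => [|p s' IH]; first by rewrite !big_nil col_mx0.
  by rewrite !big_cons IH /G scale_col_mx add_col_mx.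
rewrite sE /Y opp_col_mx add_col_mx scale_col_mx opp_col_mx add_col_mx in sG.
exists s; split => //.
  rewrite distrC; apply: le_trans sG; apply: mx_norm_le => // i j.
  set M := col_mx _ _; have := mx_entry_le M (lshift n i) j.
  by rewrite /M col_mxEu.
rewrite distrC; apply: le_trans sG; apply: mx_norm_le => // i j.
set M := col_mx _ _; have := mx_entry_le M (rshift 1 i) j.
by rewrite /M col_mxEd.
Qed.

End pair.

(** * The linearized flow *)

Section flow.
Context {R : realType} {n : nat}.
Variables (t1 t2 : R) (xh : R -> 'rV[R]_n).
Hypothesis t12 : (t1 < t2) /\ True.

(* The integrated form of the adjoint equation [dPsi = - dW Psi]. *)
Definition adjoint_increments (W Psi : R -> 'M[R]_n) :=
  forall w : R, 0 < w -> exists2 d : R, 0 < d & forall a b,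
      t1 <= a -> a <= b -> b <= t2 -> b - a < d ->
      `|Psi a - Psi b - (W b - W a) *m Psi b| <= w * (b - a).

(* The integrated form of [dV = (g dt - dxh) Psi]. *)
Definition variation_increments (Psi : R -> 'M[R]_n) (g V : R -> 'rV[R]_n) :=
  forall w : R, 0 < w -> exists2 d : R, 0 < d & forall a b,
      t1 <= a -> a <= b -> b <= t2 -> b - a < d ->
      `|V b - V a - ((b - a) *: g a - (xh b - xh a)) *m Psi a| <= w * (b - a).

(** Time reversal turns the terminal condition into an initial one, and [sewing] solves the reversed
    equation. The base point of an increment becomes the right end of the interval, whence [Psi b]
    in [adjoint_increments]. *)
Lemma adjoint_flow (C : R) (W : R -> 'M[R]_n) : 0 <= C -> lip_on t1 t2 C W ->
  exists (L : R) (Psi : R -> 'M[R]_n), [/\ 0 <= L, Psi t2 = 1%:M, lip_on t1 t2 L Psi,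
    forall t, t1 <= t -> t <= t2 -> `|Psi t| <= L &
    adjoint_increments W Psi].
Proof.
have [t12' _] := t12 => C0 WL.
pose rev (t : R) : R := t1 + t2 - t.
have revK t : rev (rev t) = t by rewrite /rev; ring.
pose K (s : R) (Y : 'M[R]_n) (q : R) : 'M[R]_n := - (W (rev q) *m Y).
have nC : 0 <= n%:R * C by rewrite mulr_ge0.
have WR p q : t1 <= p -> p <= q -> q <= t2 -> `|W (rev p) - W (rev q)| <= C * (q - p).
  move=> tp pq qt; have -> : q - p = rev p - rev q by rewrite /rev; ring.
  by apply: WL; rewrite /rev; move: tp pq qt; hclear; lra.
have KE s y z p q : K s z q - K p y p = (W (rev p) - W (rev q)) *m z + W (rev p) *m (y - z).
  rewrite /K mulmxBl mulmxBr.
  by move: (W (rev q) *m z) (W (rev p) *m y) (W (rev p) *m z) => a b c'; hclear; lmod R.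
have KE' s z p q : K s z q - K s z p = (W (rev p) - W (rev q)) *m z.
  by have := KE s z z p q; rewrite subrr mulmx0 addr0.
have [| |y [y1 [L L0 yL] yi]] := @sewing R n n t1 t2 (n%:R * C) K 1%:M t12' nC _.
- move=> s y p q _ tp pq qt; rewrite KE subrr mulmx0 addr0.
  apply: (le_trans (mulmx_norm_le _ _)).
  have h1 := WR p q tp pq qt.
  rewrite -!mulrA; apply: ler_wpM2l => //; rewrite mulrA.
  by apply: ler_pM => //; rewrite lerDr.
- move=> w w0; have nC1 : 0 < n%:R * C + 1 by rewrite ltr_wpDl.
  exists (w / (n%:R * C + 1)); first by rewrite divr_gt0.
  move=> s y p q z _ tp pq qt _ _ zy.
  have -> : K p z q - K p z p - (K s y q - K s y p) = (W (rev p) - W (rev q)) *m (z - y).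
    by rewrite !KE !subrr !mulmx0 !addr0 mulmxBr.
  apply: (le_trans (mulmx_norm_le _ _)).
  have qp : 0 <= q - p by rewrite subr_ge0.
  apply: (@le_trans _ _ (n%:R * (C * (q - p)) * `|z - y|)).
    by rewrite ler_wpM2r// ler_wpM2l// WR.
  apply: (@le_trans _ _ ((n%:R * C + 1) * `|z - y| * (q - p))).
    have : 0 <= `|z - y| * (q - p) by rewrite mulr_ge0.
    by hclear; lra.
  rewrite ler_wpM2r// mulrC -ler_pdivlMr//; exact: ltW.
exists (1 + n%:R + L * (t2 - t1) + L), (fun t => y (rev t)).
have Lt : 0 <= L * (t2 - t1) by rewrite mulr_ge0// subr_ge0 ltW.
have PL : lip_on t1 t2 L (fun t => y (rev t)).
  move=> p q tp pq qt; rewrite distrC; have -> : q - p = rev p - rev q by rewrite /rev; ring.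
  by apply: yL; rewrite /rev; move: tp pq qt; hclear; lra.
have rt2 : rev t2 = t1 by rewrite /rev; ring.
split.
- by rewrite !addr_ge0.
- by rewrite rt2.
- move=> p q tp pq qt; apply: (le_trans (PL p q tp pq qt)).
  by rewrite ler_wpM2r ?subr_ge0// lerDr !addr_ge0.
- move=> t tt tt2; have := PL t t2 tt tt2 (lexx _); rewrite rt2 y1 => h1.
  rewrite -[y (rev t)](subKr 1%:M).
  apply: (le_trans (ler_normB _ _)).
  have n1 : `|1%:M : 'M[R]_n| <= 1.
    apply: mx_norm_le => // i j; rewrite mxE; case: (i == j); rewrite ?normr1 ?normr0//.
  have h2 : L * (t2 - t) <= L * (t2 - t1) by rewrite ler_wpM2l// lerD2l lerN2.
  have n0 : 0 <= n%:R :> R by [].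
  by move: h1 h2 n1 L0 n0; hclear; lra.
move=> w w0; have [d d0 Hd] := yi w w0; exists d => // a b ta ab bt abd.
have := Hd (rev b) (rev b) (rev a); rewrite (KE' (rev b)) !revK.
have -> : rev a - rev b = b - a by rewrite /rev; ring.
apply; first by apply/andP; rewrite /rev; split; move: ta ab bt; hclear; lra.
- by rewrite /rev; move: ta ab bt; hclear; lra.
- by rewrite /rev; move: ta ab bt; hclear; lra.
- by rewrite /rev; move: ta ab bt; hclear; lra.
- by rewrite subrr normr0.
by rewrite ger0_norm// subr_ge0.
Qed.

(** The right-hand side does not depend on the unknown, so [sewing] acts here as a Riemann-Stieltjes
    integral against [t] and [xh]. *)
Lemma variation_primitive (C L : R) (Psi : R -> 'M[R]_n) (g : R -> 'rV[R]_n) :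
  0 <= C -> 0 <= L -> lip_on t1 t2 C xh -> lip_on t1 t2 L Psi ->
  (forall t, t1 <= t -> t <= t2 -> `|Psi t| <= L) ->
  (forall t, t1 <= t -> t <= t2 -> `|g t| <= C) ->
  (forall w : R, 0 < w -> exists2 d : R, 0 < d & forall s t,
     t1 <= s -> s <= t2 -> t1 <= t -> t <= t2 -> `|s - t| < d -> `|g s - g t| <= w) ->
  exists C' (V : R -> 'rV[R]_n), [/\ 0 <= C', lip_on t1 t2 C' V &
    variation_increments Psi g V].
Proof.
have [t12' _] := t12 => C0 L0 xL PL PB gB gc.
pose K (s : R) (y : 'rV[R]_n) (q : R) : 'rV[R]_n := (q *: g s - xh q) *m Psi s.
have KE s y p q : K s y q - K s y p = ((q - p) *: g s - (xh q - xh p)) *m Psi s.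
  rewrite /K -mulmxBl; congr (_ *m _); by lmod R.
have nCL : 0 <= n%:R * (2 * C) * L by rewrite !mulr_ge0.
have gx s p q : t1 <= s -> s <= t2 -> t1 <= p -> p <= q -> q <= t2 ->
    `|(q - p) *: g s - (xh q - xh p)| <= 2 * C * (q - p).
  move=> ts st tp pq qt; apply: (le_trans (ler_normB _ _)).
  have h1 := xL p q tp pq qt; have h2 := gB s ts st.
  have qp : 0 <= q - p by rewrite subr_ge0.
  have h3 : (q - p) * `|g s| <= (q - p) * C by rewrite ler_wpM2l.
  by rewrite normrZ (ger0_norm qp); move: h1 h3; hclear; lra.
have [| |V [_ [C' C'0 VL] Vi]] := @sewing R 1 n t1 t2 (n%:R * (2 * C) * L) K 0 t12' nCL.
- move=> s y p q /andP[ts st] tp pq qt; rewrite KE.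
  apply: (le_trans (mulmx_norm_le _ _)).
  have qp : 0 <= q - p by rewrite subr_ge0.
  have -> : n%:R * (2 * C) * L * (q - p) * (1 + `|y|) =
    n%:R * (2 * C * (q - p)) * L * (1 + `|y|) by ring.
  rewrite -[leLHS]mulr1; apply: ler_pM => //; last by rewrite lerDl.
  apply: ler_pM; rewrite ?mulr_ge0//; last exact: PB.
  by rewrite ler_wpM2l// gx.
- move=> w w0.
  pose c := n%:R * L + n%:R * (2 * C) * L + 1.
  have c0 : 0 < c by rewrite ltr_wpDl// addr_ge0// mulr_ge0.
  have wc : 0 < w / c by rewrite divr_gt0.
  have [d d0 Hd] := gc _ wc.
  exists (Order.min d (w / c)); first by rewrite lt_min d0.
  move=> s y p q z /andP[ts st] tp pq qt; rewrite !lt_min => /andP[pd pw] _ _.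
  have pt := le_trans pq qt; have tq := le_trans tp pq.
  have qp : 0 <= q - p by rewrite subr_ge0.
  rewrite !KE.
  have -> : ((q - p) *: g p - (xh q - xh p)) *m Psi p - ((q - p) *: g s - (xh q - xh p)) *m Psi s =
    (q - p) *: ((g p - g s) *m Psi p) + ((q - p) *: g s - (xh q - xh p)) *m (Psi p - Psi s).
    by rewrite !mulmxBr !mulmxBl -!scalemxAl; clear; lmod R.
  apply: (le_trans (ler_normD _ _)); rewrite normrZ (ger0_norm qp).
  have h1 : `|(g p - g s) *m Psi p| <= n%:R * (w / c) * L.
    apply: (le_trans (mulmx_norm_le _ _)); apply: ler_pM; rewrite ?mulr_ge0//; last exact: PB.
    by rewrite ler_wpM2l// Hd.
  have h2 : `|Psi p - Psi s| <= L * (w / c).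
    have PP (a b : R) : t1 <= a -> a <= b -> b <= t2 -> `|b - a| < w / c -> `|Psi b - Psi a| <= L * (w / c).
      move=> ta ab bt abw; apply: (le_trans (PL _ _ ta ab bt)).
      rewrite ler_wpM2l//; apply: le_trans (ltW abw); exact: ler_norm.
    have [ps|sp] := leP s p; first exact: PP.
    by rewrite distrC; apply: PP => //; [exact: ltW|rewrite distrC].
  have h3 : `|((q - p) *: g s - (xh q - xh p)) *m (Psi p - Psi s)| <=
     n%:R * (2 * C * (q - p)) * (L * (w / c)).
    apply: (le_trans (mulmx_norm_le _ _)); apply: ler_pM; rewrite ?mulr_ge0//.
    by rewrite ler_wpM2l// gx.
  have h4 : (q - p) * `|(g p - g s) *m Psi p| <= (q - p) * (n%:R * (w / c) * L).
    by rewrite ler_wpM2l.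
  apply: (le_trans (lerD h4 h3)).
  have -> : (q - p) * (n%:R * (w / c) * L) + n%:R * (2 * C * (q - p)) * (L * (w / c)) =
     (c - 1) * (w / c) * (q - p) by rewrite /c; ring.
  rewrite ler_wpM2r// mulrBl mul1r [c * _]mulrC mulfVK ?gt_eqF// gerBl; exact: ltW.
exists C', V; split => // w w0; have [d d0 Hd] := Vi w w0.
exists d => // a b ta ab bt abd; rewrite -(KE a 0); apply: (Hd a a b) => //.
- by rewrite ta (le_trans ab).
- by rewrite subrr normr0.
- by rewrite ger0_norm// subr_ge0.
Qed.

Lemma adjoint_derive (L : R) (W Psi : R -> 'M[R]_n) (A : 'M[R]_n) (t : R) :
  0 <= L -> lip_on t1 t2 L Psi ->  (forall t, t1 <= t -> t <= t2 -> `|Psi t| <= L) ->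
  adjoint_increments W Psi ->
  t1 < t -> t < t2 -> is_derive t 1 W A -> is_derive t 1 Psi (- (A *m Psi t)).
Proof.
move=> L0 PL PB Pi t1t tt2 /is_deriveP dW; apply/is_deriveP => e e0.
pose c := 1 + n%:R * L + n%:R * (`|A| + 1) * L.
have c0 : 0 < c by rewrite ltr_wpDr// ?mulr_ge0 ?addr_ge0// ?ltr_wpDr ?mulr_ge0.
have w0 : 0 < e / c by rewrite divr_gt0.
pose w' := Order.min (e / c) 1.
have w'0 : 0 < w' by rewrite lt_min w0 ltr01.
have w'1 : w' <= 1 by rewrite ge_min lexx orbT.
have w'e : w' <= e / c by rewrite ge_min lexx.
clearbody w'.
have [d1 d10 H1] := Pi _ w'0; have [d2 d20 H2] := dW _ w'0.
pose d := Order.min (Order.min d1 d2) (Order.min w' (Order.min (t - t1) (t2 - t))).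
exists d; first by rewrite !lt_min d10 d20 w'0 !subr_gt0 t1t.
move=> q; rewrite !lt_min => /andP[/andP[q1 q2] /andP[qw /andP[qt1 qt2]]].
have {}H2 := H2 q q2.
have [tq qt] : t1 <= q /\ q <= t2.
  by move: qt1 qt2; rewrite !ltr_norml => /andP[? ?] /andP[? ?]; split; lra.
have cE : c * w' <= e by rewrite mulrC -ler_pdivlMr.
have a0 : 0 <= `|A| + 1 by rewrite addr_ge0.
have dWn : `|W q - W t| <= (`|A| + 1) * `|q - t|.
  have -> : W q - W t = (W q - W t - (q - t) *: A) + (q - t) *: A by lmod R.
  apply: (le_trans (ler_normD _ _)); rewrite normrZ.
  have : w' * `|q - t| <= 1 * `|q - t| by rewrite ler_wpM2r.
  by move: H2; hclear; lra.
have err : `|(W q - W t - (q - t) *: A) *m Psi t| <= n%:R * L * w' * `|q - t|.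
  apply: (le_trans (mulmx_norm_le _ _)).
  have -> : n%:R * L * w' * `|q - t| = n%:R * (w' * `|q - t|) * L by ring.
  apply: ler_pM; rewrite ?mulr_ge0//; last by apply: PB; exact: ltW.
  by rewrite ler_wpM2l.
suff : `|Psi q - Psi t + (W q - W t) *m Psi t| <= (1 + n%:R * (`|A| + 1) * L) * w' * `|q - t|.
  move=> main.
  have -> : Psi q - Psi t - (q - t) *: - (A *m Psi t) =
    (Psi q - Psi t + (W q - W t) *m Psi t) - (W q - W t - (q - t) *: A) *m Psi t.
    rewrite !mulmxBl -scalemxAl.
    by move: (A *m Psi t) (W q *m Psi t) (W t *m Psi t) => a b c'; hclear; lmod R.
  apply: (le_trans (ler_normB _ _)); apply: (le_trans (lerD main err)).
  apply: (@le_trans _ _ (c * w' * `|q - t|)); last by rewrite ler_wpM2r.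
  by rewrite /c; move: (`|q - t|) => z; hclear; lra.
have [qt'|tq'] := leP q t.
  have qtE : `|q - t| = t - q by rewrite distrC ger0_norm// subr_ge0.
  have := H1 q t tq qt' (ltW tt2); rewrite -qtE => /(_ q1).
  have -> : Psi q - Psi t - (W t - W q) *m Psi t = Psi q - Psi t + (W q - W t) *m Psi t.
    rewrite !mulmxBl; move: (W q *m Psi t) (W t *m Psi t) => a b.
    by hclear; lmod R.
  move/le_trans; apply; rewrite -mulrA mulrDl mul1r lerDl; apply: mulr_ge0; last by rewrite mulr_ge0// ltW.
  by rewrite !mulr_ge0.
have qtE : `|q - t| = q - t by rewrite ger0_norm// subr_ge0 ltW.
have := H1 t q (ltW t1t) (ltW tq') qt; rewrite -qtE => /(_ q1) h1.
(* To the right of [t] the increment relation has [Psi q] where the derivative needs [Psi t]; the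
   exchange costs a product of two increments, which is of second order. *)
have h2 : `|(W q - W t) *m (Psi t - Psi q)| <= n%:R * (`|A| + 1) * L * w' * `|q - t|.
  apply: (le_trans (mulmx_norm_le _ _)).
  have -> : n%:R * (`|A| + 1) * L * w' * `|q - t| = n%:R * ((`|A| + 1) * `|q - t|) * (L * w') by ring.
  apply: ler_pM; rewrite ?mulr_ge0//; first by rewrite ler_wpM2l.
  rewrite distrC; apply: (le_trans (PL _ _ (ltW t1t) (ltW tq') qt)).
  by rewrite ler_wpM2l// -qtE ltW.
have -> : Psi q - Psi t + (W q - W t) *m Psi t =
  (W q - W t) *m (Psi t - Psi q) - (Psi t - Psi q - (W q - W t) *m Psi q).
  rewrite !mulmxBl !mulmxBr.
  by move: (W q *m Psi t) (W t *m Psi t) (W q *m Psi q) (W t *m Psi q) => a b c' e'; hclear; lmod R.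
apply: (le_trans (ler_normB _ _)); apply: (le_trans (lerD h2 h1)).
rewrite normr_id.
by move: (`|q - t|) => z; hclear; lra.
Qed.

End flow.

(** * Variations and adjoint covectors *)

Lemma is_derive_mdot (R : realType) m n (x : R -> 'M[R]_(m, n)) (v L : 'M[R]_(m, n)) (t : R) :
  is_derive t 1 x v -> is_derive t 1 (fun s => mdot L (x s)) (mdot L v).
Proof.
move=> /is_deriveP dx; apply/is_deriveP => e e0.
pose c := m%:R * n%:R * `|L|.
have c0 : 0 <= c by rewrite !mulr_ge0.
have c1 : 0 < c + 1 by rewrite ltr_wpDl.
have [d d0 Hd] := dx _ (divr_gt0 e0 c1); exists d => // q /Hd H.
have -> : (q - t) *: mdot L v = mdot L ((q - t) *: v) by rewrite mdotZr.
rewrite -!mdotBr; apply: (le_trans (mdot_le _ _)); rewrite -/c.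
apply: (@le_trans _ _ ((c + 1) * (e / (c + 1) * `|q - t|))).
  by apply: ler_pM => //; rewrite lerDl.
by rewrite mulrA [_ * (e / _)]mulrC mulfVK// gt_eqF.
Qed.

Lemma is_derive_mulmxr (R : realType) m n p (x : R -> 'M[R]_(m, n)) (v : 'M[R]_(m, n))
    (A : 'M[R]_(n, p)) (t : R) :
  is_derive t 1 x v -> is_derive t 1 (fun s => x s *m A) (v *m A).
Proof.
move=> /is_deriveP dx; apply/is_deriveP => e e0.
pose c := n%:R * `|A|.
have c0 : 0 <= c by rewrite !mulr_ge0.
have c1 : 0 < c + 1 by rewrite ltr_wpDl.
have [d d0 Hd] := dx _ (divr_gt0 e0 c1); exists d => // q /Hd H.
rewrite scalemxAl -!mulmxBl; apply: (le_trans (mulmx_norm_le _ _)); rewrite mulrAC -/c.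
apply: (@le_trans _ _ ((c + 1) * (e / (c + 1) * `|q - t|))).
  by apply: ler_pM => //; rewrite lerDl.
by rewrite mulrA [_ * (e / _)]mulrC mulfVK// gt_eqF.
Qed.

Lemma pairing_mdot (R : realType) n (P : 'M[R]_n) (L y : 'rV[R]_n) :
  pairing (P *m L^T) y = mdot L (y *m P).
Proof.
rewrite /pairing mulmxA mxE /mdot big_ord1; apply: eq_bigr => i _.
by rewrite !mxE mulrC.
Qed.

Lemma sup_dist (R : realType) (T : Type) (U : set T) (g1 g2 : T -> R) (B e : R) :
  U !=set0 -> (forall u, U u -> g1 u <= B) -> (forall u, U u -> g2 u <= B) ->
  (forall u, U u -> `|g1 u - g2 u| <= e) ->
  `|sup [set g1 u | u in U] - sup [set g2 u | u in U]| <= e.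
Proof.
move=> [u0 Uu0] b1 b2 H.
have aux (h1 h2 : T -> R) : (forall u, U u -> h1 u <= B) ->
    (forall u, U u -> h2 u <= B) -> (forall u, U u -> h1 u - h2 u <= e) ->
    sup [set h1 u | u in U] - sup [set h2 u | u in U] <= e.
  move=> c1 c2 h; rewrite lerBlDr; apply: ge_sup; first by exists (h1 u0), u0.
  move=> _ [u Uu <-]; have : h2 u <= sup [set h2 u | u in U].
    apply: ub_le_sup; last by exists u.
    by exists B => _ [v Uv <-]; exact: c2.
  by have := h u Uu; hclear; lra.
rewrite ler_norml; apply/andP; split.
  rewrite lerNl opprB; apply: aux => // u Uu.
  by have := H u Uu; rewrite ler_norml => /andP[]; hclear; lra.
apply: aux => // u Uu.
by have := H u Uu; rewrite ler_norml => /andP[]; hclear; lra.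
Qed.

Section cone.
Context {R : realType} {n r : nat}.
Variables (f : R -> 'rV[R]_n -> 'rV[R]_r -> 'rV[R]_n) (U : set 'rV[R]_r).
Variables (t1 t2 : R) (x1 : 'rV[R]_n) (xh : R -> 'rV[R]_n).
Variable muh : R -> probability (@borel_rV R r) R.
Hypotheses (hf : continuous_with_fx_fxx f) (U0 : U !=set0) (cU : compact U).
Hypothesis t12 : (t1 < t2) /\ True.
Hypothesis hadm : admissible_pair f U t1 t2 x1 xh muh.

Let Amx t : 'M[R]_n := mean (muh t) (fx f t (xh t)).

(** Dyadic times remain nodes of all finer dyadic grids, so variations chosen before the mesh keep
    their end points exactly. *)
Definition dyadic (p i : nat) : R := t1 + i%:R * ((t2 - t1) / 2 ^+ p).

Lemma dyadic_step (p : nat) : 0 < (t2 - t1) / 2 ^+ p.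
Proof. by have [h _] := t12; rewrite divr_gt0 ?subr_gt0// exprn_gt0. Qed.

Lemma dyadic_step_le (p : nat) : (t2 - t1) / 2 ^+ p <= t2 - t1.
Proof.
have [h _] := t12; rewrite ler_pdivrMr ?exprn_gt0// ler_peMr//.
  by rewrite subr_ge0 ltW.
by rewrite exprn_ege1// ler1n.
Qed.

Lemma dyadic_step_lim e : 0 < e -> exists p0, forall p, (p0 <= p)%N -> (t2 - t1) / 2 ^+ p < e.
Proof.
move=> e0; have [h _] := t12; exists (Num.truncn ((t2 - t1) / e)).+1 => p pp.
rewrite ltr_pdivrMr ?exprn_gt0// mulrC -ltr_pdivrMr//.
apply: (lt_trans (truncnS_gt _)); apply: (@le_lt_trans _ _ p%:R); first by rewrite ler_nat.
by rewrite -natrX ltr_nat ltn_expl.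
Qed.

(** [xh] need not be differentiable at [t2]. A cluster point of its backward slopes serves as its
    final velocity; approximation at arbitrarily fine levels, not at all of them, is enough. *)
Definition end_slope (x : R -> 'rV[R]_n) (y : 'rV[R]_n) :=
  forall (e : R) p0, 0 < e -> exists2 p, (p0 <= p)%N &
    let h := (t2 - t1) / 2 ^+ p in `|h^-1 *: (x t2 - x (t2 - h)) - y| <= e.

Lemma slope_limit (C : R) : 0 <= C -> lip_on t1 t2 C xh ->
  exists y : 'rV[R]_n, end_slope xh y.
Proof.
move=> C0 xL; have [h12 _] := t12.
have [UF [UFu UFoo]] := ultraFilterLemma (@eventually_filter).
pose h (p : nat) : R := (t2 - t1) / 2 ^+ p.
pose u p : 'rV[R]_n := (h p)^-1 *: (xh t2 - xh (t2 - h p)).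
have h0 p : 0 < h p by exact: dyadic_step.
have uB p : `|u p| <= C.
  rewrite /u normrZ normfV gtr0_norm// mulrC ler_pdivrMr//.
  have -> : C * h p = C * (t2 - (t2 - h p)) by rewrite subKr.
  apply: xL => //; last by rewrite gerBl ltW.
  by rewrite lerBrDl -lerBrDr; exact: dyadic_step_le.
have [y Hy] := bounded_ultra_lim UFu uB.
exists y => e p0 e0.
have UFp : UF [set p | (p0 <= p)%N] by apply: UFoo; exists p0.
have Fp : ProperFilter UF := @ultra_proper _ _ UFu.
have [p [/= pe pp]] := filter_ex (filterI (Hy e e0) UFp).
by exists p.
Qed.

Variables (C : R) (W Psi : R -> 'M[R]_n) (V : 'rV[R]_r -> R -> 'rV[R]_n) (y : 'rV[R]_n).
Hypothesis C0 : 0 <= C /\ True.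
Hypothesis xL : lip_on t1 t2 C xh.
Hypothesis fC : forall t u, t1 <= t -> t <= t2 -> U u -> `|f t (xh t) u| <= C.
Hypothesis dW : {ae (@lebesgue_measure R), forall t, t \in `]t1, t2[ -> is_derive t 1 W (Amx t)}.
Hypotheses (Psi2 : Psi t2 = 1%:M) (PL : lip_on t1 t2 C Psi).
Hypothesis PB : forall t, t1 <= t -> t <= t2 -> `|Psi t| <= C.
Hypothesis HPsi : adjoint_increments t1 t2 W Psi.
Hypothesis HV : forall u, U u -> (exists2 C', 0 <= C' & lip_on t1 t2 C' (V u)) /\
  variation_increments t1 t2 xh Psi (fun t => f t (xh t) u) (V u).
Hypothesis Hy : end_slope xh y.

(* A variation [(c, (p, i, j, u))] uses the control [u] with intensity [c]
   between the dyadic times [dyadic p i] and [dyadic p j]. *)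
Definition variation_ok (q : R * (nat * nat * nat * 'rV[R]_r)) :=
  let: (c, (p, i, j, u)) := q in [/\ 0 < c, U u, (i <= j)%N & (j < 2 ^ p)%N].
Definition effect (q : R * (nat * nat * nat * 'rV[R]_r)) : 'rV[R]_n :=
  let: (_, (p, i, j, u)) := q in V u (dyadic p j) - V u (dyadic p i).
Definition variation_cone : set 'rV[R]_n := [set v | exists2 s,
  (forall q, q \in s -> variation_ok q) & v = \sum_(q <- s) q.1 *: effect q].

Lemma variation_cone_cone : is_cone variation_cone.
Proof.
split.
- by exists [::]; rewrite ?big_nil.
- move=> x z [s1 h1 ->] [s2 h2 ->]; exists (s1 ++ s2); last by rewrite big_cat.
  by move=> q; rewrite mem_cat => /orP[]; [exact: h1|exact: h2].
move=> c x c0 [s hs ->]; exists [seq (c * q.1, q.2) | q <- s].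
  move=> _ /mapP[q qs ->]; have := hs q qs; move: q {qs} => [b [[[p i] j] u]] /=.
  by move=> [b0 Uu ij jp]; split => //; rewrite mulr_gt0.
rewrite scaler_sumr big_map; apply: eq_bigr => -[b [[[p i] j] u]] _ /=.
by rewrite scalerA.
Qed.

Lemma dyadic_below (p : nat) (t : R) : t1 <= t -> t < t2 ->
  exists i, [/\ (i < 2 ^ p)%N, dyadic p i <= t & t < dyadic p i + (t2 - t1) / 2 ^+ p].
Proof.
move=> tt tt2; have h0 := dyadic_step p; set h := (t2 - t1) / 2 ^+ p in h0 *.
have hE : 2 ^+ p * h = t2 - t1 by rewrite /h mulrC mulfVK// expf_neq0.
have [h12 _] := t12.
have : 0 <= (t - t1) / h by rewrite divr_ge0 ?subr_ge0// ltW.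
move=> /truncn_itv; set i := Num.truncn _ => /andP[].
rewrite ler_pdivlMr// ltr_pdivrMr// => i1 i2.
exists i; split.
- rewrite -(ltr_nat R) natrX -(ltr_pM2r h0) hE.
  by move: i1 tt2; hclear; lra.
- by rewrite /dyadic -/h; move: i1; hclear; lra.
rewrite /dyadic -/h; move: i2; rewrite -natr1 mulrDl mul1r; hclear; lra.
Qed.

Variable L : 'rV[R]_n.
Hypothesis HL : forall k, variation_cone k -> mdot L k <= 0.

Let c := n%:R * `|L| + 1.

Lemma mdot_le_const z : `|mdot L z| <= c * `|z|.
Proof.
apply: (le_trans (mdot_le _ _)); rewrite mul1r /c.
by rewrite ler_wpM2r// lerDl.
Qed.

Lemma const_gt0 : 0 < c. Proof. by rewrite ltr_wpDl// mulr_ge0. Qed.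

(** The cone has only dyadic variations; [V u] is Lipschitz, so the inequality extends to arbitrary
    times by approximation from below. *)
Lemma effect_nonpos u a b : U u -> t1 <= a -> a <= b -> b < t2 ->
  mdot L (V u b - V u a) <= 0.
Proof.
move=> Uu ta ab bt; apply/ler_addgt0Pr => e e0; rewrite add0r.
have [[C' C'0 VL] _] := HV Uu.
have c0 := const_gt0.
have C'1 : 0 < c * (2 * C') + 1 by rewrite ltr_wpDl// mulr_ge0 ?mulr_ge0// ltW.
have [p /(_ p (leqnn _)) hp] := dyadic_step_lim (divr_gt0 e0 C'1).
have [i [i2 ia ai]] := dyadic_below p ta (le_lt_trans ab bt).
have [j [j2 jb bj]] := dyadic_below p (le_trans ta ab) bt.
set h := (t2 - t1) / 2 ^+ p in hp ai bj.
have h0 : 0 < h := dyadic_step p.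
have ij : (i <= j)%N.
  rewrite leqNgt; apply/negP => ji.
  have : dyadic p j + h <= dyadic p i.
    rewrite /dyadic -/h -addrA lerD2l -[X in _ + X]mul1r -mulrDl ler_pM2r//.
    by rewrite natr1 ler_nat.
  by move: bj ia ab; hclear; lra.
have tdi : t1 <= dyadic p i by rewrite /dyadic lerDl mulr_ge0// ltW.
have tdj : t1 <= dyadic p j by rewrite /dyadic lerDl mulr_ge0// ltW.
have := HL (k := V u (dyadic p j) - V u (dyadic p i)).
have H : variation_cone (V u (dyadic p j) - V u (dyadic p i)).
  exists [:: (1, (p, i, j, u))]; last by rewrite big_seq1 /= scale1r.
  by move=> q; rewrite inE => /eqP->.
move=> /(_ H) {}H.
have -> : V u b - V u a = (V u (dyadic p j) - V u (dyadic p i)) +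
   ((V u b - V u (dyadic p j)) - (V u a - V u (dyadic p i))) by lmod R.
rewrite mdotDr; set E := _ - (V u a - _).
have Ee : `|E| <= 2 * C' * h.
  apply: (le_trans (ler_normB _ _)).
  have h1 := VL _ _ tdj jb (ltW bt).
  have h2 := VL _ _ tdi ia (le_trans ab (ltW bt)).
  have h3 : C' * (b - dyadic p j) <= C' * h by rewrite ler_wpM2l//; move: bj; hclear; lra.
  have h4 : C' * (a - dyadic p i) <= C' * h by rewrite ler_wpM2l//; move: ai; hclear; lra.
  by move: h1 h2 h3 h4; hclear; lra.
have := mdot_le_const E; rewrite ler_norml => /andP[_ h1].
have h2 : c * `|E| <= c * (2 * C' * h) by rewrite ler_wpM2l// ltW.
have h3 : (c * (2 * C') + 1) * h <= e by rewrite mulrC -ler_pdivlMr// ltW.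
by move: H h1 h2 h3 h0; hclear; lra.
Qed.

(** A variation which starts at [t] and shrinks: from the right, [V u] has the derivative
    [(f t (xh t) u - v) *m Psi t] there, and its increments have nonpositive product with [L]. *)
Lemma max_condition t u v : U u -> t1 < t -> t < t2 -> is_derive t 1 xh v ->
  mdot L (f t (xh t) u *m Psi t) <= mdot L (v *m Psi t).
Proof.
move=> Uu t1t tt2 /is_deriveP dx; rewrite -subr_le0 -mdotBr -mulmxBl.
apply/ler_addgt0Pr => e e0; rewrite add0r.
have [C0' _] := C0; have c0 := const_gt0.
pose k := c * (1 + n%:R * C).
have k0 : 0 < k by rewrite mulr_gt0// ltr_wpDr// mulr_ge0.
have w0 : 0 < e / k by rewrite divr_gt0.
have [_ HVu] := HV Uu.
have [d1 d10 Hd1] := HVu _ w0; have [d2 d20 Hd2] := dx _ w0.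
pose h := Order.min (Order.min d1 d2) (t2 - t) / 2.
have m0 : 0 < Order.min (Order.min d1 d2) (t2 - t) by rewrite !lt_min d10 d20 subr_gt0.
have h0 : 0 < h by rewrite divr_gt0.
have hm : h < Order.min (Order.min d1 d2) (t2 - t) by rewrite /h; move: m0; hclear; lra.
move: hm; clearbody h; rewrite !lt_min => /andP[/andP[hd1 hd2] ht].
have thE : t + h - t = h by rewrite addrAC subrr add0r.
have tth : t <= t + h by rewrite lerDl ltW.
have th2 : t + h < t2 by move: ht; hclear; lra.
have h1 := Hd1 t (t + h) (ltW t1t) tth (ltW th2); rewrite thE in h1; have {}h1 := h1 hd1.
have := Hd2 (t + h); rewrite thE (gtr0_norm h0) => /(_ hd2) h2.
have h3 := effect_nonpos Uu (ltW t1t) tth th2.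
have E : h *: ((f t (xh t) u - v) *m Psi t) = (V u (t + h) - V u t) -
   (V u (t + h) - V u t - (h *: f t (xh t) u - (xh (t + h) - xh t)) *m Psi t) +
   (xh (t + h) - xh t - h *: v) *m Psi t.
  rewrite subKr -mulmxDl scalemxAl; congr (_ *m _); clear; lmod R.
rewrite -(ler_pM2l h0) -mdotZr E mdotDr mdotBr.
set E1 := _ - (h *: _ - _) *m _ in h1 *; set E2 := _ *m Psi t.
have e1 : `|E1| <= e / k * h by [].
have e2 : `|E2| <= n%:R * C * (e / k * h).
  apply: (le_trans (mulmx_norm_le _ _)).
  have -> : n%:R * C * (e / k * h) = n%:R * (e / k * h) * C by ring.
  apply: ler_pM; rewrite ?mulr_ge0//; last by apply: PB; exact: ltW.
  by rewrite ler_wpM2l.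
have := mdot_le_const E1; have := mdot_le_const E2; rewrite !ler_norml => /andP[_ q2] /andP[q1 _].
have ek : k * (e / k) = e by rewrite mulrC mulfVK// gt_eqF.
have h4 : c * `|E1| <= c * (e / k * h) by rewrite ler_wpM2l// ltW.
have h5 : c * `|E2| <= c * (n%:R * C * (e / k * h)) by rewrite ler_wpM2l// ltW.
have -> : h * e = h * (k * (e / k)) by rewrite ek.
by move: h3 q1 q2 h4 h5; rewrite /k; hclear; lra.
Qed.

Let psi (t : R) : 'cV[R]_n := Psi t *m L^T.

Lemma Hfun_bound t u : t1 <= t -> t <= t2 -> U u ->
  `|Hfun f t (xh t) (psi t) u| <= c * (n%:R * C * C).
Proof.
move=> tt tt2 Uu; rewrite /Hfun pairing_mdot; apply: (le_trans (mdot_le_const _)).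
rewrite ler_wpM2l ?(ltW const_gt0)//; apply: (le_trans (mulmx_norm_le _ _)).
have [C0' _] := C0.
by apply: ler_pM; rewrite ?mulr_ge0 ?PB// ler_wpM2l// fC.
Qed.

Lemma Mfun_equicontinuous e : 0 < e -> exists2 d : R, 0 < d & forall s t,
  t1 <= s -> s <= t2 -> t1 <= t -> t <= t2 -> `|s - t| < d ->
  `|Mfun f U s (xh s) (psi s) - Mfun f U t (xh t) (psi t)| <= e.
Proof.
move=> e0; have [C0' _] := C0; have c0 := const_gt0.
have [B HB] := abs_continuous_bounded t12 hadm.
have [cf _ _] := hf.
pose k := c * (n%:R * C + n%:R * C * C) + 1.
have k0 : 0 < k.
  by rewrite ltr_wpDl// mulr_ge0 ?(ltW c0)// addr_ge0 ?mulr_ge0.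
have w0 : 0 < e / k by rewrite divr_gt0.
have [d d0 Hd] := compact_uniform t1 t2 B cf cU w0.
pose d' := Order.min (e / k) (d / (C + 1)).
have C1 : 0 < C + 1 by rewrite ltr_wpDl.
exists (Order.min d d'); first by rewrite !lt_min d0 w0 divr_gt0.
move=> s t ts st tt tt2; rewrite !lt_min => /andP[std /andP[stw stc]].
apply: (@sup_dist R _ U _ _ (c * (n%:R * C * C)) e U0).
- by move=> u Uu; apply: le_trans (Hfun_bound ts st Uu); exact: ler_norm.
- by move=> u Uu; apply: le_trans (Hfun_bound tt tt2 Uu); exact: ler_norm.
have lipn m p (g : R -> 'M[R]_(m, p)) : lip_on t1 t2 C g -> `|g s - g t| <= C * `|s - t|.
  move=> gL; have [st'|ts'] := leP s t.
    by rewrite distrC [`|s - t|]distrC [`|t - s|]ger0_norm ?subr_ge0// gL.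
  by rewrite [`|s - t|]gtr0_norm ?subr_gt0// gL// ltW.
move=> u Uu; rewrite /Hfun !pairing_mdot -mdotBr.
have fst : `|f s (xh s) u - f t (xh t) u| <= e / k.
  apply: (Hd s t (xh s) (xh t) u); rewrite ?ts ?tt ?HB//.
    exact: ltW.
  apply: (le_trans (lipn _ _ _ xL)).
  move: stc; rewrite ltr_pdivlMr//; have := normr_ge0 (s - t).
  by move: (`|s - t|) => z; hclear; lra.
have Pst : `|Psi s - Psi t| <= C * (e / k).
  by apply: (le_trans (lipn _ _ _ PL)); rewrite ler_wpM2l// ltW.
apply: (le_trans (mdot_le_const _)).
have -> : f s (xh s) u *m Psi s - f t (xh t) u *m Psi t =
  (f s (xh s) u - f t (xh t) u) *m Psi s + f t (xh t) u *m (Psi s - Psi t).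
  by rewrite mulmxBl mulmxBr addrA subrK.
have a1 : `|(f s (xh s) u - f t (xh t) u) *m Psi s| <= n%:R * (e / k) * C.
  apply: (le_trans (mulmx_norm_le _ _)).
  by apply: ler_pM; rewrite ?mulr_ge0 ?PB// ler_wpM2l.
have a2 : `|f t (xh t) u *m (Psi s - Psi t)| <= n%:R * C * (C * (e / k)).
  apply: (le_trans (mulmx_norm_le _ _)).
  by apply: ler_pM; rewrite ?mulr_ge0// ler_wpM2l// fC.
apply: (@le_trans _ _ (c * (n%:R * (e / k) * C + n%:R * C * (C * (e / k))))).
  by rewrite ler_wpM2l ?(ltW c0)// (le_trans (ler_normD _ _))// lerD.
have ek : k * (e / k) = e by rewrite mulrC mulfVK// gt_eqF.
by move: ek w0; rewrite {1}/k; move: (e / k) => z; hclear; lra.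
Qed.

(** No admissible velocity exceeds the mean velocity in the pairing, and a mean cannot exceed the
    supremum, so the two agree. *)
Lemma max_condition_ae : {ae (@lebesgue_measure R), forall t, t \in `]t1, t2[ ->
  exists2 v, is_derive t 1 xh v & pairing (psi t) v = Mfun f U t (xh t) (psi t)}.
Proof.
have [_ _ dx _] := hadm.
apply: (ae_imp2 dx (muh_full cU hadm)) => t dxt mut tI.
have := tI; rewrite in_itv/= => /andP[t1t tt2].
exists (mean (muh t) (f t (xh t))); first exact: dxt.
have Hu u : U u -> Hfun f t (xh t) (psi t) u <= pairing (psi t) (mean (muh t) (f t (xh t))).
  move=> Uu; rewrite /Hfun !pairing_mdot; apply: max_condition => //; exact: dxt.
apply/le_anti/andP; split; last first.
  apply: ge_sup; last by move=> _ [u Uu <-]; exact: Hu.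
  by have [u0 Uu0] := U0; exists (Hfun f t (xh t) (psi t) u0), u0.
have E z : pairing (psi t) z = mdot (psi t)^T z.
  rewrite /pairing mxE /mdot big_ord1; apply: eq_bigr => i _.
  by rewrite !mxE mulrC.
rewrite E; apply: (mean_mdot_le cU mut); first exact: (continuous_fu hf).
move=> u Uu; rewrite -E; apply: ub_le_sup; last by exists u.
by eexists => _ [v Uv <-]; exact: Hu.
Qed.

(** Near [t2] the derivative of [mdot L xh] is close to the maximized Hamiltonian, as [Psi t] is
    close to [Psi t2 = 1]. Averaged over [[t2 - h, t2]] it is the slope, which clusters at [y],
    while the maximized Hamiltonian is close to its value at [t2] by continuity. *)
Lemma Mfun_end : Mfun f U t2 (xh t2) (psi t2) = mdot L y.
Proof.
have [t12' _] := t12; have [C0' _] := C0; have c0 := const_gt0.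
apply/eqP; rewrite -subr_eq0 -normr_le0; apply/ler_addgt0Pr => e e0; rewrite add0r.
set M2 := Mfun _ _ _ _ _.
pose k := c * (n%:R * C * C) + c + 1.
have k0 : 0 < k by rewrite ltr_wpDl// addr_ge0 ?(ltW c0)// mulr_ge0 ?(ltW c0)// !mulr_ge0.
have w0 : 0 < e / k by rewrite divr_gt0.
have [d d0 Hd] := Mfun_equicontinuous w0.
have dd0 : 0 < Order.min d (e / k) by rewrite lt_min d0.
have [p0 Hp0] := dyadic_step_lim dd0.
have [p p0p Hp] := Hy p0 w0; move: Hp; set h := _ / 2 ^+ p; cbv zeta => Hp.
have {Hp0}hd := Hp0 p p0p; rewrite -/h lt_min in hd; case/andP: hd => hd hw.
have h0 : 0 < h by exact: dyadic_step.
have th : t1 <= t2 - h.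
  by rewrite lerBrDl -lerBrDr; exact: dyadic_step_le.
have tt : t2 - h <= t2 by rewrite gerBl ltW.
have thE : t2 - (t2 - h) = h by rewrite subKr.
have kk : 0 <= (c * (n%:R * C * C) + 1) * (e / k).
  by rewrite mulr_ge0 ?(ltW w0)// addr_ge0// mulr_ge0 ?(ltW c0)// !mulr_ge0.
have acg : abs_continuous (t2 - h) t2 (fun t => mdot L (xh t)).
  apply: (@lip_on_ac _ _ _ _ (c * C)); first by rewrite mulr_ge0// ltW.
  move=> a b ha ab hb; rewrite -mdotBr; apply: (le_trans (mdot_le_const _)).
  rewrite -mulrA ler_wpM2l ?(ltW c0)//; apply: xL => //; exact: le_trans ha.
have := @abs_continuous_mvi R _ (t2 - h) t2 (fun t => mdot L (xh t)) M2 _ tt kk acg _.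
rewrite thE -mdotBr => H.
have {H} : `|mdot L (xh t2 - xh (t2 - h)) - h *: M2| <=
    (c * (n%:R * C * C) + 1) * (e / k) * h.
  apply: H; apply: (ae_imp2 max_condition_ae max_condition_ae) => t Ht _.
  rewrite in_itv/= => /andP[t1t tt2].
  have t1t' : t1 < t by exact: le_lt_trans t1t.
  have [v dv vM] : exists2 v, is_derive t 1 xh v & pairing (psi t) v = Mfun f U t (xh t) (psi t).
    by apply: Ht; rewrite in_itv/= t1t'.
  exists (mdot L v); first exact: is_derive_mdot.
  have vC : `|v| <= C.
    move/is_deriveP: dv => dv; apply/ler_addgt0Pr => e' e'0.
    have [d' d'0 Hd'] := dv e' e'0.
    pose l := Order.min d' (t2 - t) / 2.
    have l0 : 0 < Order.min d' (t2 - t) by rewrite lt_min d'0 subr_gt0.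
    have lm : l < Order.min d' (t2 - t) by rewrite /l; move: l0; hclear; lra.
    have l00 : 0 < l by rewrite divr_gt0.
    move: lm; clearbody l; rewrite lt_min => /andP[ld' lt].
    have := Hd' (t + l); rewrite addrAC subrr add0r gtr0_norm// => /(_ ld') q1.
    have q2 : `|xh (t + l) - xh t| <= C * l.
      have := xL (p := t) (q := t + l); rewrite addrAC subrr add0r; apply.
      - exact: ltW.
      - by rewrite lerDl ltW.
      - by move: lt; hclear; lra.
    rewrite -(ler_pM2l l00) -{1}(gtr0_norm l00) -normrZ.
    have -> : l *: v = (xh (t + l) - xh t) - (xh (t + l) - xh t - l *: v) by lmod R.
    apply: (le_trans (ler_normB _ _)); move: q1 q2; hclear; lra.
  have M1 : `|Mfun f U t (xh t) (psi t) - M2| <= e / k.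
    apply: Hd => //; [exact: ltW|exact: ltW|exact: ltW|].
    by rewrite distrC gtr0_norm ?subr_gt0//; move: t1t hd; hclear; lra.
  rewrite -vM pairing_mdot in M1.
  have -> : mdot L v - M2 = mdot L (v *m (Psi t2 - Psi t)) + (mdot L (v *m Psi t) - M2).
    by rewrite Psi2 mulmxBr mulmx1 mdotBr; hclear; lra.
  apply: (le_trans (ler_normD _ _)); rewrite mulrDl mul1r; apply: lerD => //.
  apply: (le_trans (mdot_le_const _)); rewrite -mulrA ler_wpM2l ?(ltW c0)//.
  apply: (le_trans (mulmx_norm_le _ _)); rewrite -!mulrA ler_wpM2l//.
  apply: ler_pM => //.
  apply: (le_trans (PL (ltW t1t') (ltW tt2) (lexx _))); rewrite ler_wpM2l//.
  by move: t1t hw; hclear; lra.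
move=> H.
have H2 : `|mdot L (xh t2 - xh (t2 - h)) - h * mdot L y| <= h * (c * (e / k)).
  rewrite -mdotZr -mdotBr.
  have -> : xh t2 - xh (t2 - h) - h *: y = h *: (h^-1 *: (xh t2 - xh (t2 - h)) - y).
    by rewrite scalerBr scalerA mulfV ?scale1r// gt_eqF.
  rewrite mdotZr normrM gtr0_norm// ler_wpM2l ?(ltW h0)//.
  by apply: (le_trans (mdot_le_const _)); rewrite ler_wpM2l// ltW.
rewrite -(ler_pM2l h0) -{1}(gtr0_norm h0) -normrM.
have -> : h * (M2 - mdot L y) = (mdot L (xh t2 - xh (t2 - h)) - h * mdot L y) -
   (mdot L (xh t2 - xh (t2 - h)) - h *: M2) by rewrite /GRing.scale/=; hclear; ring.
apply: (le_trans (ler_normB _ _)); apply: (le_trans (lerD H2 H)).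
have ek : k * (e / k) = e by rewrite mulrC mulfVK// gt_eqF.
by rewrite -[X in _ <= h * X]ek /k; hclear; lra.
Qed.

Lemma adjoint_in_Lambda s : L != 0 -> s * mdot L y <= 0 -> Lambda f U s t1 t2 xh muh psi.
Proof.
move=> Ln0 sL; have [t12' _] := t12; have [C0' _] := C0; split.
- exists t2; first by rewrite in_itv/= lexx ltW.
  by rewrite /psi Psi2 mul1mx; apply: contra_neq Ln0 => /(congr1 trmx); rewrite trmxK trmx0.
- apply: (@lip_on_ac _ _ _ _ (n%:R * `|L^T| * C)); first by rewrite !mulr_ge0.
  move=> p q tp pq qt; rewrite /psi -mulmxBl; apply: (le_trans (mulmx_norm_le _ _)).
  rewrite mulrAC -[leRHS]mulrA ler_wpM2l ?mulr_ge0//; exact: PL.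
- apply: (ae_imp2 dW dW) => t dWt _ tI; have := tI; rewrite in_itv/= => /andP[t1t tt2].
  rewrite /psi mulmxA -mulNmx; apply: is_derive_mulmxr.
  apply: (adjoint_derive C0' PL PB HPsi t1t tt2); exact: dWt.
split.
- apply: (ae_imp2 max_condition_ae max_condition_ae) => t Ht _ tI.
  have [v [dv1 dv2] <-] := Ht tI; by rewrite derive1E dv2.
- apply/subspace_continuousP => t; rewrite /= in_itv/= => /andP[tt tt2].
  apply/cvgrPdist_le => e e0; have [d d0 Hd] := Mfun_equicontinuous e0.
  apply/nbhs_ballP; exists d => //= q; rewrite -ball_normE /= => tq.
  by rewrite in_itv/= => /andP[qt qt2]; exact: Hd.
by rewrite Mfun_end.
Qed.

End cone.

(** * Solving for the intensities of the variations *)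

Section contraction.
Context {R : realType} {n : nat}.

(** Picard iteration from 0. The limit is taken along an ultrafilter, and the decay of successive
    differences shows that it is a fixed point. *)
Lemma contraction_fixpoint (T : 'rV[R]_n -> 'rV[R]_n) (rho : R) : 0 < rho ->
  `|T 0| <= rho / 2 ->
  (forall x z, `|x| <= rho -> `|z| <= rho -> `|T x - T z| <= `|x - z| / 2) ->
  exists2 x, `|x| <= rho & T x = x.
Proof.
move=> r0 T0 TL.
have z0 : `|0 : 'rV[R]_n| <= rho by rewrite normr0 ltW.
have Tin x : `|x| <= rho -> `|T x| <= rho.
  move=> xr; have := TL x 0 xr z0; rewrite subr0 => h.
  have -> : T x = (T x - T 0) + T 0 by rewrite subrK.
  by apply: (le_trans (ler_normD _ _)); move: h T0 xr; hclear; lra.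
pose u k := iter k T 0.
have ur k : `|u k| <= rho by elim: k => [|k IH]; [rewrite /u /=|exact: Tin].
(* The geometric decay is weakened to [1 / k.+1], the quantity that [ultra_approx] makes small. *)
have ud k : `|u k.+1 - u k| <= rho / k.+1%:R.
  have : `|u k.+1 - u k| <= rho / 2 ^+ k.
    elim: k => [|k IH].
      by rewrite /u /= subr0 expr0 divr1; move: T0 r0; hclear; lra.
    have h : `|u k.+2 - u k.+1| <= `|u k.+1 - u k| / 2 := TL _ _ (ur k.+1) (ur k).
    by apply: (le_trans h); rewrite exprSr invfM mulrA ler_wpM2r.
  move/le_trans; apply; rewrite ler_wpM2l ?(ltW r0)// lef_pV2 ?posrE ?exprn_gt0//.
  by rewrite -natrX ler_nat ltn_expl.
have [UF [UFu UFoo]] := ultraFilterLemma (@eventually_filter).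
have [l Hl] := bounded_ultra_lim UFu ur.
have lr : `|l| <= rho.
  apply/ler_addgt0Pr => e e0; have [k [uk _]] := ultra_approx UFu UFoo Hl e0.
  have -> : l = u k - (u k - l) by rewrite subKr.
  by apply: (le_trans (ler_normB _ _)); rewrite lerD.
exists l => //; apply/eqP; rewrite -subr_eq0 -normr_le0; apply/ler_addgt0Pr => e e0.
rewrite add0r.
have c0 : 0 < 2 + rho by rewrite addr_gt0.
have [k [uk ke]] := ultra_approx UFu UFoo Hl (divr_gt0 e0 c0).
have -> : T l - l = - (T (u k) - T l) + (u k.+1 - u k) + (u k - l) by rewrite /u /=; lmod R.
apply: (le_trans (ler_normD _ _)); apply: (le_trans (lerD (ler_normD _ _) (lexx _))).
rewrite normrN.
have h1 := TL _ _ (ur k) lr.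
have h2 : `|u k.+1 - u k| <= rho * (e / (2 + rho)).
  by apply: (le_trans (ud k)); rewrite ler_wpM2l// ltW.
have h3 : (2 + rho) * (e / (2 + rho)) = e by rewrite mulrC mulfVK// gt_eqF.
have h4 := normr_ge0 (u k - l).
by move: h1 h2 h3 h4 uk; move: (e / _) => z; hclear; lra.
Qed.

(* Newton's method with the constant derivative [h *: id]. *)
Lemma hit_target (E : 'rV[R]_n -> 'rV[R]_n) (target : 'rV[R]_n) (rho h : R) :
  0 < rho -> 0 < h -> `|E 0 - target| <= h * (rho / 2) ->
  (forall x z, `|x| <= rho -> `|z| <= rho ->
     `|E x - E z - h *: (x - z)| <= h * (`|x - z| / 2)) ->
  exists2 x, `|x| <= rho & E x = target.
Proof.
move=> r0 h0 E0 EL.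
pose T x := x - h^-1 *: (E x - target).
have hK (x : 'rV[R]_n) : h^-1 *: (h *: x) = x by rewrite scalerA mulVf ?scale1r// gt_eqF.
have [||x xr Tx] := @contraction_fixpoint T rho r0.
- rewrite /T sub0r normrN normrZ gtr0_norm ?invr_gt0// mulrC ler_pdivrMr//.
  by rewrite mulrC.
- move=> x z xr zr; have -> : T x - T z = h^-1 *: - (E x - E z - h *: (x - z)).
    by rewrite scalerN scalerBr hK /T; lmod R.
  by rewrite normrZ normrN gtr0_norm ?invr_gt0// mulrC ler_pdivrMr// mulrC EL.
exists x => //; move: Tx => /eqP; rewrite /T subr_eq -subr_eq0 opprD addrA subrr sub0r.
by rewrite oppr_eq0 scaler_eq0 invr_eq0 gt_eqF//= subr_eq0 => /eqP.
Qed.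

End contraction.

Section affine.
Context {R : realType} {n : nat} {T : eqType}.

Lemma mdot_delta (c : R) (i : 'I_n) (x : 'rV[R]_n) :
  mdot (c *: delta_mx 0 i) x = c * x 0 i.
Proof.
rewrite /mdot big_ord1 (bigD1 i)//= !mxE !eqxx mulr1 big1 ?addr0// => j ji.
by rewrite !mxE (negbTE ji) mulr0 mul0r.
Qed.

Lemma weighted_norm (I : eqType) (G : seq I) (w : I -> R) (E : I -> 'rV[R]_n) (B e : R) :
  (forall g, g \in G -> `|w g| <= B) -> (forall g, g \in G -> `|E g| <= e) ->
  `|\sum_(g <- G) w g *: E g| <= (size G)%:R * (B * e).
Proof.
elim: G => [|g G IH] Hw HE; first by rewrite big_nil normr0 mul0r.
rewrite big_cons /= -natr1 mulrDl mul1r [leRHS]addrC; apply: (le_trans (ler_normD _ _)).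
apply: lerD; first by rewrite normrZ ler_pM// ?Hw ?HE// mem_head.
by apply: IH => k kG; [apply: Hw|apply: HE]; rewrite inE kG orbT.
Qed.

Lemma le_sum_mem (I : eqType) (G : seq I) (F : I -> R) :
  (forall g, g \in G -> 0 <= F g) -> forall g, g \in G -> F g <= \sum_(k <- G) F k.
Proof.
elim: G => [//|g G IH] H k; rewrite big_cons inE => /predU1P[->|kG].
  rewrite lerDl big_seq; apply: sumr_ge0 => i iG; apply: H.
  by rewrite inE iG orbT.
rewrite -[leLHS]add0r lerD//; first by rewrite H// mem_head.
by apply: IH => // i iG; apply: H; rewrite inE iG orbT.
Qed.

(* The points of a small ball around [y] are convex combinations, with affine
   weights, of [y] and of the vertices of a cross-polytope. *)
Lemma cross_polytope (y : 'rV[R]_n) (rho0 : R) : 0 < rho0 ->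
  exists (G : seq (R * 'rV[R]_n * 'rV[R]_n)) (a : R), [/\ 0 < a,
    forall g, g \in G -> [/\ a <= g.1.1, g.1.1 <= 1, `|g.2 - y| <= rho0 &
        forall x, `|mdot g.1.2 x| <= `|x| / (2 * rho0)] &
    forall x, \sum_(g <- G) (g.1.1 + mdot g.1.2 x) *: g.2 = y + x].
Proof.
move=> r0; pose n' : R := n%:R + 1.
have n'0 : 0 < n' by rewrite ltr_wpDl.
have n'1 : 1 <= n' by rewrite lerDr.
pose sg (b : bool) : R := if b then 1 else -1.
have sgn b : `|sg b| = 1 by case: b; rewrite /sg ?normrN normr1.
(* The vertices, [y] plus or minus [rho0] times a basis vector, get the weights [1 / (2 * n')] plus
   or minus [x_i / (2 * rho0)]. The centre gets the remaining [1 / n'], which also covers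
   [n = 0]. *)
pose v (ib : 'I_n * bool) := ((1 / (2 * n'), (sg ib.2 / (2 * rho0)) *: delta_mx 0 ib.1),
   y + (sg ib.2 * rho0) *: delta_mx 0 ib.1) : R * 'rV[R]_n * 'rV[R]_n.
have a0 : 0 < 1 / (2 * n') by rewrite divr_gt0// mulr_gt0.
have r20 : 0 < 2 * rho0 by rewrite mulr_gt0.
exists ((1 / n', 0, y) :: [seq v ib | ib <- enum {: 'I_n * bool}]), (1 / (2 * n')); split => //.
  move=> g; rewrite inE => /predU1P[->/=|/mapP[[i b] _ ->/=]].
    split; rewrite ?subrr ?normr0 ?(ltW r0)//.
    - by rewrite ler_pM2l// lef_pV2 ?posrE ?mulr_gt0// ler_peMl ?(ltW n'0)// ler1n.
    - by rewrite ler_pdivrMr// mul1r.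
    - by move=> x; rewrite mdotC mdot0r normr0 divr_ge0// ltW.
  split => //.
  - by rewrite ler_pdivrMr ?mulr_gt0// mul1r; move: n'1; hclear; lra.
  - rewrite addrAC subrr add0r normrZ normrM sgn mul1r gtr0_norm// ger_pMr//.
    apply: mx_norm_le => // k j; rewrite mxE; by case: (_ && _); rewrite ?normr1 ?normr0.
  - move=> x; rewrite mdot_delta normrM normrM sgn mul1r normfV (gtr0_norm r20) mulrC.
    by rewrite ler_wpM2r ?invr_ge0 ?(ltW r20)// mx_entry_le.
move=> x; rewrite big_cons big_map big_enum /=.
transitivity ((1 / n') *: y + \sum_i \sum_b (((v (i, b)).1.1 + mdot (v (i, b)).1.2 x) *: (v (i, b)).2)).
  by rewrite pair_bigA /= mdotC mdot0r addr0; congr (_ + _); apply: eq_bigr => -[i b].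
under eq_bigr do rewrite big_bool /= !mdot_delta.
transitivity ((1 / n') *: y + \sum_i ((1 / n') *: y + x 0 i *: delta_mx 0 i)).
  congr (_ + _); apply: eq_bigr => i _.
  have n'n : n' != 0 by rewrite gt_eqF.
  have rn : rho0 != 0 by rewrite gt_eqF.
  rewrite !scalerDr !scalerA addrACA -!scalerDl; congr (_ *: _ + _ *: _).
    by rewrite /sg; field; apply/andP.
  by rewrite /sg; field; apply/andP.
rewrite big_split /= sumr_const card_ord [x in RHS]row_sum_delta addrA; congr (_ + _).
rewrite -scaler_nat scalerA -scalerDl -[RHS]scale1r; congr (_ *: _).
by rewrite /n'; field; rewrite gt_eqF.
Qed.

(** Each vertex of the cross-polytope is replaced by a nearby combination of effects with fixed
    positive coefficients. The intensities are these coefficients times the affine weights, hence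
    affine in [x], and the errors at the vertices enter a difference with a factor proportional to
    [|x - x'|]. *)
Lemma affine_variations (ok : T -> Prop) (eff : T -> 'rV[R]_n) (d0 : T)
    (y : 'rV[R]_n) (rho0 : R) : 0 < rho0 -> ok d0 -> eff d0 = 0 ->
  (forall q, `|q - y| <= rho0 -> forall e : R, 0 < e -> exists2 vs : seq (R * T),
     (forall v, v \in vs -> 0 < v.1 /\ ok v.2) &
     `|q - \sum_(v <- vs) v.1 *: eff v.2| <= e) ->
  exists (m : nat) (v : 'I_m.+1 -> T) (al : 'I_m.+1 -> 'rV[R]_n -> R) (rho K : R),
  [/\ 0 < rho /\ 0 < K, forall j, ok (v j),
      forall x, `|x| <= rho -> (forall j, 0 < al j x <= K) /\
        `|\sum_j al j x *: eff (v j) - (y + x)| <= rho / 8 &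
      forall x x', (forall j, `|al j x - al j x'| <= K * `|x - x'|) /\
        `|\sum_j (al j x - al j x') *: eff (v j) - (x - x')| <= `|x - x'| / 8].
Proof.
move=> r0 okd effd H.
have [G [a [a0 HG GE]]] := cross_polytope y r0.
have r20 : 0 < 2 * rho0 by rewrite mulr_gt0.
(* For [|x| <= rho] a weight moves by at most half of its lower bound, so it stays positive. *)
pose rho := Order.min (a * rho0) rho0.
have rho_gt0 : 0 < rho by rewrite lt_min mulr_gt0.
have rho_a : rho <= a * rho0 by rewrite ge_min lexx.
have rho_r : rho <= rho0 by rewrite ge_min lexx orbT.
clearbody rho.
pose N : R := (size G)%:R + 1.
have N0 : 0 < N by rewrite ltr_wpDl.
(* Fewer than [N] vertices, with weights at most 2, have a total error of at most [rho / 8]. *)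
pose e := rho / (16 * N).
have e0 : 0 < e by rewrite divr_gt0// mulr_gt0.
have eE : e * (16 * N) = rho by rewrite mulfVK// gt_eqF// mulr_gt0.
clearbody e.
have /choice[vs Hvs] : forall p, exists vs : seq (R * T), `|p - y| <= rho0 ->
    (forall v, v \in vs -> 0 < v.1 /\ ok v.2) /\ `|p - \sum_(v <- vs) v.1 *: eff v.2| <= e.
  move=> p; have [pr|pr] := leP (`|p - y|) rho0; last by exists [::].
  by have [s s1 s2] := H p pr e e0; exists s.
(* A variation without effect makes the family nonempty, as an index in ['I_m.+1] requires. *)
pose dum : R * T * (R * 'rV[R]_n) := (1, d0, (1, 0)).
pose tl := [seq (q, g.1) | g <- G, q <- vs g.2].
pose vl := dum :: tl.
have Hvl it : it \in vl -> [/\ 0 < it.1.1 /\ ok it.1.2, Order.min a 1 <= it.2.1, it.2.1 <= 1 &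
    forall x, `|mdot it.2.2 x| <= `|x| / (2 * rho0)].
  rewrite inE => /predU1P[->/=|/allpairsPdep[g [q [gG qv ->/=]]]].
    split; rewrite ?ge_min ?lexx ?orbT// => x.
    by rewrite mdotC mdot0r normr0 divr_ge0// ltW.
  have [g1 g2 g3 g4] := HG g gG; have [h1 h2] := Hvs g.2 g3.
  by have [c0 vok] := h1 q qv; split => //; rewrite ge_min g1.
pose S := \sum_(it <- vl) it.1.1.
have Sle it : it \in vl -> it.1.1 <= S.
  apply: (@le_sum_mem _ vl (fun it => it.1.1)) => g /Hvl[[g0 _] _ _ _]; exact: ltW.
have S0 : 0 < S by apply: lt_le_trans (Sle dum (mem_head _ _)); rewrite /dum /=.
pose K := 2 * S + S / (2 * rho0).
pose AL (it : R * T * (R * 'rV[R]_n)) x := it.1.1 * (it.2.1 + mdot it.2.2 x).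
pose it (j : 'I_(size tl).+1) := nth dum vl j.
have itv j : it j \in vl by apply: mem_nth; exact: ltn_ord.
have sumE (F : R * T * (R * 'rV[R]_n) -> 'rV[R]_n) :
    \sum_j F (it j) = F dum + \sum_(g <- G) \sum_(q <- vs g.2) F (q, g.1).
  rewrite -(big_mkord xpredT (fun j => F (nth dum vl j))).
  rewrite -[(size tl).+1]/(size vl) -(big_nth dum xpredT F) big_cons; congr (_ + _).
  by rewrite /tl big_allpairs_dep.
pose Er (g : R * 'rV[R]_n * 'rV[R]_n) := \sum_(v <- vs g.2) v.1 *: eff v.2 - g.2.
have Ere g : g \in G -> `|Er g| <= e.
  move=> gG; have [g1 g2 g3 g4] := HG g gG; have [h1 h2] := Hvs g.2 g3.
  by rewrite /Er distrC.
exists (size tl), (fun j => (it j).1.2), (fun j => AL (it j)), rho, K; split.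
- by split => //; apply: addr_gt0; [exact: mulr_gt0|exact: divr_gt0].
- by move=> j; have [[]] := Hvl _ (itv j).
- move=> x xr; split.
    move=> j; have [[c0 _] h1 h2 h3] := Hvl _ (itv j).
    have := h3 x; have : `|x| / (2 * rho0) <= Order.min a 1 / 2.
      rewrite ler_pdivrMr// (le_trans xr)//.
      have -> : Order.min a 1 / 2 * (2 * rho0) = Order.min a 1 * rho0 by field.
      by rewrite -ler_pdivrMr// le_min !ler_pdivrMr// rho_a mul1r.
    have ma : Order.min a 1 <= 1 by rewrite ge_min lexx orbT.
    have ma0 : 0 < Order.min a 1 by rewrite lt_min a0 ltr01.
    move=> q1; rewrite ler_norml => /andP[q2 q3]; apply/andP; split.
      by apply: mulr_gt0 => //; move: h1 q1 q2 ma0; hclear; lra.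
    apply: (@le_trans _ _ (2 * (it j).1.1)).
      by rewrite /AL mulrC ler_pM2r//; move: h2 q1 q3 ma; hclear; lra.
    rewrite /K; have := Sle _ (itv j); have : 0 <= S / (2 * rho0) by rewrite divr_ge0// ltW.
    by hclear; lra.
  rewrite (sumE (fun it => AL it x *: eff it.1.2)) /= effd scaler0 add0r.
  have -> : \sum_(g <- G) \sum_(q <- vs g.2) AL (q, g.1) x *: eff q.2 - (y + x) =
     \sum_(g <- G) (g.1.1 + mdot g.1.2 x) *: Er g.
    rewrite -GE -sumrB; apply: eq_bigr => g _; rewrite scalerBr; congr (_ - _).
    rewrite scaler_sumr; apply: eq_bigr => q _; rewrite /AL /= scalerA; congr (_ *: _); exact: mulrC.
  apply: (le_trans (@weighted_norm _ _ _ _ 2 e _ Ere)).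
    move=> g gG; have [g1 g2 g3 g4] := HG g gG.
    apply: (le_trans (ler_normD _ _)); rewrite ger0_norm; last by apply: le_trans g1; exact: ltW.
    apply: lerD => //; apply: (le_trans (g4 x)); rewrite ler_pdivrMr// mul1r.
    by move: xr rho_r r0; hclear; lra.
  have : (size G)%:R * (2 * e) <= N * (2 * e) by rewrite ler_wpM2r ?mulr_ge0 ?(ltW e0)// lerDl.
  by move: eE; hclear; lra.
move=> x x'; split.
  move=> j; have [[c0 _] h1 h2 h3] := Hvl _ (itv j).
  have -> : AL (it j) x - AL (it j) x' = (it j).1.1 * mdot (it j).2.2 (x - x').
    by rewrite /AL mdotBr; ring.
  rewrite normrM gtr0_norm//; apply: (@le_trans _ _ (S * (`|x - x'| / (2 * rho0)))).
    by apply: ler_pM => //; [exact: ltW|exact: Sle].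
  have -> : K * `|x - x'| = 2 * S * `|x - x'| + S * (`|x - x'| / (2 * rho0)) by rewrite /K; ring.
  by rewrite lerDr; apply: mulr_ge0 => //; apply: mulr_ge0 => //; exact: ltW.
rewrite (sumE (fun it => (AL it x - AL it x') *: eff it.1.2)) /= effd scaler0 add0r.
have -> : \sum_(g <- G) \sum_(q <- vs g.2) (AL (q, g.1) x - AL (q, g.1) x') *: eff q.2 - (x - x') =
     \sum_(g <- G) (mdot g.1.2 (x - x')) *: Er g.
  have gE : \sum_(g <- G) mdot g.1.2 (x - x') *: g.2 = x - x'.
    transitivity ((y + x) - (y + x')); last by lmod R.
    rewrite -!GE -sumrB; apply: eq_bigr => g _; rewrite -scalerBl mdotBr.
    by congr (_ *: _); ring.
  rewrite -[x - x' in LHS]gE -sumrB; apply: eq_bigr => g _.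
  have -> : \sum_(q <- vs g.2) (AL (q, g.1) x - AL (q, g.1) x') *: eff q.2 =
     mdot g.1.2 (x - x') *: \sum_(q <- vs g.2) q.1 *: eff q.2.
    rewrite scaler_sumr; apply: eq_bigr => q _; rewrite scalerA; congr (_ *: _).
    by rewrite /AL /= mdotBr; ring.
  by rewrite /Er scalerBr.
apply: (le_trans (@weighted_norm _ _ _ _ (`|x - x'| / (2 * rho0)) e _ Ere)).
  by move=> g gG; have [g1 g2 g3 g4] := HG g gG.
have q1 : (size G)%:R * (`|x - x'| / (2 * rho0) * e) <= N * (`|x - x'| / (2 * rho0) * e).
  by rewrite ler_wpM2r ?lerDl// mulr_ge0 ?(ltW e0)// divr_ge0// ltW.
apply: (le_trans q1).
have -> : N * (`|x - x'| / (2 * rho0) * e) = `|x - x'| * ((e * (16 * N)) / rho0 / 32).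
  by field; rewrite gt_eqF.
rewrite eE ler_wpM2l//.
have : rho / rho0 <= 1 by rewrite ler_pdivrMr// mul1r.
by hclear; lra.
Qed.

End affine.

(** * Imitation of the relaxed control on a grid *)

Lemma sum_window (V : zmodType) (g : nat -> V) (a b M : nat) : (a <= b)%N -> (b <= M)%N ->
  \sum_(i < M) (if (a <= i < b)%N then g i.+1 - g i else 0) = g b - g a.
Proof.
move=> ab bM; have H k : \sum_(i < k) (if (a <= i < b)%N then g i.+1 - g i else 0) =
    g (minn b k) - g (minn a k).
  elim: k => [|k IH]; first by rewrite big_ord0 !minn0 subrr.
  rewrite big_ord_recr /= IH.
  have [ak|] := boolP (a <= k)%N; last first.
    rewrite -ltnNge => ka; rewrite addr0 (minn_idPr (ltnW ka)) (minn_idPr ka) (minn_idPr (leq_trans (ltnW ka) ab)).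
    by rewrite (minn_idPr (leq_trans ka ab)) !subrr.
  have [kb|] := boolP (k < b)%N.
    by rewrite (minn_idPr (ltnW kb)) (minn_idPr kb) (minn_idPl ak) (minn_idPl (leqW ak)) addrC subrKA.
  by rewrite -leqNgt => bk; rewrite addr0 (minn_idPl bk) (minn_idPl (leqW bk)) (minn_idPl ak) (minn_idPl (leqW ak)).
by rewrite H (minn_idPl bM) (minn_idPl (leq_trans ab bM)).
Qed.

(** Finitely many smallness requirements, linear in the step, are met below one threshold. The later
    choices of constants are lists of pairs (factor, bound). *)
Lemma small_all (R : realType) (s : seq (R * R)) : (forall p, p \in s -> 0 < p.2) ->
  exists2 w : R, 0 < w & forall h : R, 0 < h -> h <= w -> forall p, p \in s -> p.1 * h <= p.2.
Proof.
elim: s => [|[c b] s IH] H; first by exists 1.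
have [p ps|w w0 Hw] := IH; first by apply: H; rewrite inE ps orbT.
have b0 : 0 < b by apply: (H (c, b)); rewrite mem_head.
have c1 : 0 < `|c| + 1 by rewrite ltr_wpDl.
exists (Order.min w (b / (`|c| + 1))); first by rewrite lt_min w0 divr_gt0.
move=> h h0; rewrite le_min => /andP[hw hb] p; rewrite inE => /predU1P[->/=|ps]; last exact: Hw.
rewrite ler_pdivlMr// in hb; apply: le_trans hb.
rewrite mulrC ler_pM2l//; have := ler_norm c; hclear; lra.
Qed.

(* In the [i]-th cell of the grid the control takes its values in the proportions
   given by the weights [pw i]. *)
Definition grid_data (R : realType) n r m
    (F : R -> 'rV[R]_n -> 'rV[R]_r -> 'rV[R]_n) (U : set 'rV[R]_r)
    (xt : R -> 'rV[R]_n) (D : R -> 'rV[R]_r -> 'M[R]_n)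
    (t1 T1 : R) (step : nat -> R) (C : R)
    (W Psi : R -> 'M[R]_n) (vu : 'I_m.+1 -> 'rV[R]_r)
    (act : nat -> nat -> 'I_m.+1 -> bool) (dV : nat -> nat -> 'I_m.+1 -> 'rV[R]_n)
    (eta : R) :=
  exists2 w : R, 0 < w & forall N, step N <= w ->
  exists pw : nat -> seq (R * 'rV[R]_r),
  [/\ forall i, weights U (pw i),
    (forall s t u, t1 <= s -> s <= T1 -> t1 <= t -> t <= T1 -> `|t - s| <= step N -> U u ->
     `|F t (xt t) u - F s (xt s) u| <= eta) &
    let h := step N in let tt := ti t1 h in forall i, (i < 2 ^ N)%N ->
    [/\ `|h *: (\sum_(p <- pw i) p.1 *: F (tt i) (xt (tt i)) p.2) -
          (xt (tt i.+1) - xt (tt i))| <= eta * h,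
        forall z : 'rV[R]_n, `|h *: (\sum_(p <- pw i) p.1 *: (z *m D (tt i) p.2)) -
            z *m (W (tt i.+1) - W (tt i))| <= eta * h * `|z|,
        forall z : 'rV[R]_n, `|z *m Psi (tt i) -
          (z + z *m (W (tt i.+1) - W (tt i))) *m Psi (tt i.+1)| <= eta * h * `|z|,
        forall z : 'rV[R]_n, `|z *m Psi (tt i.+1)| <= C * `|z| &
        forall j, (act N i j ->
          `|(h *: F (tt i) (xt (tt i)) (vu j) - (xt (tt i.+1) - xt (tt i))) *m Psi (tt i.+1)
             - dV N i j| <= eta * h) /\ (~~ act N i j -> dV N i j = 0)]].

Section assembly.
Context {R : realType} {n r m : nat}.
Variables (f : R -> 'rV[R]_n -> 'rV[R]_r -> 'rV[R]_n) (U : set 'rV[R]_r).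
Variables (t1 t2 : R) (xh : R -> 'rV[R]_n).
Variables (C : R) (W Psi : R -> 'M[R]_n) (V : 'rV[R]_r -> R -> 'rV[R]_n).
Variables (v : 'I_m.+1 -> nat * nat * nat * 'rV[R]_r).
Hypothesis t12 : (t1 < t2) /\ True.
Hypothesis C1 : 1 <= C /\ True.
Hypothesis U0 : U !=set0.
Hypothesis xL : lip_on t1 t2 C xh.
Hypothesis hull : slopes_in_hull f U t1 t2 xh W.
Hypothesis PL : lip_on t1 t2 C Psi.
Hypothesis PB : forall t (z : 'rV[R]_n), t1 <= t -> t <= t2 -> `|z *m Psi t| <= C * `|z|.
Hypothesis HPsi : adjoint_increments t1 t2 W Psi.
Hypothesis HV : forall u, U u ->
  variation_increments t1 t2 xh Psi (fun t => f t (xh t) u) (V u).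
Hypothesis hv : forall j, variation_ok U (1 : R, v j).

Let xt := xh \o clamp t1 t2.
Let F := clipped f xt.
Let D := jac f xt.
Let T1 : R := t2 + 1.

Hypothesis HF : regular_field F U D t1 T1 C /\ True.
Hypothesis equiF : equicontinuous_field U t1 T1 F.

Let step (N : nat) : R := (t2 - t1) / 2 ^+ N.
Let vu j := (v j).2.

Definition active (N i : nat) (j : 'I_m.+1) : bool :=
  let: (p, a, b, _) := v j in (a * 2 ^ (N - p) <= i < b * 2 ^ (N - p))%N.

Definition increment (N i : nat) (j : 'I_m.+1) : 'rV[R]_n :=
  if active N i j then V (vu j) (ti t1 (step N) i.+1) - V (vu j) (ti t1 (step N) i) else 0.

Lemma step_gt0 N : 0 < step N. Proof. exact: dyadic_step. Qed.

Lemma stepM N : 2 ^+ N * step N = t2 - t1.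
Proof. by rewrite /step mulrC mulfVK// expf_neq0. Qed.

Lemma dyadic_refine p N a : (p <= N)%N ->
  dyadic t1 t2 p a = ti t1 (step N) (a * 2 ^ (N - p)).
Proof.
move=> pN; rewrite /dyadic /ti; congr (_ + _).
rewrite natrM natrX -mulrA; congr (_ * _).
have -> : step N = (t2 - t1) / (2 ^+ (N - p) * 2 ^+ p) by rewrite -exprD subnK.
by field; rewrite !expf_neq0.
Qed.

Lemma increment_sum N M j : ((v j).1.1.1 <= N)%N ->
  ((v j).1.2 * 2 ^ (N - (v j).1.1.1) <= M)%N ->
  \sum_(i < M) increment N i j = effect t1 t2 V (1, v j).
Proof.
have := hv j; rewrite /increment /active /vu /effect; case: (v j) => [[[p a] b] u] /=.
move=> [_ _ ab _] pN bM.
rewrite (sum_window (fun i => V u (ti t1 (step N) i))) ?leq_pmul2r ?expn_gt0//.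
by rewrite !(@dyadic_refine p N).
Qed.

Lemma xt_id t : t1 <= t -> t <= t2 -> xt t = xh t.
Proof. by move=> h1 h2; rewrite /xt /= clamp_id. Qed.

Lemma clip_self (x : 'rV[R]_n) : clip x x = x.
Proof. by apply: clip_id; rewrite subrr normr0. Qed.

Lemma xt_lip a b : lip_on a b C xt.
Proof. by apply: lip_clamp => //; have [C1' _] := C1; exact: le_trans C1'. Qed.

(** Each estimate is a property of small increments applied to the ends of a cell; finitely many
    controls [vu j] occur, so one threshold for the mesh serves for all of them. *)
Lemma grid_cells (eta : R) : 0 < eta -> grid_data F U xt D t1 T1 step C W Psi vu active increment eta.
Proof.
move=> eta0; have [t12' _] := t12; have [C1' _] := C1.
have C0 : 0 <= C by exact: le_trans C1'.
have n0 : 0 < n%:R + 1 :> R by rewrite ltr_wpDl.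
(* The divisor pays for the factor [n] in the norm of a matrix product. *)
pose e1 := eta / (n%:R + 1); have e10 : 0 < e1 by rewrite divr_gt0.
have e1E : e1 * (n%:R + 1) = eta by rewrite mulfVK// gt_eqF.
clearbody e1.
have e1eta : e1 <= eta.
  by rewrite -e1E ler_peMr ?(ltW e10)// lerDr.
have [d1 d10 Hd1] := hull e10.
have [d2 d20 Hd2] := HPsi e10.
have e20 : 0 < eta / 2 by rewrite divr_gt0.
have /choice[d3 Hd3] : forall j, exists d : R, 0 < d /\ forall a b,
      t1 <= a -> a <= b -> b <= t2 -> b - a < d ->
      `|V (vu j) b - V (vu j) a - ((b - a) *: f a (xh a) (vu j) - (xh b - xh a)) *m Psi a| <= eta / 2 * (b - a).
  move=> j; have Uj : U (vu j) by have := hv j; rewrite /vu; case: (v j) => [[[p a] b] u] [].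
  by have [d d0 Hd] := HV Uj e20; exists d.
have [d4 d40 Hd4] := equiF eta0.
have [w w0 Hw] : exists2 w : R, 0 < w & forall h : R, 0 < h -> h <= w ->
    [/\ h <= d1, h < d2, forall j, h < d3 j, h < d4 /\ C * h < d4 & 2 * n%:R * C ^+ 2 * h <= eta / 2].
  have [|w w0 Hw] := @small_all R ([:: (1, d1); (1, d2 / 2); (1, d4 / 2); (C, d4 / 2);
     (2 * n%:R * C ^+ 2, eta / 2)] ++ [seq (1, d3 j / 2) | j <- enum 'I_m.+1]).
    move=> p; rewrite mem_cat !inE => /orP[/or4P[/eqP->|/eqP->|/eqP->|/orP[]/eqP->]|/mapP[j _ ->]] //=; rewrite ?divr_gt0//.
    by have [] := Hd3 j.
  exists w => // h h0 hw; have {}Hw := Hw h h0 hw.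
  have q1 := Hw (1, d1); have q2 := Hw (1, d2 / 2); have q3 := Hw (1, d4 / 2).
  have q4 := Hw (C, d4 / 2); have q5 := Hw (2 * n%:R * C ^+ 2, eta / 2).
  rewrite !inE !eqxx /= ?orbT in q1 q2 q3 q4 q5.
  have {}q1 := q1 isT; have {}q2 := q2 isT; have {}q3 := q3 isT.
  have {}q4 := q4 isT; have {}q5 := q5 isT.
  split.
  - by move: q1; hclear; lra.
  - by move: q2 d20; hclear; lra.
  - move=> j; have := Hw (1, d3 j / 2); rewrite mem_cat map_f ?mem_enum ?orbT// => /(_ isT) /=.
    by have [d30 _] := Hd3 j; move: d30; hclear; lra.
  - by split; move: q3 q4 d40; hclear; lra.
  - exact: q5.
exists w => // N hw; have [q1 q2 q3 [q4 q4'] q5] := Hw _ (step_gt0 N) hw.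
have h0 := step_gt0 N; set h := step N in hw q1 q2 q3 q4 q4' q5 h0 *.
have tE i : ti t1 h i.+1 - ti t1 h i = h.
  by rewrite /ti -natr1; move: (i%:R) => a; hclear; ring.
have tge i : t1 <= ti t1 h i by rewrite /ti lerDl mulr_ge0// ltW.
have tle i : (i <= 2 ^ N)%N -> ti t1 h i <= t2.
  move=> iN; rewrite /ti -lerBrDl -(stepM N) -/h ler_pM2r// -natrX ler_nat//.
have tlt i : ti t1 h i < ti t1 h i.+1 by rewrite -subr_gt0 tE.
have [u0 Uu0] := U0.
have /choice[pw Hpw] : forall i, exists s : seq (R * 'rV[R]_r), weights U s /\
   ((i < 2 ^ N)%N -> let a := ti t1 h i in let b := ti t1 h i.+1 in
      `|\sum_(p <- s) p.1 *: f a (xh a) p.2 - (b - a)^-1 *: (xh b - xh a)| <= e1 /\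
      `|\sum_(p <- s) p.1 *: fx f a (xh a) p.2 - (b - a)^-1 *: (W b - W a)| <= e1).
  move=> i; have [iN|iN] := boolP (i < 2 ^ N)%N; last first.
    exists [:: (1, u0)]; split => //; split; last by rewrite big_seq1.
    by move=> x; rewrite inE => /eqP->.
  have [|s [sw s1 s2]] := Hd1 _ _ (tge i) (tlt i) (tle _ iN); first by rewrite tE.
  by exists s.
exists pw; split.
- by move=> i; have [] := Hpw i.
- move=> s t u s1 s2 s3 s4 s5 Uu; apply: Hd4 => //; first exact: le_lt_trans q4.
  apply: le_lt_trans q4'.
  have H a b : a <= b -> `|b - a| <= h -> `|xt b - xt a| <= C * h.
    move=> ab abh; apply: (le_trans (xt_lip (lexx a) ab (lexx b))).
    by rewrite ler_wpM2l// (le_trans (ler_norm _) abh).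
  have [st|ts] := leP s t; first exact: H.
  by rewrite distrC; apply: H; [exact: ltW|rewrite distrC].
move=> /= i iN; have [sw /(_ iN) /=] := Hpw i.
rewrite !tE; set a := ti t1 h i; set b := ti t1 h i.+1 => -[s1 s2].
have ta : t1 <= a := tge i; have tb : t1 <= b := tge i.+1.
have bt : b <= t2 := tle _ iN; have ab : a <= b := ltW (tlt i).
have at2 := le_trans ab bt.
have baE : b - a = h := tE i.
have Fa u : F a (xt a) u = f a (xh a) u by rewrite /F /clipped clip_self xt_id.
have Fa' u : F a (xh a) u = f a (xh a) u by rewrite -[in LHS](xt_id ta at2) Fa.
have incE j : active N i j -> increment N i j = V (vu j) b - V (vu j) a.
  by rewrite /increment => ->.
have inc0 j : ~~ active N i j -> increment N i j = 0 by rewrite /increment => /negbTE->.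
rewrite !(xt_id ta at2) !(xt_id tb bt).
have hK p q (A : 'M[R]_(p, q)) : h *: (h^-1 *: A) = A by rewrite scalerA mulfV ?scale1r// gt_eqF.
clearbody a b.
split.
- under eq_bigr do rewrite Fa'.
  rewrite -(hK _ _ (xh b - xh a)) -scalerBr normrZ gtr0_norm// mulrC ler_pM2r//.
  exact: le_trans e1eta.
- move=> z; rewrite /D /jac (xt_id ta at2).
  have -> : \sum_(p <- pw i) p.1 *: (z *m fx f a (xh a) p.2) = z *m \sum_(p <- pw i) p.1 *: fx f a (xh a) p.2.
    by rewrite mulmx_sumr; apply: eq_bigr => p _; rewrite scalemxAr.
  rewrite scalemxAr -mulmxBr -(hK _ _ (W b - W a)) -scalerBr -scalemxAr normrZ gtr0_norm//.
  rewrite mulrC mulrAC ler_pM2r//; apply: (le_trans (mulmx_norm_le _ _)).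
  have : n%:R * `|z| * e1 <= eta * `|z|.
    rewrite -e1E mulrAC ler_wpM2r// mulrC ler_pM2l// lerDl//.
  apply: le_trans; apply: ler_wpM2l => //; by rewrite mulr_ge0.
- move=> z; rewrite mulmxDl -mulmxA opprD addrA -!mulmxBr.
  apply: (le_trans (mulmx_norm_le _ _)).
  have hh := Hd2 a b ta ab bt; rewrite baE in hh; have {}hh := hh q2.
  apply: (@le_trans _ _ (n%:R * `|z| * (e1 * h))).
    by apply: ler_wpM2l => //; rewrite mulr_ge0.
  have -> : eta * h * `|z| = (eta * `|z|) * h by ring.
  rewrite mulrA ler_wpM2r ?(ltW h0)// -e1E mulrAC ler_wpM2r// mulrC ler_pM2l// lerDl//.
- by move=> z; exact: PB.
move=> j; split => [aj|]; last exact: inc0.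
rewrite (incE j aj) Fa'.
have [_ Hd3j] := Hd3 j; have := Hd3j a b ta ab bt; rewrite baE => /(_ (q3 j)).
set X := h *: f a (xh a) (vu j) - _; set dVV := V _ _ - _ => hh.
have Uj : U (vu j) by have := hv j; rewrite /vu; case: (v j) => [[[p a'] b'] u] [].
have Xn : `|X| <= 2 * C * h.
  apply: (le_trans (ler_normB _ _)).
  have g1 := xL ta ab bt; rewrite baE in g1.
  have g2 : `|f a (xh a) (vu j)| <= C.
    have [[_ FC _ _] _] := HF; have := FC a (xt a) (vu j) ta; rewrite Fa; apply => //.
    by rewrite (le_trans at2)// lerDl.
  have g3 : h * `|f a (xh a) (vu j)| <= h * C by rewrite ler_wpM2l// ltW.
  by rewrite normrZ gtr0_norm//; move: g1 g3; hclear; lra.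
clearbody X dVV.
(* [variation_increments] has [Psi] at the left end, the cell estimate at the right end; the
   discrepancy is of second order in [h]. *)
have -> : X *m Psi b - dVV = X *m (Psi b - Psi a) - (dVV - X *m Psi a).
  by rewrite mulmxBr opprB addrA subrK.
apply: (le_trans (ler_normB _ _)).
have g4 : `|X *m (Psi b - Psi a)| <= n%:R * (2 * C * h) * (C * h).
  apply: (le_trans (mulmx_norm_le _ _)); apply: ler_pM; rewrite ?mulr_ge0//.
    by rewrite ler_wpM2l.
  by apply: (le_trans (PL ta ab bt)); rewrite baE.
apply: (le_trans (lerD g4 hh)).
have : 2 * n%:R * C ^+ 2 * h * h <= eta / 2 * h by rewrite ler_pM2r.
by rewrite expr2; hclear; lra.
Qed.

End assembly.

(** * Controls on a grid followed by a tail *)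

Section schedule.
Context {R : realType} {n r m : nat}.
Variables (F : R -> 'rV[R]_n -> 'rV[R]_r -> 'rV[R]_n) (U : set 'rV[R]_r).
Variables (xt : R -> 'rV[R]_n) (D : R -> 'rV[R]_r -> 'M[R]_n) (t1 T1 C : R).
Variables (h h0 : R) (pw : nat -> seq (R * 'rV[R]_r)) (pwT : seq (R * 'rV[R]_r)).
Variables (vu : 'I_m.+1 -> 'rV[R]_r) (act : nat -> 'I_m.+1 -> bool) (M : nat).

Hypothesis HF : regular_field F U D t1 T1 C /\ True.
Hypothesis equiF : equicontinuous_field U t1 T1 F.
Hypothesis xtL : forall a b, lip_on a b C xt.
Hypothesis Hpw : (0 < h /\ True) /\ forall i, weights U (pw i).
Hypothesis Hvu : forall j, U (vu j).
Hypothesis HT : [/\ weights U pwT, 0 < h0, h <= h0 & ti t1 h M + h0 <= T1].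

Let tM : R := ti t1 h M.

(** The variation control of a piece equals its base control, so the intensities do not influence
    the velocities; [ord0] is an arbitrary index. The tail either runs after [t2] or fills the time
    from the hitting of the target to [t2]. *)
Definition tailP : seq (@piece R r 'I_m.+1) :=
  [seq (h0 * p.1, (p.2, p.2, ord0)) | p <- pwT].

Definition schedule g := needles g (gridP h pw vu act M ++ tailP).

Lemma tailP_ok : pieces_ok U tailP.
Proof.
have [[s1 _] h00 _ _] := HT; rewrite /tailP.
elim: pwT s1 => [//|p s IH] s1 /=; split.
  by have [p0 Up] := s1 p (mem_head _ _); split => //; rewrite mulr_gt0.
by apply: IH => q qs; apply: s1; rewrite inE qs orbT.
Qed.

Lemma tot_tailP : tot tailP = h0.
Proof.
have [[_ s1] _ _ _] := HT.
by rewrite /tot /tailP big_map -mulr_sumr s1 mulr1.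
Qed.

Lemma schedule_ok : pieces_ok U (gridP h pw vu act M ++ tailP).
Proof. by apply: pieces_ok_cat; [exact: gridP_ok|exact: tailP_ok]. Qed.

Lemma tot_schedule g : tot (schedule g) = tM + h0 - t1.
Proof.
rewrite /schedule tot_needles tot_cat (tot_gridP _ _ Hpw) tot_tailP /tM /ti.
by ring.
Qed.

Lemma schedule_exists g x0 : (forall j, 0 < g j < 1) ->
  exists x, [/\ x t1 = x0, forall b, lip_on t1 b C x & follows F (schedule g) t1 x].
Proof.
move=> g01; have [[C1 FC _ _] _] := HF; have [_ _ _ hT] := HT.
apply: (follows_exists (U := U) (t1 := t1) (T1 := T1)).
- by split => //; exact: le_trans C1.
- exact: equiF.
- apply: steps_in_needles => //; exact: schedule_ok.
- exact: lexx.
- by rewrite tot_schedule; move: hT; rewrite -/tM; hclear; lra.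
Qed.

Lemma schedule_split g x : follows F (schedule g) t1 x ->
  follows F (needles g (gridP h pw vu act M)) t1 x /\ follows F (needles g tailP) tM x.
Proof.
by rewrite /schedule needles_cat => /follows_cat; rewrite tot_needles (tot_gridP _ _ Hpw).
Qed.

Lemma schedule_close (k cb eta : R) (g : 'I_m.+1 -> R) (x : R -> 'rV[R]_n) :
  0 <= k -> 0 <= eta -> cb <= 1 -> (forall j, 0 < g j <= cb) ->
  (forall b, lip_on t1 b C x) -> x t1 = xt t1 -> follows F (schedule g) t1 x ->
  (forall s t u, t1 <= s -> s <= T1 -> t1 <= t -> t <= T1 -> `|t - s| <= h -> U u ->
     `|F t (xt t) u - F s (xt s) u| <= k) ->
  (forall i, (i < M)%N ->
    `|h *: (\sum_(p <- pw i) p.1 *: F (ti t1 h i) (xt (ti t1 h i)) p.2) -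
      (xt (ti t1 h i.+1) - xt (ti t1 h i))| <= eta * h) ->
  let e := expR (C * (T1 - t1)) * (T1 - t1) * (k + 2 * C ^+ 2 * h + 2 * C * cb + eta) in
  `|x tM - xt tM| <= e /\
  forall t, t1 <= t -> t <= tM + h0 -> `|x t - xt t| <= e + 2 * C * h0.
Proof.
move=> k0 eta0 cb1 gcb lx x0 /schedule_split[fx _] Hk Hf e.
have [_ h00 hh0 hT] := HT; have [[hp _] _] := Hpw; have [[C1 _ _ _] _] := HF.
have C0 : 0 <= C by exact: le_trans C1.
have tMT : ti t1 h M <= T1 by apply: le_trans hT; rewrite lerDl ltW.
have H := grid_close HF Hpw Hvu k0 eta0 cb1 tMT gcb (lx _) (@xtL _ _) x0 fx Hk Hf.
split; first exact: H.
move=> t tt ttM.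
have near i : (i <= M)%N -> ti t1 h i <= t -> t <= ti t1 h i + h0 -> `|x t - xt t| <= e + 2 * C * h0.
  move=> iM it ti0.
  have -> : x t - xt t = (x (ti t1 h i) - xt (ti t1 h i)) +
      ((x t - x (ti t1 h i)) - (xt t - xt (ti t1 h i))) by lmod R.
  apply: (le_trans (ler_normD _ _)); apply: lerD; first exact: H.
  apply: (le_trans (ler_normB _ _)).
  have h1 := lx t _ _ (ti_ge t1 Hpw i) it (lexx t).
  have h2 := xtL (lexx (ti t1 h i)) it (lexx t).
  have h3 : C * (t - ti t1 h i) <= C * h0 by rewrite ler_wpM2l//; move: ti0; hclear; lra.
  by move: h1 h2 h3; hclear; lra.
have [tl|lt] := leP (ti t1 h M) t; first exact: (near M).
have : 0 <= (t - t1) / h by rewrite divr_ge0 ?subr_ge0// ltW.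
move=> /truncn_itv; set i := Num.truncn _ => /andP[].
rewrite ler_pdivlMr// ltr_pdivrMr// => i1 i2.
have it : ti t1 h i <= t by rewrite /ti; move: i1; hclear; lra.
have ti1 : t <= ti t1 h i + h.
  by move: i2; rewrite /ti -natr1 mulrDl mul1r; hclear; lra.
have iM : (i <= M)%N.
  have : i%:R * h < M%:R * h by move: lt i1; rewrite /ti; hclear; lra.
  by rewrite ltr_pM2r// ltr_nat => /ltnW.
apply: (near i iM it); apply: (le_trans ti1); by rewrite lerD2l.
Qed.

Lemma schedule_tail_diff (k d cb de : R) (g g' : 'I_m.+1 -> R) (x x' : R -> 'rV[R]_n) :
  approx_field F U xt D t1 T1 k d -> 0 <= k -> 40 * C ^+ 2 * h0 <= 1 -> cb <= 1 ->
  (forall j, 0 < g j <= cb) -> (forall j, 0 < g' j <= cb) ->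
  (forall j, `|g j - g' j| <= de) -> 0 <= de ->
  (forall b, lip_on t1 b C x) -> (forall b, lip_on t1 b C x') ->
  follows F (schedule g) t1 x -> follows F (schedule g') t1 x' ->
  (forall t, tM <= t -> t <= tM + h0 ->
     [/\ `|t - tM| < d, `|x t - xt tM| < d & `|x' t - xt tM| < d]) ->
  `|x (tM + h0) - x' (tM + h0) - (x tM - x' tM)| <=
    40 * C ^+ 2 * h0 * (`|x tM - x' tM| + de).
Proof.
move=> A k0 Ch cb1 gcb g'cb gde de0 lx lx' fg fg' reg.
have [_ fx] := schedule_split fg; have [_ fx'] := schedule_split fg'.
have [_ h00 hh0 hT] := HT; have [[C1 _ _ _] _] := HF.
have C0 : 0 <= C by exact: le_trans C1.
have tMT : tM <= T1 by apply: le_trans hT; rewrite lerDl ltW.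
have t1M := ti_ge t1 Hpw M.
have := @cell_diff R n r 'I_m.+1 F U xt D t1 T1 C HF k d tM tM h0 cb de g g' x x' C A k0 t1M tMT t1M hT
  Ch cb1 C0 gcb g'cb gde de0 reg (lip_onW t1M (lexx _) (lx _)) (lip_onW t1M (lexx _) (lx' _)).
cbv zeta => /(_ tailP tM (lexx _)).
rewrite tot_tailP => /(_ (lexx _) tailP_ok fx fx').
by rewrite !subrr normr0 mulr0 mul0r => /(_ (lexx _))[].
Qed.

Lemma schedule_tail_close (k d cb : R) (g : 'I_m.+1 -> R) (x : R -> 'rV[R]_n) :
  approx_field F U xt D t1 T1 k d -> 0 <= k -> cb <= 1 -> (forall j, 0 < g j <= cb) ->
  (forall b, lip_on t1 b C x) -> follows F (schedule g) t1 x ->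
  (forall t, tM <= t -> t <= tM + h0 -> `|t - tM| < d /\ `|x t - xt tM| < d) ->
  `|x (tM + h0) - x tM - h0 *: \sum_(p <- pwT) p.1 *: F tM (xt tM) p.2| <=
    h0 * (k + 2 * C * cb).
Proof.
move=> A k0 cb1 gcb lx /schedule_split[_ fx] reg.
have [_ h00 hh0 hT] := HT; have [[C1 _ _ _] _] := HF.
have C0 : 0 <= C by exact: le_trans C1.
have tMT : tM <= T1 by apply: le_trans hT; rewrite lerDl ltW.
have t1M := ti_ge t1 Hpw M.
have := cell_close HF t1M tMT k0 C0 cb1 gcb tailP_ok.
rewrite tot_tailP => /(_ xt x tM (lip_onW t1M (lexx _) (lx _)) fx).
have -> : \sum_(p <- tailP) p.1 *: F tM (xt tM) p.2.1.1 = h0 *: \sum_(p <- pwT) p.1 *: F tM (xt tM) p.2.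
  by rewrite /tailP big_map scaler_sumr; apply: eq_bigr => p _; rewrite scalerA.
apply=> t u tt th Uu; have [r1 r2] := reg t tt th.
apply: (A.1 tM t (x t) u) => //; first exact: le_trans tt.
exact: le_trans hT.
Qed.

End schedule.

(** * Exact steering *)

Lemma dist_pos_le (R : realType) (a b c : R) :
  0 < a -> a <= c -> 0 < b -> b <= c -> `|a - b| <= c.
Proof. by move=> a0 ac b0 bc; rewrite ler_norml; apply/andP; split; lra. Qed.

Section steering.
Context {R : realType} {n r m : nat}.
Variables (F : R -> 'rV[R]_n -> 'rV[R]_r -> 'rV[R]_n) (U : set 'rV[R]_r).
Variables (xt : R -> 'rV[R]_n) (D : R -> 'rV[R]_r -> 'M[R]_n) (t1 t2 C : R).
Variables (W Psi : R -> 'M[R]_n) (vu : 'I_m.+1 -> 'rV[R]_r).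
Variables (act : nat -> nat -> 'I_m.+1 -> bool) (dV : nat -> nat -> 'I_m.+1 -> 'rV[R]_n).
Variables (eff : 'I_m.+1 -> 'rV[R]_n) (y : 'rV[R]_n) (sp : bool).
Variables (al : 'I_m.+1 -> 'rV[R]_n -> R) (rho K : R).

Let T1 : R := t2 + 1.
Let step (N : nat) : R := (t2 - t1) / 2 ^+ N.
Let sg : R := if sp then 1 else -1.
Let tau (h : R) : R := if sp then t2 + h else t2 - h.

(** When the target is to be hit before [t2], the grid stops there: the [2 ^ (N - P)] cells left out
    make up one step of level [P]. *)
Definition grid_size (P N : nat) : nat := if sp then (2 ^ N)%N else (2 ^ N - 2 ^ (N - P))%N.

Hypothesis t12 : (t1 < t2) /\ True.
Hypothesis HF : regular_field F U D t1 T1 C /\ True.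
Hypothesis equiF : equicontinuous_field U t1 T1 F.
Hypothesis approxF : forall k : R, 0 < k -> exists2 d : R, 0 < d & approx_field F U xt D t1 T1 k d.
Hypothesis xtL : forall a b, lip_on a b C xt.
Hypotheses (Psi2 : Psi t2 = 1%:M) (PL : lip_on t1 t2 C Psi).
Hypothesis Hvu : forall j, U (vu j).
Hypothesis cells : forall eta : R, 0 < eta -> 
  grid_data F U xt D t1 T1 step C W Psi vu act dV eta.
Hypothesis dVsum : exists P0, forall P N, (P0 <= P)%N -> (P <= N)%N -> forall j,
  \sum_(i < grid_size P N) dV N i j = eff j.
Hypothesis tails : forall s : R, 0 < s -> exists2 pwT, weights U pwT &
  `|\sum_(p <- pwT) p.1 *: F t2 (xt t2) p.2 - y| <= s.
Hypothesis slope : end_slope t1 t2 xt y.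
Hypothesis Hrho : (0 < rho /\ 0 < K) /\ True.
Hypothesis Hal1 : forall x, `|x| <= rho -> (forall j, 0 < al j x <= K) /\
        `|\sum_j al j x *: eff j - (- (sg *: y) + x)| <= rho / 8.
Hypothesis Hal2 : forall x x', (forall j, `|al j x - al j x'| <= K * `|x - x'|) /\
        `|\sum_j (al j x - al j x') *: eff j - (x - x')| <= `|x - x'| / 8.

Lemma grid_size_le P N : (grid_size P N <= 2 ^ N)%N.
Proof. by rewrite /grid_size; case: sp => //; exact: leq_subr. Qed.

Lemma ti_grid_size P N : (P <= N)%N ->
  ti t1 (step N) (grid_size P N) = if sp then t2 else t2 - step P.
Proof.
move=> PN; have sE k : 2 ^+ k * step k = t2 - t1 by rewrite /step mulrC mulfVK// expf_neq0.
rewrite /ti /grid_size; case: sp; first by rewrite natrX sE addrC subrK.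
rewrite natrB ?leq_pexp2l ?leq_subr// !natrX mulrBl sE.
have -> : 2 ^+ (N - P) * step N = step P.
  rewrite /step -{2}(subnK PN) exprD; field.
  by rewrite !expf_neq0.
by rewrite addrA addrC; ring.
Qed.

(** The displacement of the end time is [h0 = step P]. The level [P] is chosen so that errors in
    differences are at most small multiples of [sig * h0] times the distance of the parameters;
    [eta], [kap] and the level [N] come afterwards and bring the distance of a reference trajectory
    to [xt] below [sig * h0]. *)
Theorem steer (e : R) : 0 < e -> exists (l : seq (R * 'rV[R]_r)) (x : R -> 'rV[R]_n) (h0 : R),
  [/\ 0 < h0 /\ h0 < e,
      steps_in U l /\ t1 + tot l = Order.max t2 (tau h0),
      [/\ forall b, lip_on t1 b C x, x t1 = xt t1 & follows F l t1 x],
      forall t, t1 <= t -> t <= Order.max t2 (tau h0) -> `|x t - xt t| <= e &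
      x (tau h0) = xt t2].
Proof.
move=> e0; have [t12' _] := t12; have [[C1 _ _ _] _] := HF; have [[rho0 K0] _] := Hrho.
have C0 : 0 <= C by exact: le_trans C1.
have m0 : 0 < m.+1%:R :> R by rewrite ltr0n.
pose Ka : R := m.+1%:R * K; have Ka0 : 0 < Ka by rewrite mulr_gt0.
have T10 : 0 <= T1 - t1 by rewrite subr_ge0 (le_trans (ltW t12'))// lerDl.
pose Q := expR (40 * C ^+ 2 * (T1 - t1)); have Q0 : 0 <= Q by exact: expR_ge0.
pose G := expR (C * (T1 - t1)) * (T1 - t1).
have G0 : 0 <= G by rewrite mulr_ge0// expR_ge0.
pose K2 := 82 * C ^+ 4 * (T1 - t1) * Q.
have K20 : 0 <= K2 by rewrite !mulr_ge0// exprn_ge0.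
(* The budget: [10 * sig + rho / 8] has to fit into [rho / 2] for the starting error, and
   [6 * sig + 1 / 8] into the contraction constant [1 / 2]. *)
pose sig := Order.min 1 rho / 64.
have sig0 : 0 < sig by rewrite divr_gt0// lt_min ltr01.
have sig1 : 64 * sig <= 1 by rewrite mulrC divfK// ge_min lexx.
have sigr : 64 * sig <= rho by rewrite mulrC divfK// ge_min lexx orbT.
clearbody sig.
have [k k0 [kK ks]] : exists2 k : R, 0 < k & K2 * Ka * k <= sig /\ k <= sig.
  have [|w w0 Hw] := @small_all R [:: (K2 * Ka, sig); (1, sig)].
    by move=> p; rewrite !inE => /orP[]/eqP->.
  exists w => //; split; first by apply: (Hw w w0 (lexx _) (K2 * Ka, sig)); rewrite !inE eqxx.
  by rewrite -[w]mul1r; apply: (Hw w w0 (lexx _) (1, sig)); rewrite !inE eqxx orbT.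
have [d d0 A] := approxF k0.
pose e' := Order.min e d / 4.
have e'0 : 0 < e' by rewrite divr_gt0// lt_min e0.
have e'e : e' <= e.
  have : Order.min e d <= e by rewrite ge_min lexx.
  by rewrite /e'; move: e0; hclear; move: (Order.min e d) => z; lra.
have e'd : 4 * e' <= d.
  have : Order.min e d <= d by rewrite ge_min lexx orbT.
  by rewrite /e'; hclear; move: (Order.min e d) => z; lra.
clearbody e'.
have e'4 : 0 < e' / 4 by rewrite divr_gt0.
have d4 : 0 < d / 4 by rewrite divr_gt0.
have nQ : 0 <= n%:R * Q * Ka * C by rewrite !mulr_ge0// ltW.
have [w0 w00 Hw0] : exists2 w : R, 0 < w & forall h : R, 0 < h -> h <= w ->
    [/\ h <= d / 4, h <= e / 2, h <= 1 & Ka * h <= 1 / 2] /\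
    [/\ K2 * Ka * (Ka * h) <= sig, 2 * C * (Ka * h) <= sig, n%:R * Q * Ka * C * h <= sig,
        40 * C ^+ 2 * h <= 1 & 40 * C ^+ 2 * (Q + 1) * Ka * h <= sig] /\
    [/\ G * (2 * C * (Ka * h)) <= e' / 4, 2 * C * h <= e' / 4 & C * h <= d / 4].
  have [|w w0 Hw] := @small_all R [:: (1, d / 4); (1, e / 2); (1, 1); (Ka, 1 / 2);
     (K2 * Ka * Ka, sig); (2 * C * Ka, sig); (n%:R * Q * Ka * C, sig); (40 * C ^+ 2, 1);
     (40 * C ^+ 2 * (Q + 1) * Ka, sig); (G * (2 * C * Ka), e' / 4); (2 * C, e' / 4); (C, d / 4)].
    by apply/allP => /=; rewrite !ltr01 !divr_gt0// sig0.
  exists w => // h h0 hw; have {Hw} := Hw h h0 hw.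
  move=> /allP /= /and5P[q1 q2 q3 q4 /and5P[q5 q6 q7 q8 /and5P[q9 q10 q11 q12 _]]].
  move: q1 q2 q3 q4 q5 q6 q7 q8 q9 q10 q11 q12; rewrite !mul1r !mulrA; hclear => *.
  by split; [|split].
have [p0 Hp0] := dyadic_step_lim t12 w00.
have [P0 HP0] := dVsum.
have [P PP slP] := slope (maxn p0 P0) sig0.
rewrite geq_max in PP; case/andP: PP => p0P P0P.
have h00 : 0 < step P by exact: dyadic_step.
have [[h0d h0e h01 h0K] [[a5 a6 a7 a8 a9] [a10 a11 a12]]] := Hw0 _ h00 (ltW (Hp0 _ p0P)).
have {}slP : `|(step P)^-1 *: (xt t2 - xt (t2 - step P)) - y| <= sig := slP.
set h0 := step P in slP h00 h0d h0e h01 h0K a5 a6 a7 a8 a9 a10 a11 a12.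
(* Common bound of the intensities [gam], which are [m.+1%:R * h0] times coefficients bounded by
   [K]. *)
pose cb := Ka * h0; have cb0 : 0 < cb by rewrite mulr_gt0.
rewrite -/cb in h0K a5 a6 a10.
have cb1 : cb <= 1 by move: h0K; hclear; lra.
pose S := \sum_j `|eff j|; have S0 : 0 <= S by apply: sumr_ge0.
have sh0 : 0 < sig * h0 / 3 by rewrite divr_gt0// mulr_gt0.
have [eta eta0 [b1 b2 b3]] : exists2 eta : R, 0 < eta &
    [/\ G * (2 * eta) <= e' / 4, K2 * Ka * eta <= sig & G * (2 * eta) <= sig * h0 / 3].
  have [|w wp Hw] := @small_all R [:: (2 * G, e' / 4); (K2 * Ka, sig); (2 * G, sig * h0 / 3)].
    by apply/allP => /=; rewrite e'4 sig0 sh0.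
  have {Hw} := Hw w wp (lexx _) => /allP /= /and4P[q1 q2 q3 _].
  by exists w => //; split => //; rewrite mulrA [G * 2]mulrC.
(* Intensities of order [h0] keep the trajectory within order [h0] of [xt], which is not enough. The
   constant family [kap], chosen after [h0], gives a reference trajectory within [sig * h0], and the
   other families are compared with it by [diff]. *)
have [kap kap0 [c1 c2 c3]] : exists2 kap : R, 0 < kap &
    [/\ G * (2 * C * kap) <= sig * h0 / 3, S * kap <= sig * h0 & kap <= cb].
  have [|w wp Hw] := @small_all R [:: (G * (2 * C), sig * h0 / 3); (S, sig * h0); (1, cb)].
    by apply/allP => /=; rewrite sh0 cb0 mulr_gt0.
  have {Hw} := Hw w wp (lexx _) => /allP /= /and4P[q1 q2 q3 _].
  by exists w => //; split => //; [rewrite mulrA|rewrite -[w]mul1r].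
have [wc wc0 Hwc] := cells eta0.
have [wh wh0 Hwh] : exists2 w : R, 0 < w & forall h : R, 0 < h -> h <= w ->
    [/\ G * (2 * C ^+ 2 * h) <= e' / 4, K2 * Ka * h <= sig, G * (2 * C ^+ 2 * h) <= sig * h0 / 3,
      40 * C ^+ 2 * h <= 1 & h <= d / 4] /\ C * h <= d / 4 /\ h <= wc.
  have [|w wp Hw] := @small_all R [:: (G * (2 * C ^+ 2), e' / 4); (K2 * Ka, sig);
     (G * (2 * C ^+ 2), sig * h0 / 3); (40 * C ^+ 2, 1); (1, d / 4); (C, d / 4); (1, wc)].
    by apply/allP => /=; rewrite e'4 sig0 sh0 ltr01 d4 wc0.
  exists w => // h hp hw; have {Hw} := Hw h hp hw.
  move=> /allP /= /and5P[q1 q2 q3 q4 /and4P[q5 q6 q7 _]].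
  move: q1 q2 q3 q4 q5 q6 q7; rewrite !mul1r !mulrA; hclear => *.
  by split; [|split].
have [p1 Hp1] := dyadic_step_lim t12 wh0.
pose N := maxn P p1; have PN : (P <= N)%N by rewrite leq_maxl.
have hp : 0 < step N by exact: dyadic_step.
have [[f1 f2 f3 f4 f5] [f6 f7]] := Hwh _ hp (ltW (Hp1 N (leq_maxr _ _))).
have hh0 : step N <= h0.
  rewrite /h0 /step ler_wpM2l ?subr_ge0 ?(ltW t12')// lef_pV2 ?posrE ?exprn_gt0//.
  by rewrite ler_weXn2l// ler1n.
have [pw [Hpw0 Hmod Hcells]] := Hwc N f7.
have [pwT wT HpT] := tails sig0.
set h := step N in hp f1 f2 f3 f4 f5 f6 f7 hh0 Hmod Hcells.
have Hpw : (0 < h /\ True) /\ forall i, weights U (pw i) by [].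
pose M := grid_size P N.
have MN : (M <= 2 ^ N)%N := grid_size_le P N.
pose tM : R := if sp then t2 else t2 - h0.
have tME : ti t1 h M = tM by exact: ti_grid_size.
have tM2 : tM <= t2 by rewrite /tM; case: sp => //; rewrite gerBl ltW.
have tM1 : t1 <= tM by rewrite -tME; exact: (ti_ge t1 Hpw).
have tMd : t2 - tM <= h0 by rewrite /tM; case: sp; rewrite ?subrr ?(ltW h00)// subKr.
have tMT : Order.max t2 (tau h0) = tM + h0.
  rewrite /tau /tM; case: sp; first by apply/max_idPr; rewrite lerDl ltW.
  by rewrite subrK; apply/max_idPl; rewrite gerBl ltW.
have HT : [/\ weights U pwT, 0 < h0, h <= h0 & ti t1 h M + h0 <= T1].
  by split => //; rewrite tME /T1 lerD.
have dVM j : \sum_(i < M) dV N i j = eff j by exact: HP0.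
have okg (g : 'I_m.+1 -> R) : (forall j, 0 < g j <= cb) -> forall j, 0 < g j < 1.
  move=> gcb j; have /andP[-> g2] := gcb j; move: h0K g2; hclear; lra.
pose sch g := schedule h h0 pw pwT vu (act N) M g.
have /choice[X HX] : forall g : 'I_m.+1 -> R, exists x : R -> 'rV[R]_n, (forall j, 0 < g j <= cb) ->
   [/\ x t1 = xt t1, forall b, lip_on t1 b C x & follows F (sch g) t1 x].
  move=> g; have [gcb|ng] := pselect (forall j, 0 < g j <= cb); last by exists xt => /ng.
  have [x hx] := schedule_exists (act N) HF equiF Hpw Hvu HT (xt t1) (okg g gcb).
  by exists x.
have Hcl i : (i < M)%N -> `|h *: (\sum_(p <- pw i) p.1 *: F (ti t1 h i) (xt (ti t1 h i)) p.2) -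
      (xt (ti t1 h i.+1) - xt (ti t1 h i))| <= eta * h.
  by move=> iM; have [] := Hcells i (leq_trans iM MN).
have close g : (forall j, 0 < g j <= cb) -> forall t, t1 <= t -> t <= tM + h0 -> `|X g t - xt t| <= e'.
  move=> gcb t tt ttM; have [x1 xl fx] := HX g gcb.
  have [_ H] := schedule_close HF xtL Hpw Hvu HT (ltW eta0) (ltW eta0) cb1 gcb xl x1 fx Hmod Hcl.
  rewrite tME in H; apply: (le_trans (H t tt ttM)); rewrite -/G.
  by move: b1 f1 a10 a11; hclear; lra.
have t1i i : t1 <= ti t1 h i by exact: (ti_ge t1 Hpw).
have tiM i : (i <= M)%N -> ti t1 h i <= tM by move=> iM; rewrite -tME; exact: (ti_le t1 Hpw).
have regx g i t : (forall j, 0 < g j <= cb) -> (i < M)%N -> ti t1 h i <= t -> t <= ti t1 h i.+1 ->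
    `|t - ti t1 h i| < d /\ `|X g t - xt (ti t1 h i)| < d.
  move=> gcb iM it ti1.
  have th : t - ti t1 h i <= h by move: ti1; rewrite tiS; hclear; lra.
  split; first by rewrite ger0_norm ?subr_ge0//; move: th f5 d0; hclear; lra.
  have -> : X g t - xt (ti t1 h i) = (X g t - xt t) + (xt t - xt (ti t1 h i)) by lmod R.
  apply: (le_lt_trans (ler_normD _ _)).
  have q1 : `|X g t - xt t| <= e'.
    apply: close => //; first exact: le_trans it.
    by apply: (le_trans (le_trans ti1 (tiM _ iM))); rewrite lerDl ltW.
  have q2 := xtL (lexx (ti t1 h i)) it (lexx t).
  have q3 : C * (t - ti t1 h i) <= C * h by rewrite ler_wpM2l.
  by move: q1 q2 q3 f6 e'd d0; hclear; lra.
have regT g t : (forall j, 0 < g j <= cb) -> tM <= t -> t <= tM + h0 ->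
    `|t - tM| < d /\ `|X g t - xt tM| < d.
  move=> gcb tt ti1.
  have th : t - tM <= h0 by move: ti1; hclear; lra.
  split; first by rewrite ger0_norm ?subr_ge0//; move: th h0d d0; hclear; lra.
  have -> : X g t - xt tM = (X g t - xt t) + (xt t - xt tM) by lmod R.
  apply: (le_lt_trans (ler_normD _ _)).
  have q1 : `|X g t - xt t| <= e' by apply: close => //; exact: le_trans tt.
  have q2 := xtL (lexx tM) tt (lexx t).
  have q3 : C * (t - tM) <= C * h0 by rewrite ler_wpM2l.
  by move: q1 q2 q3 a12 e'd d0; hclear; lra.
have tMT1 : ti t1 h M <= T1 by rewrite tME (le_trans tM2)// lerDl.
have diff g g' de : (forall j, 0 < g j <= cb) -> (forall j, 0 < g' j <= cb) -> 0 <= de ->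
    (forall j, `|g j - g' j| <= Ka * h0 * de) ->
    `|X g tM - X g' tM - \sum_j ((g j - g' j) / m.+1%:R) *: eff j| <= 5 * sig * h0 * de /\
    `|X g (tM + h0) - X g' (tM + h0) - (X g tM - X g' tM)| <= sig * h0 * de.
  move=> gcb g'cb de0 gde.
  have [x1 xl fx] := HX g gcb; have [x1' xl' fx'] := HX g' g'cb.
  have de0' : 0 <= Ka * h0 * de by apply: mulr_ge0 => //; exact: (ltW cb0).
  have fg := (schedule_split Hpw fx).1.
  have fg' := (schedule_split Hpw fx').1.
  have HC i : (i < M)%N -> _ := fun iM => Hcells i (leq_trans iM MN).
  have x11 : X g t1 = X g' t1 by rewrite x1 x1'.
  have reg i t : (i < M)%N -> ti t1 h i <= t -> t <= ti t1 h i.+1 ->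
     [/\ `|t - ti t1 h i| < d, `|X g t - xt (ti t1 h i)| < d & `|X g' t - xt (ti t1 h i)| < d].
    by move=> iM q1 q2; have [? ?] := regx g i t gcb iM q1 q2; have [? ?] := regx g' i t g'cb iM q1 q2.
  have [z1 z2] := grid_diff HF Hpw Hvu A (ltW k0) (ltW eta0) tMT1 f4 cb1 gcb g'cb gde de0'
     (xl _) (xl' _) x11 fg fg' reg HC.
  rewrite -/Q in z1 z2.
  have {}z1 := z1 M (leqnn _); rewrite tME in z1 z2.
  have sE : \sum_j ((g j - g' j) / m.+1%:R) *: (\sum_(i < M) dV N i j) =
     \sum_j ((g j - g' j) / m.+1%:R) *: eff j by apply: eq_bigr => j _; rewrite dVM.
  rewrite sE in z2; set Sg := \sum_j _ in z2 *; set z := X g tM - X g' tM in z1 z2 *.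
  have hd : 0 <= h0 * de by apply: mulr_ge0 => //; exact: ltW.
  split.
    have -> : z - Sg = (z *m Psi tM - Sg) + z *m (Psi t2 - Psi tM).
      by rewrite Psi2 mulmxBr mulmx1 [RHS]addrC subrKA.
    apply: (le_trans (ler_normD _ _)).
    have q1 : `|z *m (Psi t2 - Psi tM)| <= n%:R * (Q * (Ka * h0 * de)) * (C * h0).
      apply: (le_trans (mulmx_norm_le _ _)); apply: ler_pM; rewrite ?mulr_ge0//.
        by rewrite ler_wpM2l.
      by apply: (le_trans (PL tM1 tM2 (lexx _))); rewrite ler_wpM2l.
    have q2 : n%:R * Q * Ka * C * h0 * (h0 * de) <= sig * (h0 * de) by rewrite ler_wpM2r.
    have q3 : K2 * Ka * k * (h0 * de) <= sig * (h0 * de) by rewrite ler_wpM2r.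
    have q4 : K2 * Ka * h * (h0 * de) <= sig * (h0 * de) by rewrite ler_wpM2r.
    have q5 : K2 * Ka * cb * (h0 * de) <= sig * (h0 * de) by rewrite ler_wpM2r.
    have q6 : K2 * Ka * eta * (h0 * de) <= sig * (h0 * de) by rewrite ler_wpM2r.
    have q7 : 82 * C ^+ 4 * (T1 - t1) * Q * (k + h + cb + eta) * (Ka * h0 * de) =
       K2 * Ka * k * (h0 * de) + K2 * Ka * h * (h0 * de) + K2 * Ka * cb * (h0 * de) + K2 * Ka * eta * (h0 * de).
      by rewrite /K2; ring.
    have q8 : n%:R * (Q * (Ka * h0 * de)) * (C * h0) = n%:R * Q * Ka * C * h0 * (h0 * de) by ring.
    rewrite q7 in z2; rewrite q8 in q1.
    apply: (le_trans (lerD z2 q1)).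
    have -> : 5 * sig * h0 * de = 5 * (sig * (h0 * de)) by ring.
    by move: q2 q3 q4 q5 q6; hclear; lra.
  have regt t : tM <= t -> t <= tM + h0 ->
     [/\ `|t - tM| < d, `|X g t - xt tM| < d & `|X g' t - xt tM| < d].
    by move=> q1 q2; have [? ?] := regT g t gcb q1 q2; have [? ?] := regT g' t g'cb q1 q2.
  have := schedule_tail_diff HF Hpw HT A (ltW k0) a8 cb1 gcb g'cb gde de0' xl xl' fx fx'.
  rewrite tME => /(_ regt) H; apply: (le_trans H).
  apply: (@le_trans _ _ (40 * C ^+ 2 * h0 * (Q * (Ka * h0 * de) + Ka * h0 * de))).
    apply: ler_wpM2l; last by rewrite lerD2r.
    by apply: mulr_ge0; [apply: mulr_ge0 => //; exact: exprn_ge0|exact: ltW].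
  have -> : 40 * C ^+ 2 * h0 * (Q * (Ka * h0 * de) + Ka * h0 * de) =
     40 * C ^+ 2 * (Q + 1) * Ka * h0 * (h0 * de) by ring.
  by rewrite -[leRHS]mulrA ler_wpM2r.
(* The factor [m.+1%:R] compensates for the share of a cell given to each variation. *)
pose gam (xi : 'rV[R]_n) (j : 'I_m.+1) : R := m.+1%:R * h0 * al j xi.
have mh0 : 0 < m.+1%:R * h0 by rewrite mulr_gt0.
have gam_ok xi : `|xi| <= rho -> forall j, 0 < gam xi j <= cb.
  move=> xir j; have [/(_ j)/andP[al0 alK] _] := Hal1 xir.
  rewrite /gam mulr_gt0//= /cb /Ka.
  by rewrite [leRHS]mulrAC ler_wpM2l ?(ltW mh0).
have gamE xi : \sum_j (gam xi j / m.+1%:R) *: eff j = h0 *: \sum_j al j xi *: eff j.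
  rewrite scaler_sumr; apply: eq_bigr => j _; rewrite scalerA; congr (_ *: _).
  by rewrite /gam; field; rewrite gt_eqF.
have tauE : tau h0 = if sp then tM + h0 else tM by rewrite /tau /tM; case: sp.
pose E xi := X (gam xi) (tau h0).
have [||xi xir Exi] := @hit_target R n E (xt t2) rho h0 rho0 h00.
- have z0 : `|0 : 'rV[R]_n| <= rho by rewrite normr0 ltW.
  have g0 := gam_ok 0 z0.
  have kapok : 0 < kap <= cb by rewrite kap0.
  have [d1 d2] : `|X (gam 0) tM - X (fun=> kap) tM - \sum_j ((gam 0 j - kap) / m.+1%:R) *: eff j| <= 5 * sig * h0 * 1 /\
    `|X (gam 0) (tM + h0) - X (fun=> kap) (tM + h0) - (X (gam 0) tM - X (fun=> kap) tM)| <= sig * h0 * 1.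
    apply: diff => // j; rewrite mulr1 -/cb.
    by have /andP[g1 g2] := g0 j; exact: dist_pos_le.
  rewrite mulr1 in d1; rewrite mulr1 in d2.
  have d3 : `|X (fun=> kap) tM - xt tM| <= sig * h0.
    have kap1 : kap <= 1 by exact: le_trans cb1.
    have kk : 0 < kap <= kap by rewrite kap0 lexx.
    have [x1 xl fx] := HX (fun=> kap) (fun=> kapok).
    have [H _] := schedule_close HF xtL Hpw Hvu HT (ltW eta0) (ltW eta0) kap1 (fun=> kk) xl x1 fx Hmod Hcl.
    rewrite tME -/G in H; apply: (le_trans H); move: b3 f3 c1; hclear; lra.
  have d4' : `|\sum_j (kap / m.+1%:R) *: eff j| <= sig * h0.
    apply: (le_trans (ler_norm_sum _ _ _)); apply: le_trans c2.
    rewrite /S mulr_suml; apply: ler_sum => j _; rewrite normrZ mulrC.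
    apply: ler_wpM2l => //; rewrite ger0_norm; last by rewrite divr_ge0// ltW.
    by rewrite ler_pdivrMr// ler_peMr ?(ltW kap0)// ler1n.
  have [_ d5] := Hal1 z0.
  set SA := \sum_j al j 0 *: eff j in d5.
  have sE : \sum_j ((gam 0 j - kap) / m.+1%:R) *: eff j = h0 *: SA - \sum_j (kap / m.+1%:R) *: eff j.
    by rewrite -gamE -sumrB; apply: eq_bigr => j _; rewrite mulrBl scalerBl.
  rewrite sE in d1; set Sk := \sum_j _ in d1 d4'.
  have d6 : `|X (gam 0) tM - xt tM + h0 *: (sg *: y)| <= h0 * (7 * sig + rho / 8).
    have -> : X (gam 0) tM - xt tM + h0 *: (sg *: y) =
      (X (gam 0) tM - X (fun=> kap) tM - (h0 *: SA - Sk)) + (X (fun=> kap) tM - xt tM) +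
      h0 *: (SA - (- (sg *: y) + 0)) - Sk.
      by rewrite addr0; move: (sg *: y) => w; lmod R.
    apply: (le_trans (ler_normB _ _)); apply: (le_trans (lerD (ler_normD _ _) (lexx _))).
    apply: (le_trans (lerD (lerD (ler_normD _ _) (lexx _)) (lexx _))).
    rewrite [`|h0 *: _|]normrZ (gtr0_norm h00).
    have q : h0 * `|SA - (- (sg *: y) + 0)| <= h0 * (rho / 8) by rewrite ler_wpM2l// ltW.
    by move: d1 d3 d4' q; hclear; lra.
  have [gx1 gxl gfx] := HX (gam 0) g0.
  (* The variations have displaced the trajectory at [tM] by about [- h0 *: (sg *: y)]. With [sp]
     the tail adds about [h0 *: y] and cancels this; otherwise the displacement replaces what [xt]
     still travels between [t2 - h0] and [t2]. *)
  rewrite /E tauE; move: d6; rewrite /sg; case: (boolP sp) => spE d6.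
    have tMt : tM = t2 by rewrite /tM spE.
    have := schedule_tail_close HF Hpw HT A (ltW k0) cb1 g0 gxl gfx.
    rewrite tME tMt => H; rewrite tMt in d6.
    have {}H : `|X (gam 0) (t2 + h0) - X (gam 0) t2 - h0 *: (\sum_(p <- pwT) p.1 *: F t2 (xt t2) p.2)| <=
        h0 * (k + 2 * C * cb) by apply: H => t q1 q2; rewrite -tMt; apply: regT => //; rewrite tMt.
    set Sp := \sum_(p <- pwT) _ in H HpT.
    have -> : X (gam 0) (t2 + h0) - xt t2 = (X (gam 0) (t2 + h0) - X (gam 0) t2 - h0 *: Sp) +
       (X (gam 0) t2 - xt t2 + h0 *: (1 *: y)) + h0 *: (Sp - y) by lmod R.
    apply: (le_trans (ler_normD _ _)); apply: (le_trans (lerD (ler_normD _ _) (lexx _))).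
    rewrite [`|h0 *: _|]normrZ (gtr0_norm h00).
    have q1 : h0 * `|Sp - y| <= h0 * sig by rewrite ler_wpM2l// ltW.
    have q2 : h0 * (k + 2 * C * cb) <= h0 * (2 * sig).
      by rewrite ler_wpM2l ?(ltW h00)//; move: ks a6; hclear; lra.
    have q3 : h0 * (10 * sig + rho / 8) <= h0 * (rho / 2).
      by rewrite ler_wpM2l ?(ltW h00)//; move: sigr sig0 rho0; hclear; lra.
    by move: H d6 q1 q2 q3; hclear; lra.
  have tMt : tM = t2 - h0 by rewrite /tM (negbTE spE).
  rewrite tMt in d6 *.
  have q1 : `|xt t2 - xt (t2 - h0) - h0 *: y| <= h0 * sig.
    have -> : xt t2 - xt (t2 - h0) - h0 *: y = h0 *: (h0^-1 *: (xt t2 - xt (t2 - h0)) - y).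
      by rewrite scalerBr scalerA mulfV ?scale1r// gt_eqF.
    by rewrite normrZ (gtr0_norm h00) ler_wpM2l// ltW.
  have -> : X (gam 0) (t2 - h0) - xt t2 = (X (gam 0) (t2 - h0) - xt (t2 - h0) + h0 *: (-1 *: y))
     - (xt t2 - xt (t2 - h0) - h0 *: y) by lmod R.
  apply: (le_trans (ler_normB _ _)).
  have q3 : h0 * (8 * sig + rho / 8) <= h0 * (rho / 2).
    by rewrite ler_wpM2l ?(ltW h00)//; move: sigr sig0 rho0; hclear; lra.
  by move: d6 q1 q3; hclear; lra.
- move=> a b ar br; have ga := gam_ok a ar; have gb := gam_ok b br.
  have [e1 e2] := Hal2 a b.
  have [d1 d2] : `|X (gam a) tM - X (gam b) tM - \sum_j ((gam a j - gam b j) / m.+1%:R) *: eff j| <= 5 * sig * h0 * `|a - b| /\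
    `|X (gam a) (tM + h0) - X (gam b) (tM + h0) - (X (gam a) tM - X (gam b) tM)| <= sig * h0 * `|a - b|.
    apply: diff => // j; rewrite /gam -mulrBr normrM (gtr0_norm mh0) /Ka.
    have -> : m.+1%:R * K * h0 * `|a - b| = m.+1%:R * h0 * (K * `|a - b|) by ring.
    by rewrite ler_wpM2l ?(ltW mh0).
  have sE : \sum_j ((gam a j - gam b j) / m.+1%:R) *: eff j = h0 *: \sum_j (al j a - al j b) *: eff j.
    rewrite scaler_sumr; apply: eq_bigr => j _; rewrite scalerA; congr (_ *: _).
    by rewrite /gam; field; rewrite gt_eqF.
  rewrite sE in d1; set SA := \sum_j _ in d1 e2.
  set zM := X (gam a) tM - X (gam b) tM in d1 d2.
  have d3 : `|E a - E b - zM| <= sig * h0 * `|a - b|.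
    rewrite /E tauE; case: sp => //; rewrite subrr normr0.
    exact: le_trans (normr_ge0 _) d2.
  have -> : E a - E b - h0 *: (a - b) = (E a - E b - zM) + (zM - h0 *: SA) + h0 *: (SA - (a - b)) by lmod R.
  apply: (le_trans (ler_normD _ _)); apply: (le_trans (lerD (ler_normD _ _) (lexx _))).
  rewrite [`|h0 *: _|]normrZ (gtr0_norm h00).
  have q1 : h0 * `|SA - (a - b)| <= h0 * (`|a - b| / 8) by rewrite ler_wpM2l// ltW.
  have q3 : 0 <= h0 * `|a - b| by apply: mulr_ge0 => //; exact: ltW.
  have q2 : 64 * sig * (h0 * `|a - b|) <= 1 * (h0 * `|a - b|) by rewrite ler_wpM2r.
  by move: d1 d3 q1 q2 q3; hclear; lra.
have gx := gam_ok xi xir; have [x1 xl fx] := HX _ gx.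
exists (sch (gam xi)), (X (gam xi)), h0; split.
- by split => //; move: h0e e0; hclear; lra.
- split; first by apply: steps_in_needles; [exact: okg|exact: (schedule_ok (act N) Hpw Hvu HT)].
  by rewrite (tot_schedule _ _ Hpw HT) tME tMT addrC subrK.
- by split.
- move=> t tt; rewrite tMT => ttM; apply: le_trans e'e; exact: close.
- exact: Exi.
Qed.

End steering.

(** * Step controls *)

Section step_functions.
Context {R : realType} {n r : nat}.

Lemma borel_lebesgue_measurable (A : set R) :
  measurable A -> measurable (A : set (@lebesgueR R)).
Proof.
move=> mA.
rewrite -[X in X A](_ : (completed_algebra_gen (@lebesgue_measure R)).-sigma.-measurable = _); last first.
  exact: completed_caratheodory_measurable.
rewrite g_sigma_completed_algebra_genE; exists A => //.
by exists set0; [exact: negligible_set0|rewrite setU0].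
Qed.

Lemma ae_notin (s : seq R) : {ae (@lebesgue_measure R), forall t, t \notin s}.
Proof.
have cs : countable [set` s] by apply: finite_set_countable; exact: finite_seq.
exists [set` s]; split.
- exact: countable_measurable.
- exact: countable_lebesgue_measure0.
by move=> t /= /negP; rewrite negbK.
Qed.

(** The default [u0] is the value from the end of the last step on, in particular at the right end
    point of the interval, so it will be taken in [U]. *)
Fixpoint stepf (u0 : 'rV[R]_r) (l : seq (R * 'rV[R]_r)) (a t : R) : 'rV[R]_r :=
  if l is (d, w) :: l' then (if t < a + d then w else stepf u0 l' (a + d) t) else u0.

Fixpoint breakpoints (l : seq (R * 'rV[R]_r)) (a : R) : seq R :=
  if l is (d, _) :: l' then (a + d) :: breakpoints l' (a + d) else [::].

Variable U : set 'rV[R]_r.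

Lemma stepf_in u0 l a t : U u0 -> steps_in U l -> U (stepf u0 l a t).
Proof.
move=> Uu; elim: l a => [//|[d w] l IH] a /steps_in_cons[[_ Uw] Hl] /=.
by case: ifP => // _; exact: IH.
Qed.

Lemma stepf_measurable u0 l a b c :
  lebesgue_measurable_fun `[b, c] (stepf u0 l a).
Proof.
move=> i j; apply: measurable_funTS; elim: l a => [|[d w] l IH] a /=.
  exact: measurable_cst.
rewrite (_ : (fun t => _) = (fun t : @lebesgueR R => if ((t : R) < a + d) then w i j else stepf u0 l (a + d) t i j)); last first.
  by apply/funext => t; case: ifP.
apply: measurable_fun_ifT; [|exact: measurable_cst|exact: IH].
apply: (measurable_fun_bool true).
rewrite setTI (_ : _ @^-1` _ = `]-oo, a + d[%classic).
  by apply: borel_lebesgue_measurable; exact: measurable_itv.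
by apply/seteqP; split => t /=; rewrite in_itv.
Qed.

Lemma breakpoints_path l a : steps_in U l ->
  path <%O a (breakpoints l a) /\ last a (breakpoints l a) = a + tot l.
Proof.
elim: l a => [|[d w] l IH] a; first by rewrite /tot big_nil addr0.
move=> /steps_in_cons[[/= d0 _] /(IH (a + d))[-> ->]].
by rewrite ltrDl d0 tot_cons /= addrA.
Qed.

Lemma stepf_piecewise u0 l a : steps_in U l ->
  piecewise_constant a (a + tot l) (stepf u0 l a).
Proof.
move=> Hl; have [bp bl] := breakpoints_path a Hl.
exists (breakpoints l a); first by split => //; apply/eqP.
move: (a + tot l) => b; elim: l a Hl {bp bl} => [//|[d w] l IH] a.
move=> /steps_in_cons[[/= d0 _] Hl] [|i] /=.
  by move=> _; exists w => t; rewrite in_itv/= => /andP[_ ->].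
rewrite ltnS => il; have [c Hc] := IH _ Hl i il; exists c => t tI.
suff -> : t < a + d = false by exact: Hc.
apply/negbTE; rewrite -leNgt; move: tI; rewrite in_itv/= => /andP[ti _].
apply: le_trans (ltW ti); case: i il {Hc ti} => [//|i] il /=.
have [bp _] := breakpoints_path (a + d) Hl.
have := order_path_min lt_trans bp => /allP; move=> /(_ (nth b (breakpoints l (a + d)) i)).
by rewrite mem_nth ?(ltnW il)// => /(_ isT) /ltW.
Qed.

Lemma stepf_pc_control u0 l a : U u0 -> compact U -> steps_in U l ->
  pc_control U a (a + tot l) (stepf u0 l a).
Proof.
move=> Uu cU Hl; split; last exact: stepf_piecewise.
have [B B0 HB] := compact_bound cU (@norm_continuous R 'rV[R]_r).
have F := ae_filter_ringOfSetsType (@lebesgue_measure R).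
split; first exact: stepf_measurable.
  exists B; apply: (@filterE _ _ F) => t _; rewrite -normr_id; apply: HB; exact: stepf_in.
by apply: (@filterE _ _ F) => t _; exact: stepf_in.
Qed.

Lemma follows_stepf (F : R -> 'rV[R]_n -> 'rV[R]_r -> 'rV[R]_n) u0 l a x :
  steps_in U l -> follows F l a x -> forall t, a < t -> t < a + tot l ->
  t \notin breakpoints l a -> is_derive t 1 x (F t (x t) (stepf u0 l a t)).
Proof.
elim: l a => [|[d w] l IH] a.
  by move=> _ _ t; rewrite /tot big_nil addr0 => /lt_trans h /h; rewrite ltxx.
move=> /steps_in_cons[[/= d0 _] Hl] [fx fl] t at_.
rewrite tot_cons /= addrA => tb; rewrite inE negb_or => /andP[tad tbp].
case: ifPn => tl; first exact: fx.
by apply: IH => //; rewrite lt_neqAle eq_sym tad leNgt.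
Qed.

Lemma convex_comb_self N a b u : (0 < N)%N -> pc_control U a b u ->
  convex_comb_pc_controls U N a b u.
Proof.
move=> N0 hu; exists 1%N, (fun=> 1), (fun=> u); split => //.
- by split => //; rewrite big_ord1.
- by move=> t _; rewrite big_ord1 scale1r.
Qed.

End step_functions.

Lemma lip_on_le (R : realType) (V : normedModType R) (a b C C' : R) (x : R -> V) :
  C <= C' -> lip_on a b C x -> lip_on a b C' x.
Proof.
move=> CC xL p q ap pq qb; apply: (le_trans (xL p q ap pq qb)).
by rewrite ler_wpM2r// subr_ge0.
Qed.

Lemma weights_norm (R : realType) (T : eqType) n (U : set T) (s : seq (R * T))
    (E : T -> 'rV[R]_n) (e : R) :
  weights U s -> (forall u, U u -> `|E u| <= e) -> `|\sum_(p <- s) p.1 *: E p.2| <= e.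
Proof.
move=> [s1 s2] HE; apply: (le_trans (ler_norm_sum _ _ _)).
have -> : e = \sum_(p <- s) p.1 * e by rewrite -mulr_suml s2 mul1r.
rewrite !big_seq; apply: ler_sum => p /s1[p0 Up].
by rewrite normrZ gtr0_norm// ler_pM2l// HE.
Qed.

(** Backward slopes near [t2] are almost convex combinations of velocities at [t2 - h]; by
    equicontinuity the same weights work at [t2], and some of these slopes are close to [y]. *)
Lemma end_slope_hull (R : realType) n r (U : set 'rV[R]_r)
    (g : R -> 'rV[R]_r -> 'rV[R]_n) (t1 t2 : R) (xh : R -> 'rV[R]_n) (y : 'rV[R]_n) :
  (t1 < t2) /\ True ->
  (forall eta : R, 0 < eta -> exists2 d : R, 0 < d & forall a b,
    t1 <= a -> a < b -> b <= t2 -> b - a <= d -> exists2 s, weights U s &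
      `|\sum_(p <- s) p.1 *: g a p.2 - (b - a)^-1 *: (xh b - xh a)| <= eta) ->
  (forall w : R, 0 < w -> exists2 d : R, 0 < d & forall s t u,
     t1 <= s -> s <= t2 -> t1 <= t -> t <= t2 -> U u -> `|s - t| < d -> `|g s u - g t u| <= w) ->
  end_slope t1 t2 xh y ->
  forall e : R, 0 < e -> exists2 s, weights U s & `|\sum_(p <- s) p.1 *: g t2 p.2 - y| <= e.
Proof.
move=> t12 hull gc Hy e e0; have [t12' _] := t12.
have e30 : 0 < e / 3 by rewrite divr_gt0.
have [d1 d10 Hd1] := hull _ e30; have [d2 d20 Hd2] := gc _ e30.
have dd : 0 < Order.min d1 d2 by rewrite lt_min d10.
have [p0 Hp0] := dyadic_step_lim t12 dd.
have [p p0p] := Hy _ p0 e30; set h := _ / 2 ^+ p; cbv zeta => Hp.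
have h0 : 0 < h by exact: dyadic_step.
have := Hp0 p p0p; rewrite -/h lt_min => /andP[hd1 hd2].
have t1h : t1 <= t2 - h.
  by rewrite lerBrDl -lerBrDr; exact: dyadic_step_le.
have ht2 : t2 - h < t2 by rewrite gtrBl.
have thE : t2 - (t2 - h) = h by rewrite subKr.
have [|s sw Hs] := Hd1 (t2 - h) t2 t1h ht2 (lexx _); first by rewrite thE ltW.
exists s => //; rewrite thE in Hs.
have q : `|\sum_(p <- s) p.1 *: (g t2 p.2 - g (t2 - h) p.2)| <= e / 3.
  apply: (@weights_norm _ _ _ _ _ (fun u => g t2 u - g (t2 - h) u) _ sw) => u Uu; apply: Hd2 => //; [exact: ltW|exact: ltW|].
  by rewrite thE gtr0_norm.
have -> : \sum_(p <- s) p.1 *: g t2 p.2 - y = \sum_(p <- s) p.1 *: (g t2 p.2 - g (t2 - h) p.2) +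
   (\sum_(p <- s) p.1 *: g (t2 - h) p.2 - h^-1 *: (xh t2 - xh (t2 - h))) +
   (h^-1 *: (xh t2 - xh (t2 - h)) - y).
  have -> : \sum_(p <- s) p.1 *: (g t2 p.2 - g (t2 - h) p.2) =
     \sum_(p <- s) p.1 *: g t2 p.2 - \sum_(p <- s) p.1 *: g (t2 - h) p.2.
    by rewrite -sumrB; apply: eq_bigr => i _; rewrite scalerBr.
  by hclear; lmod R.
apply: (le_trans (ler_normD _ _)); apply: (le_trans (lerD (ler_normD _ _) (lexx _))).
by move: q Hs Hp; hclear; lra.
Qed.

Lemma within_continuous_right (R : realType) (V : normedModType R) (a b c : R) (x : R -> V) :
  a <= b -> b <= c -> {within `[a, c], continuous x} -> forall e : R, 0 < e ->
  exists2 d : R, 0 < d & forall t, b <= t -> t <= c -> t - b < d -> `|x t - x b| <= e.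
Proof.
move=> ab bc /subspace_continuousP cx e e0.
have /cvgrPdist_le /(_ e e0) : x t @[t --> within `[a, c] (nbhs b)] --> x b.
  by apply: cx; rewrite /= in_itv/= ab.
move=> /nbhs_ballP[d /= d0 Hd]; exists d => // t bt tc tb.
rewrite distrC; apply: Hd.
  by rewrite -ball_normE /= distrC ger0_norm ?subr_ge0.
by rewrite /= in_itv/= tc (le_trans ab bt).
Qed.

Theorem theorem5p1 (R : realType) (n r : nat)
    (f : R -> 'rV[R]_n -> 'rV[R]_r -> 'rV[R]_n) (U : set 'rV[R]_r)
    (t1 t2h dh : R) (x1 : 'rV[R]_n)
    (xh : R -> 'rV[R]_n) (muh : R -> probability (@borel_rV R r) R) (s : R)
    (hf : continuous_with_fx_fxx f)
    (hU0 : U !=set0) (hUc : compact U)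
    (ht : t1 < t2h)
    (hadm : admissible_pair f U t1 t2h x1 xh muh)
    (hs : s = -1 \/ s = 1)
    (hdh : 0 < dh)
    (hext : s = 1 -> {within `[t1, t2h + dh], continuous xh})
    (hLambda : Lambda f U s t1 t2h xh muh = set0)
    (hgrowth : exists2 L : R, 0 < L &
       forall (t : R) (x : 'rV[R]_n) (u : 'rV[R]_r), t \in `[t1, t2h] -> U u ->
         op_norm (fx f t x u) <= L * (1 + `|x|))
    (hunif : unif_continuous_on_compacts f U) :
  exists2 delta : R, 0 < delta &
    forall eps : R, 0 < eps ->
      exists (ueps : R -> 'rV[R]_r) (tau : R) (xeps : R -> 'rV[R]_n),
        let T := Num.max t2h tau in
        [/\ t1 <= tau /\ (s = 1 -> tau <= t2h + dh),
            `|tau - t2h| < eps,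
            pc_control U t1 T ueps,
            trajectory f t1 T x1 ueps xeps
          & [/\ C_norm t1 T (fun t => xeps t - xh t) < eps,
                xeps tau = xh t2h,
                (s = -1 -> tau < t2h) /\ (s = 1 -> t2h < tau)
              & convex_comb_pc_controls U n.+1 t1 T ueps]].
Proof.
exists 1; first exact: ltr01.
move=> eps eps0.
have t12 : (t1 < t2h) /\ True by [].
have [u0 Uu0] := hU0.
have [sp sE] : exists sp : bool, s = if sp then 1 else -1.
  by have [->|->] := hs; [exists false|exists true].
have [_ _ _ xh1] := hadm.
have [B [C1 [C10 HB xL fC]]] := pair_lip hf hUc t12 hadm.
have [C2 [W [C20 WL dW]]] := pair_primitive hf hUc t12 hadm.
have [L [Psi [L0 Psi2 PsiL PsiB HPsi]]] := adjoint_flow t12 C20 WL.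
have [y Hy] := slope_limit t12 C10 xL.
have [cf [_ cfx] _] := hf.
have gc (w : R) : 0 < w -> exists2 d : R, 0 < d & forall s t u,
     t1 <= s -> s <= t2h -> t1 <= t -> t <= t2h -> U u -> `|s - t| < d ->
     `|f s (xh s) u - f t (xh t) u| <= w.
  move=> w0; have [d d0 Hd] := compact_uniform t1 t2h B cf hUc w0.
  have C11 : 0 < C1 + 1 by rewrite ltr_wpDl.
  exists (Order.min d (d / (C1 + 1))); first by rewrite lt_min d0 divr_gt0.
  move=> a b u ta at2 tb bt2 Uu; rewrite lt_min => /andP[ab1 ab2].
  apply: (Hd a b (xh a) (xh b) u); rewrite ?ta ?tb ?HB//; first exact: ltW.
  have H p q : t1 <= p -> p <= q -> q <= t2h -> `|p - q| < d / (C1 + 1) -> `|xh q - xh p| <= d.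
    move=> tp pq qt; rewrite distrC ger0_norm ?subr_ge0// ltr_pdivlMr// => h.
    apply: (le_trans (xL p q tp pq qt)); apply: le_trans (ltW h).
    by have : 0 <= q - p by [rewrite subr_ge0]; hclear; lra.
  have [ab|ba] := leP a b; first by rewrite distrC; exact: H.
  by apply: H => //; [exact: ltW|rewrite distrC].
have /choice[V HV] : forall u, exists V : R -> 'rV[R]_n, U u ->
    (exists2 C', 0 <= C' & lip_on t1 t2h C' V) /\
    variation_increments t1 t2h xh Psi (fun t => f t (xh t) u) V.
  move=> u; have [Uu|nU] := pselect (U u); last by exists (fun=> 0).
  have [||C' [V [C'0 VL HV]]] := @variation_primitive R n t1 t2h xh t12 C1 L Psi (fun t => f t (xh t) u)
    C10 L0 xL PsiL PsiB.
  - by move=> t tt tt2; have [] := fC t u tt tt2 Uu.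
  - move=> w w0; have [d d0 Hd] := gc w w0; exists d => // a b ta at2 tb bt2 ab.
    exact: Hd.
  by exists V => _; split => //; exists C'.
(* The reference curve is frozen after [t2h]: for [s = 1] the steering runs beyond this time, where
   no relaxed motion is given. *)
pose xt := xh \o clamp t1 t2h.
have xtE t : t1 <= t -> t <= t2h -> xt t = xh t by move=> h1 h2; rewrite /xt /= clamp_id.
have xt2 : xt t2h = xh t2h by apply: xtE; rewrite ?lexx// ltW.
have xtL a b : lip_on a b C1 xt by exact: lip_clamp.
have xtB t : `|xt t| <= B by have [c1 c2] := clamp_in t12 t; exact: HB.
have [C3 [HF approxF equiF]] := @regularize R n r f U xt t1 (t2h + 1) B C1 hf hUc C10
  (fun t _ _ => xtB t) (xtL _ _).
(* One constant for all bounds: [n%:R * L] serves for products with [Psi], and the norm of [C3]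
   makes every summand nonnegative. *)
pose C := 1 + C1 + (n%:R + 1) * L + `|C3|.
have nL0 : 0 <= n%:R * L by rewrite mulr_ge0.
have CC1 : C1 <= C by rewrite /C; move: L0 nL0 (normr_ge0 C3); hclear; lra.
have CL : L <= C by rewrite /C; move: C10 L0 nL0 (normr_ge0 C3); hclear; lra.
have CnL : n%:R * L <= C by rewrite /C; move: C10 L0 nL0 (normr_ge0 C3); hclear; lra.
have CC3 : C3 <= C by rewrite /C; move: C10 L0 nL0 (ler_norm C3); hclear; lra.
have C1C : 1 <= C /\ True by split => //; rewrite /C; move: C10 L0 nL0 (normr_ge0 C3); hclear; lra.
have C0 : 0 <= C /\ True by split => //; exact: le_trans CC1.
clearbody C.
have {}HF : regular_field (clipped f xt) U (jac f xt) t1 (t2h + 1) C /\ True by split => //; exact: HF.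
have xLC := lip_on_le CC1 xL.
have PLC := lip_on_le CL PsiL.
have PBC t : t1 <= t -> t <= t2h -> `|Psi t| <= C.
  by move=> h1 h2; exact: le_trans (PsiB t h1 h2) CL.
have PBz t (z : 'rV[R]_n) : t1 <= t -> t <= t2h -> `|z *m Psi t| <= C * `|z|.
  move=> h1 h2; apply: (le_trans (mulmx_norm_le _ _)); rewrite mulrAC.
  rewrite ler_wpM2r//; apply: le_trans CnL; by rewrite ler_wpM2l// PsiB.
have fCC t u : t1 <= t -> t <= t2h -> U u -> `|f t (xh t) u| <= C.
  by move=> h1 h2 Uu; have [h3 _] := fC t u h1 h2 Uu; exact: le_trans h3 CC1.
have [[rho0 rho00 Hreach]|[Lv Lv0 [Lvy HLv]]] :=
  cone_dichotomy (- (s *: y)) (variation_cone_cone U t1 t2h V); last first.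
  have sL : s * mdot Lv y <= 0 by move: Lvy; rewrite mdotNr mdotZr oppr_ge0.
  have := adjoint_in_Lambda hf hU0 hUc t12 hadm C0 xLC fCC dW Psi2 PLC PBC HPsi HV Hy HLv Lv0 sL.
  by rewrite hLambda.
(* The default variation runs between equal times and therefore has no effect. *)
have [|||m [v [al [rho [K [rhoK hv Hal1 Hal2]]]]]] := @affine_variations R n (nat * nat * nat * 'rV[R]_r)%type
   (fun v => variation_ok U (1, v)) (fun v => effect t1 t2h V (1, v)) (0%N, 0%N, 0%N, u0)
   (- (s *: y)) rho0 rho00.
- by split; rewrite ?expn0.
- by rewrite /effect subrr.
- move=> q qr e e0; have [_ [vs hvs ->] qe] := Hreach q qr e e0.
  exists vs.
    move=> [c [[[p i] j] u]] /hvs /= [c0 Uu ij jp]; split => //.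
  rewrite (eq_bigr (fun q => q.1 *: effect t1 t2h V q))//.
  by move=> [c [[[p i] j] u]] _.
have hull := pair_hull hf hU0 hUc t12 hadm C20 WL dW.
have cells := @grid_cells R n r m f U t1 t2h xh C W Psi V v t12 C1C hU0 xLC hull PLC PBz HPsi
  (fun u Uu => (HV u Uu).2) hv HF equiF.
have dVsum : exists P0, forall P N, (P0 <= P)%N -> (P <= N)%N -> forall j,
   \sum_(i < grid_size sp P N) increment t1 t2h V v N i j = effect t1 t2h V (1, v j).
  (* From the finest level of the variations on, all their end points are grid nodes. The strict
     inequality in [variation_ok] leaves a step before [t2h] free, so that the variations also fit
     into a grid which stops at [t2h - step P]. *)
  exists (\max_j (v j).1.1.1)%N => P N P0P PN j.
  have jP : ((v j).1.1.1 <= P)%N by apply: leq_trans P0P; exact: leq_bigmax.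
  apply: (increment_sum t1 t2h V hv); first exact: leq_trans PN.
  have := hv j; move: jP; case: (v j) => [[[p a] b] u] /= jP [_ _ _ bp].
  have pN := leq_trans jP PN.
  have NE : (2 ^ N = 2 ^ p * 2 ^ (N - p))%N by rewrite -expnD subnKC.
  rewrite /grid_size; case: (sp); first by rewrite NE leq_pmul2r ?expn_gt0// ltnW.
  rewrite leq_subRL ?leq_pexp2l ?leq_subr//.
  apply: (@leq_trans (2 ^ (N - p) + b * 2 ^ (N - p))).
    by rewrite leq_add2r leq_pexp2l// leq_sub2l.
  by rewrite -mulSn NE leq_pmul2r ?expn_gt0.
have clipE t u : clipped f xt t (xt t) u = f t (xt t) u by rewrite /clipped clip_self.
have tails (e : R) : 0 < e -> exists2 pwT, weights U pwT &
    `|\sum_(p <- pwT) p.1 *: clipped f xt t2h (xt t2h) p.2 - y| <= e.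
  move=> e0.
  have hull' (eta : R) : 0 < eta -> exists2 d : R, 0 < d & forall a b,
    t1 <= a -> a < b -> b <= t2h -> b - a <= d -> exists2 s, weights U s &
      `|\sum_(p <- s) p.1 *: f a (xh a) p.2 - (b - a)^-1 *: (xh b - xh a)| <= eta.
    move=> eta0; have [d d0 Hd] := hull eta eta0; exists d => // a b ta ab bt bad.
    by have [w [h1 h2 _]] := Hd a b ta ab bt bad; exists w.
  have [w hw Hw] := end_slope_hull t12 hull' gc Hy e0.
  exists w => //; rewrite xt2; under eq_bigr do rewrite -xt2 clipE xt2; exact: Hw.
have slope : end_slope t1 t2h xt y.
  move=> e p0 e0; have [p pp Hp] := Hy e p0 e0; exists p => //=.
  rewrite xt2 xtE//; last by rewrite gerBl ltW// dyadic_step.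
  by rewrite lerBrDl -lerBrDr; exact: dyadic_step_le.
have Hvu j : U (v j).2 by have := hv j; case: (v j) => [[[p a] b] u] [].
have [dx dx0 Hdx] : exists2 d : R, 0 < d & s = 1 -> forall t, t2h <= t -> t <= t2h + dh ->
    t - t2h < d -> `|xh t - xh t2h| <= eps / 4.
  have [s1|s1] := pselect (s = 1); last by exists 1.
  have e40 : 0 < eps / 4 by rewrite divr_gt0.
  have [|d d0 Hd] := within_continuous_right (ltW ht) _ (hext s1) e40; first by rewrite lerDl ltW.
  by exists d.
(* The bound 1 makes clipping ineffective along the trajectory, [eps / 4] is the wanted precision,
   [dx] and [dh] keep the final time where [xh] is controlled for [s = 1], and [t2h - t1] keeps it
   after [t1] for [s = -1]. *)
pose e := Order.min (Order.min 1 (eps / 4)) (Order.min (Order.min dx dh) (t2h - t1)).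
have e0 : 0 < e by rewrite !lt_min ltr01 divr_gt0// dx0 hdh subr_gt0.
have : e <= e by []; rewrite {2}/e !le_min => /andP[/andP[e1 e2] /andP[/andP[e3 e4] e5]].
clearbody e.
rewrite sE in Hal1.
have [l [x [h0 [[h00 h0e] [Hl totl] [xLip x1E fx] xclose xtau]]]] :=
  @steer R n r m (clipped f xt) U xt (jac f xt) t1 t2h C W Psi (fun j => (v j).2)
   (active v) (increment t1 t2h V v) (fun j => effect t1 t2h V (1, v j)) y sp al rho K
   t12 HF equiF approxF (fun a b => lip_on_le CC1 (xtL a b)) Psi2 PLC Hvu cells dVsum tails slope
   (conj rhoK I) Hal1 Hal2 e e0.
set tau := if sp then t2h + h0 else t2h - h0 in totl xclose xtau.
have tT : t1 < Order.max t2h tau by rewrite lt_max ht.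
have xt1 : xt t1 = x1 by rewrite xtE ?lexx// ltW.
exists (stepf u0 l t1), tau, x; rewrite -totl; cbv zeta.
have pcu := stepf_pc_control t1 Uu0 hUc Hl.
split.
- rewrite /tau sE; case: (sp); split.
  + by rewrite (le_trans (ltW ht))// lerDl ltW.
  + by move=> _; rewrite lerD2l; move: h0e e4; hclear; lra.
  + by move: h0e e5; hclear; lra.
  + by move=> /eqP; rewrite lt_eqF// (lt_trans _ ltr01)// oppr_lt0.
- have -> : `|tau - t2h| = h0.
    rewrite /tau; case: (sp); first by rewrite addrAC subrr add0r gtr0_norm.
    by rewrite addrAC subrr sub0r normrN gtr0_norm.
  by move: h0e e2 eps0; hclear; lra.
- exact: pcu.
- split.
  + by apply: (@lip_on_ac _ _ _ _ C); [have [] := C0|exact: xLip].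
  + have N := @ae_notin R (breakpoints l t1).
    apply: (ae_imp2 N N) => t tb _; rewrite in_itv/= => /andP[t1t tT'].
    (* [e <= 1] keeps the trajectory in the unit ball around [xt], where the clipped field is [f]
       itself. *)
    have := follows_stepf u0 Hl fx t1t tT' tb; rewrite /clipped clip_id//.
    apply: le_trans e1; apply: xclose; first exact: ltW.
    by rewrite -totl ltW.
  + by rewrite x1E.
split.
(* Up to [t2h] the curve [xt] is [xh]. Beyond, it is frozen, and the continuity of [xh] to the right
   of [t2h] supplies another [eps / 4]. *)
- have CB t : t \in `[t1, t1 + tot l] -> `|x t - xh t| <= eps / 2.
    rewrite totl in_itv/= => /andP[t1t tT'].
    have q1 := xclose t t1t tT'.
    have [tt2|tt2] := leP t t2h.
      by rewrite -(xtE t t1t tt2); move: q1 e2 eps0; hclear; lra.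
    have spT : sp by move: tT'; rewrite /tau; case: (sp) => //; rewrite le_max !leNgt tt2 /=;
      rewrite (lt_trans _ tt2)// gtrBl.
    have s1 : s = 1 by rewrite sE spT.
    have tt : t <= t2h + h0.
      by move: tT'; rewrite /tau spT le_max leNgt tt2.
    have q2 : `|xh t - xh t2h| <= eps / 4.
      apply: (Hdx s1); first exact: ltW.
        by move: tt h0e e4; hclear; lra.
      by move: tt h0e e3; hclear; lra.
    have xtt : xt t = xh t2h.
      rewrite /xt /= /clamp (min_idPr (ltW tt2)); congr xh; apply/max_idPr; exact: ltW.
    have -> : x t - xh t = (x t - xt t) - (xh t - xh t2h) by rewrite xtt; hclear; lmod R.
    by apply: (le_trans (ler_normB _ _)); move: q1 q2 e2; hclear; lra.
  apply: (@le_lt_trans _ _ (eps / 2)); last by move: eps0; hclear; lra.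
  apply: ge_sup.
    by exists `|x t1 - xh t1|, t1 => //; rewrite /= in_itv/= lexx totl ltW.
  by move=> _ [t tI <-]; exact: CB.
- by rewrite xtau.
- rewrite /tau sE; case: (sp); split => //.
  + by move=> /esym/eqP; rewrite lt_eqF// (lt_trans _ ltr01)// oppr_lt0.
  + by rewrite ltrDl.
  + by rewrite gtrBl.
  + by move=> /eqP; rewrite lt_eqF// (lt_trans _ ltr01)// oppr_lt0.
(* The control is piecewise constant with values in [U], hence a combination with a single term. *)
- exact: convex_comb_self.
Qed.
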